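(* Let $k$ be a field of characteristic not $2$, let $\mathfrak{g}$ be a Lie algebra over $k$, let $\Lambda^1$ be a right $\mathfrak{g}$-module regarded as a right $U(\mathfrak{g})$-crossed module with trivial coaction, and let $\omega\in Z^1(\mathfrak{g},\Lambda^1)$ be a $1$-cocycle, extended to a crossed module morphism $\omega:U(\mathfrak{g})^+\to\Lambda^1$ by $\omega(x\xi)=\omega(x)\triangleleft\xi$ for $x\in U(\mathfrak g)^+$, $\xi\in\mathfrak g$. Then the `generalised Woronowicz calculus' extending the first order calculus with $v\xi-\xi v=v\triangleleft\xi$ and $\mathrm{d}\xi=\omega(\xi)$ ($v\in\Lambda^1$, $\xi\in\mathfrak{g}$) is a strongly bicovariant differential exterior algebra $\Omega(U(\mathfrak{g}))=U(\mathfrak{g})\#\Lambda(\Lambda^1)$ with $\Lambda(\Lambda^1)$ the usual Grassmann algebra on $\Lambda^1$ and $\delta=0$. Augmentations on this correspond to $\mathfrak{g}$-module maps $i:\Lambda^1\to\mathfrak{g}$, where $\mathfrak{g}$ has the right adjoint action, obeying $v\triangleleft i(v)=0$ for all $v\in\Lambda^1$. The Lie derivative $\mathcal{L}=\mathrm{d}i+i\mathrm{d}$ is given by $\mathcal{L}\xi=i(\omega(\xi))$ and $\mathcal{L}v=\omega(i(v))$ on $\xi\in\mathfrak{g}$ and $v\in\Lambda^1$. The canonical choice is $\Lambda^1=\mathfrak{g}$ (with the right adjoint action) with augmentation the inclusion $i:\mathfrak{g}\hookrightarrow U(\mathfrak{g})^+$.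
   Context: A $1$-cocycle is a linear map $\omega:\mathfrak{g}\to\Lambda^1$ with $\omega([\xi,\eta])=\omega(\xi)\triangleleft\eta-\omega(\eta)\triangleleft\xi$. $U(\mathfrak{g})^+=\ker\epsilon$, $\pi(a)=a-\epsilon(a)1$. $\Lambda(\Lambda^1)$ is a super-Hopf algebra with $\Lambda^1$ odd and primitive (it is $B_-(\Lambda^1)$, the quotient of the tensor algebra by the kernels of the antisymmetrisers for the flip braiding). $U(\mathfrak{g})\#\Lambda(\Lambda^1)$ is $U(\mathfrak{g})\otimes\Lambda(\Lambda^1)$ with the cross product algebra $(a\otimes\eta)(b\otimes\zeta)=ab_{(1)}\otimes(\eta\triangleleft b_{(2)})\zeta$ and tensor product super-coalgebra. The differential is $\mathrm{d}(a\otimes\eta)=a_{(1)}\otimes\omega(\pi(a_{(2)}))\eta+a\otimes\delta\eta$, where $\delta$ is the restriction of $\mathrm{d}$ to $\Lambda(\Lambda^1)$. A strongly bicovariant differential exterior algebra over a Hopf algebra $A$ is a graded super-Hopf algebra $\Omega$ with $\Omega^0=A$ (parity given by degree) and a degree $1$ map $\mathrm{d}$, $\mathrm{d}^2=0$, that is a super-derivation and a super-coderivation ($\Delta\mathrm{d}=(\mathrm{d}\otimes\mathrm{id}+(-1)^{|\ |}\otimes\mathrm{d})\Delta$). An augmentation is a degree $-1$ map $i:\Omega\to\Omega$, $i^2=0$, which is a super-derivation and a super-coderivation ($\Delta i=(i\otimes\mathrm{id}+(-1)^{|\ |}\otimes i)\Delta$); it is determined by its restriction $i:\Lambda^1\to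 U(\mathfrak{g})^+$ to $1\otimes\Lambda^1$.
   Formalization: That every augmentation comes from a 𝔤-module map Λ¹→𝔤 is proved when k has characteristic 0 or the augmentation sends Λ¹ into 𝔤; in characteristic p>2 it fails in general, since x^p is primitive in U(𝔤) (e.g. 𝔤=kx, Λ¹=kv trivial, i(v)=x^p). *)

(* Defs.v *)
From HB Require Import structures.
From mathcomp Require Import all_boot all_algebra.
From mathcomp Require Import perm.
From mathcomp Require Import finmap monalg.
From mathcomp Require Import mathcomp_extra boolp classical_sets functions.
From mathcomp Require Import cardinality fsbigop.

Set Implicit Arguments.
Unset Strict Implicit.
Unset Printing Implicit Defensive.

Import GRing.Theory.
Local Open Scope ring_scope.
Local Open Scope quotient_scope.

Definition bilin (k : fieldType) (U V W : lmodType k) (f : U -> V -> W) : Prop :=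
  (forall v, linear (f^~ v)) /\ (forall u, linear (f u)).

Inductive span (k : fieldType) (V : lmodType k) (G : V -> Prop) : V -> Prop :=
| span0 : span G 0
| spanS c x y : G x -> span G y -> span G (c *: x + y).

Section QuotientModule.
Variables (k : fieldType) (V : lmodType k) (G : V -> Prop).

Definition spanb : {pred V} := fun x => `[< span G x >].

Lemma spanbP x : reflect (span G x) (x \in spanb).
Proof. exact: asboolP. Qed.

Lemma span_incl x : G x -> span G x.
Proof. by move=> Gx; rewrite -[x]scale1r -[_ *: _]addr0; apply: spanS => //; exact: span0. Qed.

Lemma spanZD c x y : span G x -> span G y -> span G (c *: x + y).
Proof.
move=> Sx Sy; elim: Sx => [|b u v Gu _ IH]; first by rewrite scaler0 add0r.
by rewrite scalerDr scalerA -addrA; apply: spanS.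
Qed.

Lemma spanb_submod : submod_closed spanb.
Proof.
split; first by apply/spanbP; exact: span0.
by move=> c x y /spanbP Sx /spanbP Sy; apply/spanbP; exact: spanZD.
Qed.

HB.instance Definition _ := GRing.isSubmodClosed.Build k V spanb spanb_submod.

Definition qmod := Quotient.quot spanb.

HB.instance Definition _ := GRing.Zmodule.copy qmod (Quotient.quot spanb).

Definition qpi (x : V) : qmod := \pi_qmod x.

Lemma qpiE x y : qpi x = qpi y <-> span G (x - y).
Proof.
split; first by move/eqP; rewrite /qpi -Quotient.idealrBE => /spanbP.
by move=> h; apply/eqP; rewrite -Quotient.idealrBE; apply/spanbP.
Qed.

Lemma qpiK (x : qmod) : qpi (generic_quotient.repr x) = x.
Proof. exact: reprK. Qed.

Lemma qpiD x y : qpi (x + y) = qpi x + qpi y.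
Proof. by rewrite /qpi !piE. Qed.

Definition qscale (c : k) (x : qmod) : qmod := qpi (c *: generic_quotient.repr x).

Lemma qpiZ c x : qpi (c *: x) = qscale c (qpi x).
Proof.
apply/qpiE; rewrite -scalerBr -[_ *: _]addr0; apply: spanZD; last exact: span0.
by apply/qpiE; rewrite qpiK.
Qed.

Fact qscaleA a b x : qscale a (qscale b x) = qscale (a * b) x.
Proof. by rewrite -(qpiK x) -!qpiZ scalerA. Qed.
Fact qscale1 : left_id 1 qscale.
Proof. by move=> x; rewrite -(qpiK x) -qpiZ scale1r. Qed.
Fact qscaleDr : right_distributive qscale +%R.
Proof. by move=> c x y; rewrite -(qpiK x) -(qpiK y) -qpiD -!qpiZ scalerDr qpiD. Qed.
Fact qscaleDl x : {morph qscale^~ x : a b / a + b}.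
Proof. by move=> a b; rewrite -(qpiK x) -!qpiZ scalerDl qpiD. Qed.

HB.instance Definition _ :=
  GRing.Zmodule_isLmodule.Build k qmod qscaleA qscale1 qscaleDr qscaleDl.

Lemma qpi_linear : linear qpi.
Proof. by move=> c x y; rewrite qpiD qpiZ. Qed.

End QuotientModule.

(* The linear extension of f to the free module on K. *)
Definition flin (k : fieldType) (K : choiceType) (W : lmodType k) (f : K -> W)
  (x : {malg k[K]}) : W := \sum_(m <- msupp x) x@_m *: f m.

(* The map induced by [flin f] on a quotient of the free module on K; it is
   computed on a representative, so it is meaningful when [flin f] vanishes on
   the relators, in which case [qliftE] is its universal property. *)
Definition qlift (k : fieldType) (K : choiceType) (G : {malg k[K]} -> Prop)
  (W : lmodType k) (f : K -> W) (x : qmod G) : W := flin f (generic_quotient.repr x).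

Section Lift.
Variables (k : fieldType) (K : choiceType) (W : lmodType k) (f : K -> W).

Lemma flinEw (d : {fset K}) (x : {malg k[K]}) :
  (msupp x `<=` d)%fset -> flin f x = \sum_(m <- d) x@_m *: f m.
Proof.
move=> le; rewrite /flin; apply: (big_fset_incl _ le) => m _ /mcoeff_outdom ->.
by rewrite scale0r.
Qed.

Lemma flin_linear : linear (flin f).
Proof.
move=> c x y.
pose d := (msupp x `|` msupp y `|` msupp (c *: x + y))%fset.
rewrite !(@flinEw d).
- rewrite scaler_sumr -big_split /=; apply: eq_bigr => m _.
  by rewrite mcoeffD mcoeffZ scalerDl scalerA.
- by rewrite /d fsubsetU // fsubsetUr.
- by rewrite /d fsubsetU // fsubsetUl.
- by rewrite /d fsubsetUr.
Qed.

HB.instance Definition _ :=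
  GRing.isLinear.Build k {malg k[K]} W *:%R (flin f) flin_linear.

Lemma flinU m : flin f << m >> = f m.
Proof. by rewrite (@flinEw [fset m]%fset) ?msuppU_le // big_seq_fset1 mcoeffUU scale1r. Qed.

Lemma qliftE (G : {malg k[K]} -> Prop) :
  (forall x, G x -> flin f x = 0) ->
  linear (qlift (G := G) f) /\ (forall x, qlift f (qpi G x) = flin f x).
Proof.
move=> fG.
have fS x : span G x -> flin f x = 0.
  by elim=> [|c u v Gu _ IH]; [rewrite raddf0|rewrite linearP /= fG // IH scaler0 addr0].
have E x : qlift f (qpi G x) = flin f x.
  have /qpiE/fS : qpi G (generic_quotient.repr (qpi G x)) = qpi G x by rewrite qpiK.
  by rewrite raddfB => /eqP; rewrite subr_eq0 => /eqP.
split=> // c x y; rewrite -(qpiK x) -(qpiK y).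
by rewrite -(qpi_linear G) !E linearP.
Qed.

End Lift.

Section Tensor.
Variable k : fieldType.

Inductive tensor_rel (V W : lmodType k) : {malg k[(V * W)%type]} -> Prop :=
| tensor_rel_l c v v' w :
    tensor_rel (<<(c *: v + v', w)>> - c *: <<(v, w)>> - <<(v', w)>>)
| tensor_rel_r c v w w' :
    tensor_rel (<<(v, c *: w + w')>> - c *: <<(v, w)>> - <<(v, w')>>).

Definition tensor (V W : lmodType k) : lmodType k := qmod (@tensor_rel V W).

Definition tpure (V W : lmodType k) (v : V) (w : W) : tensor V W :=
  qpi (@tensor_rel V W) <<(v, w)>>.

Definition tlift (V W X : lmodType k) (f : V -> W -> X) : tensor V W -> X :=
  qlift (fun p => f p.1 p.2).

Definition tmap (V W V' W' : lmodType k) (f : V -> V') (g : W -> W') :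
  tensor V W -> tensor V' W' := tlift (fun v w => tpure (f v) (g w)).

Definition tassoc (U V W : lmodType k) :
    tensor (tensor U V) W -> tensor U (tensor V W) :=
  tlift (fun p w => tlift (fun u v => tpure u (tpure v w)) p).

Lemma tpure_bilin (V W : lmodType k) : bilin (@tpure V W).
Proof.
split=> [w c v v'|v c w w'].
- apply: etrans (qpi_linear (@tensor_rel V W) c _ _); apply/qpiE/span_incl.
  by rewrite opprD addrA; exact: tensor_rel_l.
- apply: etrans (qpi_linear (@tensor_rel V W) c _ _); apply/qpiE/span_incl.
  by rewrite opprD addrA; exact: tensor_rel_r.
Qed.

Lemma tliftE (V W X : lmodType k) (f : V -> W -> X) : bilin f ->
  linear (tlift f) /\ (forall v w, tlift f (tpure v w) = f v w).
Proof.
move=> [fl fr]; rewrite /tlift.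
have [|L E] := @qliftE k _ X (fun p : V * W => f p.1 p.2) (@tensor_rel V W).
  by move=> _ [c v v' w|c v w w']; rewrite !raddfB /= linearZ /= !flinU /= ?fl ?fr;
     rewrite addrAC addrK subrr.
by split=> // v w; rewrite /tpure E flinU.
Qed.

End Tensor.

Notation "v ⊗ w" := (tpure v w) (at level 38, right associativity).

(* The associative unital algebra with generators X and relators R. *)
Section PresentedAlgebra.
Variables (k : fieldType) (X : choiceType).

Definition falg := {malg k[{fmonom X}]}.
Definition fword (w : seq X) : falg := << FMonom w >>.

Variant ideal_gen (R : falg -> Prop) : falg -> Prop :=
| IdealGen a r b : R r -> ideal_gen R (a * r * b).

Definition ideal (R : falg -> Prop) : falg -> Prop := span (ideal_gen R).

Variable R : falg -> Prop.

Definition palg : lmodType k := qmod (ideal_gen R).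
Definition pword (w : seq X) : palg := qpi (ideal_gen R) (fword w).
Definition pmul (x y : palg) : palg := qpi (ideal_gen R) (generic_quotient.repr x * generic_quotient.repr y).
Lemma falg_scalerAr c (x y : falg) : c *: (x * y) = x * (c *: y).
Proof.
rewrite malgME (malgMEw (fsubset_refl _) (msuppZ_le c y)) scaler_sumr.
apply: eq_bigr => m _; rewrite scaler_sumr; apply: eq_bigr => n _.
by apply/malgP => p; rewrite mcoeffZ !mcoeffU mcoeffZ mulrCA mulrnAr.
Qed.

Lemma pmulE a b :
  pmul (qpi (ideal_gen R) a) (qpi (ideal_gen R) b) = qpi (ideal_gen R) (a * b).
Proof.
have mull c x : ideal R x -> ideal R (c * x).
  elim=> [|e y z [u r v Rr] _ IH]; first by rewrite mulr0; exact: span0.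
  rewrite mulrDr -falg_scalerAr !mulrA; apply: spanS => //; exact: IdealGen.
have mulr x c : ideal R x -> ideal R (x * c).
  elim=> [|e y z [u r v Rr] _ IH]; first by rewrite mul0r; exact: span0.
  rewrite mulrDl -scalerAl; apply: spanS => //; rewrite -(mulrA (u * r)); exact: IdealGen.
apply/qpiE; set a' := generic_quotient.repr _; set b' := generic_quotient.repr _.
have -> : a' * b' - a * b = 1 *: ((a' - a) * b') + a * (b' - b).
  by rewrite scale1r mulrBl mulrBr addrA subrK.
by apply: spanZD; [apply: mulr | apply: mull]; apply/qpiE; rewrite qpiK.
Qed.

Definition plift (W : lmodType k) (f : seq X -> W) : palg -> W :=
  qlift (fun m : {fmonom X} => f m).

End PresentedAlgebra.

Section SuperHopf.
Variable k : fieldType.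

(* [hcomp n] is the projection onto the component of degree n. *)
Record superHopfData := SuperHopfData {
  hcar :> lmodType k;
  hcomp : nat -> hcar -> hcar;
  hmul : hcar -> hcar -> hcar;
  hone : hcar;
  hcop : hcar -> tensor hcar hcar;
  hcou : hcar -> k }.

(* x |-> (-1)^|x| x *)
Definition parity (V : lmodType k) (comp : nat -> V -> V) (x : V) : V :=
  \sum_(n \in [set: nat]) (-1) ^+ n *: comp n x.

(* (a ⊗ b)(c ⊗ d) = (-1)^(|b||c|) ac ⊗ bd *)
Definition tmul (V : lmodType k) (comp : nat -> V -> V) (mul : V -> V -> V)
    (s t : tensor V V) : tensor V V :=
  tlift (fun a b => tlift (fun c d =>
    \sum_(m \in [set: nat]) \sum_(n \in [set: nat])
       (-1) ^+ (m * n) *: (mul a (comp n c) ⊗ mul (comp m b) d)) t) s.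

Definition tcomp (V : lmodType k) (comp : nat -> V -> V) (n : nat)
    (t : tensor V V) : tensor V V :=
  \sum_(i < n.+1) tmap (comp i) (comp (n - i)%N) t.

Definition graded (V : lmodType k) (comp : nat -> V -> V) : Prop :=
  [/\ forall n, linear (comp n),
      forall m n x, comp m (comp n x) = if m == n then comp n x else 0,
      forall x, finite_set [set n | comp n x != 0]%classic &
      forall x, x = \sum_(n \in [set: nat]) comp n x].

Definition graded_algebra (H : superHopfData) : Prop :=
  [/\ bilin (@hmul H), associative (@hmul H),
      left_id (hone H) (@hmul H) /\ right_id (hone H) (@hmul H),
      hcomp 0 (hone H) = hone H &
      forall m n (x y : H), let z := hmul (hcomp m x) (hcomp n y) in
        hcomp (m + n) z = z].

Definition graded_coalgebra (H : superHopfData) : Prop :=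
  [/\ linear (@hcop H), linear (fun x : H => hcou x : k^o),
      forall x : H, tassoc (tmap (@hcop H) id (hcop x)) = tmap id (@hcop H) (hcop x),
      forall x : H, tlift (fun a b => hcou a *: b) (hcop x) = x
                 /\ tlift (fun a b => hcou b *: a) (hcop x) = x &
      forall n (x : H), hcop (hcomp n x) = tcomp (@hcomp H) n (hcop x)
                 /\ ((0 < n)%N -> hcou (hcomp n x) = 0)].

Definition antipode (H : superHopfData) (S : H -> H) : Prop :=
  [/\ linear S, forall n x, S (hcomp n x) = hcomp n (S x),
      forall x, tlift (fun a b => hmul (S a) b) (hcop x) = hcou x *: hone H &
      forall x, tlift (fun a b => hmul a (S b)) (hcop x) = hcou x *: hone H].

Definition super_hopf (H : superHopfData) : Prop :=
  [/\ graded (@hcomp H), graded_algebra H, graded_coalgebra H,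
      [/\ forall x y : H, hcop (hmul x y)
            = tmul (@hcomp H) (@hmul H) (hcop x) (hcop y),
          hcop (hone H) = hone H ⊗ hone H,
          forall x y : H, hcou (hmul x y) = hcou x * hcou y &
          hcou (hone H) = 1] &
      exists S, @antipode H S].

(* An ordinary Hopf algebra is a super-Hopf algebra concentrated in degree 0. *)
Definition hopf (A : superHopfData) : Prop :=
  super_hopf A /\ forall a : A, hcomp 0 a = a.

Definition hopf_morphism (A B : superHopfData) (f : A -> B) : Prop :=
  [/\ linear f, forall x y, f (hmul x y) = hmul (f x) (f y),
      f (hone A) = hone B,
      forall x, hcop (f x) = tmap f f (hcop x) &
      forall x, hcou (f x) = hcou x].

Section Derivations.
Variables (H : superHopfData) (d : H -> H).

Definition super_derivation : Prop := forall x y : H,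
  d (hmul x y) = hmul (d x) y + hmul (parity (@hcomp H) x) (d y).

Definition super_coderivation : Prop := forall x : H,
  hcop (d x) = tmap d id (hcop x) + tmap (parity (@hcomp H)) d (hcop x).

End Derivations.

(* [j] identifies A with the degree 0 part of Omega. *)
Definition strongly_bicovariant (A Omega : superHopfData) (j : A -> Omega)
    (d : Omega -> Omega) : Prop :=
  [/\ hopf A, super_hopf Omega,
      [/\ hopf_morphism j, injective j &
          forall x, hcomp 0 x = x <-> exists a, x = j a],
      [/\ linear d,
          forall n x, hcomp n.+1 (d (hcomp n x)) = d (hcomp n x) &
          forall x, d (d x) = 0] &
      super_derivation d /\ super_coderivation d].

Definition augmentation (Omega : superHopfData) (i : Omega -> Omega) : Prop :=
  [/\ linear i,
      (forall x, i (hcomp 0 x) = 0) /\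
      (forall n x, hcomp n (i (hcomp n.+1 x)) = i (hcomp n.+1 x)),
      forall x, i (i x) = 0,
      super_derivation i & super_coderivation i].

Definition lie_derivative (Omega : superHopfData) (d i : Omega -> Omega)
  (x : Omega) : Omega := d (i x) + i (d x).

(* h1 ⊗ h2 ⊗ h3 |-> f h1 h2 h3, applied to the iterated coproduct of h *)
Definition cop3 (H : superHopfData) (W : lmodType k) (f : H -> H -> H -> W)
    (h : H) : W :=
  tlift (fun p h3 => tlift (fun h1 h2 => f h1 h2 h3) p)
    (tmap (@hcop H) id (hcop h)).

(* right action and right coaction; H is an ordinary Hopf algebra, so the
   compatibility carries no signs *)
Definition crossed_module (H : superHopfData) (V : lmodType k)
    (act : V -> H -> V) (coact : V -> tensor V H) : Prop :=
  [/\ bilin act,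
      (forall v, act v (hone H) = v) /\
      (forall v a b, act v (hmul a b) = act (act v a) b),
      linear coact,
      (forall v, tassoc (tmap coact id (coact v)) = tmap id (@hcop H) (coact v)) /\
      (forall v, tlift (fun v' h => hcou h *: v') (coact v) = v) &
      forall S, @antipode H S -> forall v h,
        coact (act v h) =
        cop3 (fun h1 h2 h3 => tlift (fun v0 v1 =>
                act v0 h2 ⊗ hmul (hmul (S h1) v1) h3) (coact v)) h].

(* The crossed module H^+ = ker epsilon has the right regular action and the
   right adjoint coaction a |-> a2 ⊗ (S a1) a3; f is used only on H^+. *)
Definition aug_crossed_morphism (H : superHopfData) (V : lmodType k)
    (act : V -> H -> V) (coact : V -> tensor V H) (f : H -> V) : Prop :=
  [/\ linear f,
      forall a h : H, hcou a = 0 -> f (hmul a h) = act (f a) h &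
      forall S, @antipode H S -> forall a : H, hcou a = 0 ->
        cop3 (fun a1 a2 a3 => f a2 ⊗ hmul (S a1) a3) a = coact (f a)].

(* The algebra presented by (X, R) with every generator primitive and
   homogeneous of degree e. *)
Definition primHopf (X : choiceType) (R : falg k X -> Prop) (e : nat) :
    superHopfData :=
  let comp n := plift (R := R)
    (fun w => if (e * size w == n)%N then pword R w else 0) in
  let one := pword R [::] in
  @SuperHopfData (palg R) comp (@pmul _ _ R) one
    (plift (fun w => foldr (fun x t =>
        tmul comp (@pmul _ _ R) (pword R [:: x] ⊗ one + one ⊗ pword R [:: x]) t)
      (one ⊗ one) w))
    (plift (fun w => (if w is [::] then 1 else 0) : k^o)).

(* H ⊗ L for H in degree 0 acting on L from the right; the flip in the tensor
   product coalgebra carries no sign because H is even. *)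
Definition smash (H L : superHopfData) (act : L -> H -> L) : superHopfData :=
  @SuperHopfData (tensor H L)
    (fun n => tmap id (hcomp n))
    (fun s t => tlift (fun a eta => tlift (fun b zeta =>
       tlift (fun b1 b2 => hmul a b1 ⊗ hmul (act eta b2) zeta) (hcop b)) t) s)
    (hone H ⊗ hone L)
    (tlift (fun a eta => tlift (fun a1 a2 => tlift (fun eta1 eta2 =>
       (a1 ⊗ eta1) ⊗ (a2 ⊗ eta2)) (hcop eta)) (hcop a)))
    (tlift (fun a eta => hcou a * hcou eta : k^o)).

End SuperHopf.

Section TensorAlgebra.
Variables (k : fieldType) (V : lmodType k).

(* The tensor algebra of V is the free algebra on the set V modulo these. *)
Inductive linear_rel : falg k V -> Prop :=
| LinearRel c v v' : linear_rel
    (fword k [:: c *: v + v'] - c *: fword k [:: v] - fword k [:: v']).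

Definition antisym_word (w : seq V) : falg k V :=
  \sum_(s : 'S_(size w)) (-1) ^+ s *:
    fword k [seq tnth (in_tuple w) (s i) | i <- enum 'I_(size w)].

Definition antisym : falg k V -> falg k V :=
  flin (fun m : {fmonom V} => antisym_word m).

(* x lies in the kernel of the antisymmetrisers of the tensor algebra *)
Definition Bminus_rel (x : falg k V) : Prop := ideal linear_rel (antisym x).

Inductive grassmann_rel : falg k V -> Prop :=
| grassmann_lin x : linear_rel x -> grassmann_rel x
| grassmann_sq v : grassmann_rel (fword k [:: v; v]).

Definition Lam : superHopfData k := primHopf Bminus_rel 1.
Definition lam1 (v : V) : Lam := pword Bminus_rel [:: v].

End TensorAlgebra.

HB.mixin Record isLieAlgebra (k : fieldType) L of GRing.Lmodule k L := {
  lie : L -> L -> L;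
  lie_linearl : forall y, linear (lie^~ y);
  lie_linearr : forall x, linear (lie x);
  lie_alt : forall x, lie x x = 0;
  lie_jacobi : forall x y z,
    lie x (lie y z) + lie y (lie z x) + lie z (lie x y) = 0 }.

#[short(type="lieAlgType")]
HB.structure Definition LieAlgebra (k : fieldType) :=
  { L of GRing.Lmodule k L & isLieAlgebra k L }.

Section Enveloping.
Variables (k : fieldType) (g : lieAlgType k).

Inductive env_rel : falg k g -> Prop :=
| env_lin x : @linear_rel k g x -> env_rel x
| env_lie x y : env_rel
    (fword k [:: x; y] - fword k [:: y; x] - fword k [:: lie x y]).

Definition Uenv : superHopfData k := primHopf env_rel 0.
Definition uin (x : g) : Uenv := pword env_rel [:: x].

Variables (V : lmodType k) (act : V -> g -> V).

Definition right_module : Prop :=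
  bilin act /\
  forall v x y, act v (lie x y) = act (act v x) y - act (act v y) x.

Definition cocycle (om : g -> V) : Prop :=
  linear om /\ forall x y, om (lie x y) = act (om x) y - act (om y) x.

Definition uact (v : V) (u : Uenv) : V :=
  plift (fun w => foldl act v w) u.

(* Generators of g are primitive, so U(g)-module algebra means: g acts by
   derivations. *)
Definition gact (eta : Lam V) (x : g) : Lam V :=
  plift (fun w => \sum_(i < size w)
    pword (@Bminus_rel k V) (set_nth 0 w i (act (nth 0 w i) x))) eta.

Definition lact (eta : Lam V) (u : Uenv) : Lam V :=
  plift (fun w => foldl gact eta w) u.

(* om(x1 ... xn) = om(x1) <| x2 ... xn; defined on all of U(g) by om(1) = 0, that
   is, precomposed with the projection a |-> a - epsilon(a) 1. *)
Definition omext (om : g -> V) : Uenv -> V :=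
  plift (fun w => if w is x :: w' then foldl act (om x) w' else 0).

Definition trivial_coact (v : V) : tensor V Uenv := v ⊗ hone Uenv.

Definition Omega : superHopfData k := smash lact.

Definition Omega0 (a : Uenv) : Omega := a ⊗ hone (Lam V).
Definition Omega1 (v : V) : Omega := hone Uenv ⊗ lam1 v.

Definition proj_aug (a : Uenv) : Uenv := a - hcou a *: hone Uenv.

Definition woronowicz_d (om : g -> V) (delta : Lam V -> Lam V) : Omega -> Omega :=
  tlift (fun a eta =>
    tlift (fun a1 a2 => a1 ⊗ hmul (lam1 (omext om (proj_aug a2))) eta) (hcop a)
    + a ⊗ delta eta).

Definition compatible_map (j : V -> g) : Prop :=
  [/\ linear j, forall v x, j (act v x) = lie (j v) x &
      forall v, act v (j v) = 0].

Definition restricts_to (i : Omega -> Omega) (j : V -> g) : Prop :=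
  forall v, i (Omega1 v) = Omega0 (uin (j v)).

End Enveloping.

Arguments Omega {k g V} act.
Arguments Omega0 {k g V} act a.
Arguments Omega1 {k g V} act v.
Arguments lam1 {k V} v.
Arguments restricts_to {k g V} act i j.
Arguments woronowicz_d {k g V} act om delta _.
Arguments omext {k g V} act om _.
Arguments uact {k g V} act v u.

(* Main.v *)
(* Both U(g) and Lambda(V) are generated by primitive elements, and so is the cross
   product U(g) # Lambda(V). All Hopf algebra axioms therefore reduce to recursions for
   right multiplication by a generator, and a super-derivation of odd degree is a
   super-coderivation, or squares to zero, as soon as this holds on generators; this
   covers both d and the augmentations. Conversely, if i is an augmentation then i(v) is
   a primitive element of U(g) in the kernel of the counit; applying i to v x - x v =
   v <| x gives equivariance, and applying it to v v = 0 gives v <| i(v) = 0. In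
   characteristic zero Friedrichs' argument identifies the primitive elements with g,
   and the injectivity of g -> U(g) is the degree one case of the
   Poincare-Birkhoff-Witt theorem, proved by straightening words. The kernel of the
   antisymmetrisers is the Grassmann ideal because iterated contractions of a word are
   determinants, and they separate the points of the Grassmann algebra. *)
From mathcomp Require Import all_boot all_algebra perm finmap monalg.
From mathcomp Require Import boolp classical_sets cardinality fsbigop wochoice.
Require Import Defs.
Set Implicit Arguments.
Unset Strict Implicit.
Unset Printing Implicit Defensive.
Import GRing.Theory.
Local Open Scope ring_scope.


(** * Linear and bilinear maps *)

(** The obstacle in the converse direction is the characteristic: in characteristic p the power x^p
    of an element of [g] is again primitive in U(g), so an augmentation may send V outside [g]. The
    correspondence is therefore asked for in characteristic zero or for values in [g], while the Lie
    derivative is computed for every augmentation through a linear map from V to U(g). The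
    injectivity of g -> U(g) is needed over every field and in every dimension, so bases come from
    Zorn's lemma and are ordered by the well-ordering principle. Straightening is not phrased as a
    terminating rewriting system: each word receives an explicit correction of smaller degree, and
    replacing the longest words by their corrections shortens by one the relators in which an
    element of the ideal is expressed. An element of degree one then ends up as a combination of no
    relators at all. The antisymmetrisers are compared with the Grassmann ideal without dividing by
    factorials: a product of linear forms, evaluated on an antisymmetrised word, already is the
    determinant. *)

(* Comparing two tensors by conversion unfolds the quotient construction and is
   very slow; the operations are therefore used through opaque copies, named with
   a final S. *)
Definition seal (T : Type) (x : T) : {y : T | x = y}.
Proof. by exists x. Qed.

Definition tpureS := sval (seal (@tpure)).
Definition tliftS := sval (seal (@tlift)).
Definition tmapS := sval (seal (@tmap)).
Definition tassocS := sval (seal (@tassoc)).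
Lemma tpureSE : @tpure = tpureS. Proof. exact: (svalP (seal (@tpure))). Qed.
Lemma tliftSE : @tlift = tliftS. Proof. exact: (svalP (seal (@tlift))). Qed.
Lemma tmapSE : @tmap = tmapS. Proof. exact: (svalP (seal (@tmap))). Qed.
Lemma tassocSE : @tassoc = tassocS. Proof. exact: (svalP (seal (@tassoc))). Qed.
Arguments tpureS {k V W} v w.
Arguments tliftS {k V W X} f _.
Arguments tmapS {k V W V' W'} f g _.
Arguments tassocS {k U V W} _.
Notation "v ⊠ w" := (tpureS v w) (at level 38, right associativity).

Section LinearMaps.
Variable k : fieldType.
Implicit Types U V W X : lmodType k.

Lemma lin_id U : linear (fun x : U => x).
Proof. by []. Qed.
Lemma lin_0 U V : linear (fun _ : U => 0 : V).
Proof. by move=> c x y; rewrite scaler0 addr0. Qed.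
Lemma lin_D U V (f g : U -> V) : linear f -> linear g -> linear (fun x => f x + g x).
Proof. by move=> lf lg c x y; rewrite lf lg scalerDr addrACA. Qed.
Lemma lin_N U V (f : U -> V) : linear f -> linear (fun x => - f x).
Proof. by move=> lf c x y; rewrite lf opprD scalerN. Qed.
Lemma lin_Z U V c (f : U -> V) : linear f -> linear (fun x => c *: f x).
Proof. by move=> lf d x y; rewrite lf scalerDr !scalerA mulrC. Qed.
Lemma lin_Zl U V (f : U -> k) (v : V) :
  linear (f : U -> k^o) -> linear (fun x => f x *: v).
Proof. by move=> lf d x y; rewrite lf scalerDl scalerA. Qed.
Lemma lin_Ml U (f : U -> k) c : linear (f : U -> k^o) -> linear (fun x => f x * c : k^o).
Proof. by move=> lf d x y; rewrite lf mulrDl; congr (_ + _); exact: (esym (mulrA _ _ _)). Qed.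
Lemma lin_Mr U (f : U -> k) c : linear (f : U -> k^o) -> linear (fun x => c * f x : k^o).
Proof. by move=> lf d x y; rewrite lf mulrDr; congr (_ + _); exact: mulrCA. Qed.
Lemma lin_sum U V (I : Type) (r : seq I) (P : pred I) (f : I -> U -> V) :
  (forall i, linear (f i)) -> linear (fun x => \sum_(i <- r | P i) f i x).
Proof.
by move=> lf c x y; rewrite scaler_sumr -big_split /=; apply: eq_bigr => i _; rewrite lf.
Qed.
Lemma lin_comp U V W (g : V -> W) (f : U -> V) :
  linear g -> linear f -> linear (fun x => g (f x)).
Proof. by move=> lg lf c x y; rewrite lf lg. Qed.
Lemma lin_if U V (b : bool) (f g : U -> V) :
  linear f -> linear g -> linear (fun x => if b then f x else g x).
Proof. by case: b. Qed.

Section Eval.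
Variables (U V : lmodType k) (f : U -> V).
Hypothesis lf : linear f.
Lemma linE0 : f 0 = 0.
Proof. by have := lf (-1) 0 0; rewrite !scaleN1r oppr0 addr0 addNr. Qed.
Lemma linED x y : f (x + y) = f x + f y.
Proof. by have := lf 1 x y; rewrite !scale1r. Qed.
Lemma linEZ c x : f (c *: x) = c *: f x.
Proof. by have := lf c x 0; rewrite linE0 !addr0. Qed.
Lemma linEN x : f (- x) = - f x.
Proof. by rewrite -scaleN1r linEZ scaleN1r. Qed.
Lemma linEB x y : f (x - y) = f x - f y.
Proof. by rewrite linED linEN. Qed.
Lemma linEsum (I : Type) (r : seq I) (P : pred I) (F : I -> U) :
  f (\sum_(i <- r | P i) F i) = \sum_(i <- r | P i) f (F i).
Proof. exact: (big_morph f linED linE0). Qed.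
End Eval.

(** The constructor [spanS] adds one scaled generator at a time; this principle separates the
    generators from closure under combinations, which is automatic for linear conditions. *)
Lemma span_ind (V : lmodType k) (G P : V -> Prop) :
  P 0 -> (forall c x y, P x -> P y -> P (c *: x + y)) -> (forall x, G x -> P x) ->
  forall x, span G x -> P x.
Proof. by move=> P0 PS PG x; elim=> // c u v Gu _ Pv; apply: PS => //; apply: PG. Qed.

Lemma span_ext (V W : lmodType k) (G : V -> Prop) (f g : V -> W) :
  linear f -> linear g -> (forall x, G x -> f x = g x) ->
  forall x, span G x -> f x = g x.
Proof.
move=> lf lg e; apply: span_ind => //; first by rewrite !linE0.
by move=> c x y ex ey; rewrite lf lg ex ey.
Qed.

Lemma span_lin (V W : lmodType k) (G : V -> Prop) (G' : W -> Prop) (f : V -> W) :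
  linear f -> (forall x, G x -> span G' (f x)) -> forall x, span G x -> span G' (f x).
Proof.
move=> lf e; apply: span_ind => //; first by rewrite linE0 //; exact: span0.
by move=> c x y ex ey; rewrite lf; apply: spanZD.
Qed.

Lemma span_mono (V : lmodType k) (G G' : V -> Prop) :
  (forall x, G x -> G' x) -> forall x, span G x -> span G' x.
Proof.
by move=> e; apply: span_ind => [|c x y|x /e]; [exact: span0|exact: spanZD|exact: span_incl].
Qed.

Lemma spanD (V : lmodType k) (G : V -> Prop) x y : span G x -> span G y -> span G (x + y).
Proof. by move=> Gx Gy; rewrite -[x]scale1r; apply: spanZD. Qed.
Lemma spanZ (V : lmodType k) (G : V -> Prop) c x : span G x -> span G (c *: x).
Proof. by move=> Gx; rewrite -[_ *: _]addr0; apply: spanZD => //; exact: span0. Qed.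
Lemma spanN (V : lmodType k) (G : V -> Prop) x : span G x -> span G (- x).
Proof. by rewrite -scaleN1r; apply: spanZ. Qed.
Lemma spanB (V : lmodType k) (G : V -> Prop) x y : span G x -> span G y -> span G (x - y).
Proof. by move=> Gx Gy; apply/spanD/spanN. Qed.
Lemma span_sum (V : lmodType k) (G : V -> Prop) (I : Type) (r : seq I) (P : pred I) F :
  (forall i, P i -> span G (F i)) -> span G (\sum_(i <- r | P i) F i).
Proof. by move=> h; elim/big_ind: _ => //; [exact: span0|exact: spanD]. Qed.

Lemma malg_span (K : choiceType) (x : {malg k[K]}) : span (fun y => exists m, y = << m >>) x.
Proof.
rewrite (monalgE x); apply: span_sum => m _.
have -> c : << c *g m >> = c *: (<< m >> : {malg k[K]}).
  by apply/malgP => q; rewrite mcoeffZ !mcoeffU mulrnAr mulr1.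
by apply/spanZ/span_incl; exists m.
Qed.

Lemma malg_ext (K : choiceType) (W : lmodType k) (f g : {malg k[K]} -> W) :
  linear f -> linear g -> (forall m, f << m >> = g << m >>) -> forall x, f x = g x.
Proof. by move=> lf lg e x; apply: span_ext (malg_span x) => // _ [m ->]. Qed.

Lemma tlift_lin V W X (f : V -> W -> X) : bilin f -> linear (tliftS f).
Proof. by rewrite -tliftSE; case/tliftE. Qed.
Lemma tliftP V W X (f : V -> W -> X) v w : bilin f -> tliftS f (v ⊠ w) = f v w.
Proof. by rewrite -tliftSE -tpureSE; case/tliftE => _; exact. Qed.

Lemma eq_tlift V W X (f g : V -> W -> X) t :
  (forall v w, f v w = g v w) -> tliftS f t = tliftS g t.
Proof. by move=> e; have -> : f = g by apply/funext => v; apply/funext. Qed.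

Lemma tensor_span V W (t : tensor V W) : span (fun t => exists v w, t = v ⊠ w) t.
Proof.
rewrite -tpureSE -(qpiK t); apply: (span_lin _ _ (malg_span _)); first exact: qpi_linear.
by move=> _ [[v w] ->]; apply: span_incl; exists v, w.
Qed.

Lemma tensor_ext V W X (f g : tensor V W -> X) : linear f -> linear g ->
  (forall v w, f (v ⊠ w) = g (v ⊠ w)) -> forall t, f t = g t.
Proof.
by move=> lf lg e t; apply: span_ext (tensor_span t) => // _ [v [w ->]].
Qed.

Lemma tensor_ind V W (P : tensor V W -> Prop) :
  P 0 -> (forall c x y, P x -> P y -> P (c *: x + y)) -> (forall v w, P (v ⊠ w)) ->
  forall t, P t.
Proof.
by move=> P0 PS PT t; apply: (span_ind P0 PS _ (tensor_span t)) => _ [v [w ->]].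
Qed.

(** A lift is computed on a representative, so its dependence on the lifted map is not linear by
    definition; it becomes so by induction on [t]. Needed for lifts nested inside lifts. *)
Lemma tlift_lin_param U V W X (f : U -> V -> W -> X) (t : tensor V W) :
  (forall u, bilin (f u)) -> (forall v w, linear (fun u => f u v w)) ->
  linear (fun u => tliftS (f u) t).
Proof.
move=> bf lf c x y; elim/tensor_ind: t => [|d s t es et|v w].
- by rewrite !(linE0 (tlift_lin (bf _))) scaler0 addr0.
- rewrite !(tlift_lin (bf _)) es et !scalerDr !scalerA (mulrC d c) -!addrA.
  by congr (_ + _); rewrite addrCA.
- by rewrite !tliftP // lf.
Qed.

Lemma tpure_linl V W (w : W) : linear (fun v : V => v ⊠ w).
Proof. by rewrite -tpureSE; exact: (tpure_bilin V W).1. Qed.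
Lemma tpure_linr V W (v : V) : linear (fun w : W => v ⊠ w).
Proof. by rewrite -tpureSE; exact: (tpure_bilin V W).2. Qed.

Lemma tpure0l V W (w : W) : (0 : V) ⊠ w = 0. Proof. exact: linE0 (tpure_linl w). Qed.
Lemma tpure0r V W (v : V) : v ⊠ (0 : W) = 0. Proof. exact: linE0 (tpure_linr v). Qed.
Lemma tpureDl V W (v v' : V) (w : W) : (v + v') ⊠ w = v ⊠ w + v' ⊠ w.
Proof. exact: linED (tpure_linl w) v v'. Qed.
Lemma tpureDr V W (v : V) (w w' : W) : v ⊠ (w + w') = v ⊠ w + v ⊠ w'.
Proof. exact: linED (tpure_linr v) w w'. Qed.
Lemma tpureZl V W c (v : V) (w : W) : (c *: v) ⊠ w = c *: (v ⊠ w).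
Proof. exact: linEZ (tpure_linl w) c v. Qed.
Lemma tpureZr V W c (v : V) (w : W) : v ⊠ (c *: w) = c *: (v ⊠ w).
Proof. exact: linEZ (tpure_linr v) c w. Qed.
Lemma tpureNl V W (v : V) (w : W) : (- v) ⊠ w = - (v ⊠ w).
Proof. exact: linEN (tpure_linl w) v. Qed.
Lemma tpureNr V W (v : V) (w : W) : v ⊠ (- w) = - (v ⊠ w).
Proof. exact: linEN (tpure_linr v) w. Qed.

Lemma tmapE V W V' W' (f : V -> V') (g : W -> W') :
  tmapS f g = tliftS (fun v w => f v ⊠ g w).
Proof. by rewrite -tmapSE -tliftSE -tpureSE. Qed.
Lemma tassocE U V W : @tassocS k U V W =
  tliftS (fun p w => tliftS (fun u v => u ⊠ (v ⊠ w)) p).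
Proof. by rewrite -tassocSE -tliftSE -tpureSE. Qed.
Lemma tmap_bilin V W V' W' (f : V -> V') (g : W -> W') :
  linear f -> linear g -> bilin (fun v w => f v ⊠ g w).
Proof.
move=> lf lg; split=> [w|v].
  exact: (lin_comp (@tpure_linl V' W' _)).
exact: (lin_comp (@tpure_linr V' W' _)).
Qed.
Lemma tmap_lin V W V' W' (f : V -> V') (g : W -> W') :
  linear f -> linear g -> linear (tmapS f g).
Proof. by move=> lf lg; rewrite tmapE; apply/tlift_lin/tmap_bilin. Qed.
Lemma tmapP V W V' W' (f : V -> V') (g : W -> W') v w :
  linear f -> linear g -> tmapS f g (v ⊠ w) = f v ⊠ g w.
Proof. by move=> lf lg; rewrite tmapE tliftP //; apply: tmap_bilin. Qed.
Lemma tassoc_bilin U V W : bilin (fun p (w : W) =>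
  tliftS (fun (u : U) (v : V) => u ⊠ (v ⊠ w)) p).
Proof.
have B w : bilin (fun (u : U) (v : V) => u ⊠ (v ⊠ w)).
  split=> [v|u]; first exact: tpure_linl.
  exact: (lin_comp (@tpure_linr _ _ _) (@tpure_linl _ _ _)).
split=> [w|p]; first exact: tlift_lin.
apply: tlift_lin_param => // u v.
exact: (lin_comp (@tpure_linr _ _ _) (@tpure_linr _ _ _)).
Qed.
Lemma tassoc_lin U V W : linear (@tassocS k U V W).
Proof. by rewrite tassocE; exact/tlift_lin/tassoc_bilin. Qed.
Lemma tassocP U V W (u : U) (v : V) (w : W) : tassocS ((u ⊠ v) ⊠ w) = u ⊠ (v ⊠ w).
Proof.
rewrite tassocE tliftP ?tliftP //; last exact: tassoc_bilin.
split=> [v'|u']; first exact: tpure_linl.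
exact: (lin_comp (@tpure_linr _ _ _) (@tpure_linl _ _ _)).
Qed.

Lemma bilin_l U V W (f : U -> V -> W) v : bilin f -> linear (fun u => f u v).
Proof. by case=> + _; exact. Qed.
Lemma bilin_r U V W (f : U -> V -> W) u : bilin f -> linear (fun v => f u v).
Proof. by case=> _; exact. Qed.

End LinearMaps.


(* Proves [linear (fun x => E)] by following the structure of E, using the
   hypotheses [linear f] and [bilin f] of the context. *)
Ltac lin_hyp :=
  match goal with
  | h : @GRing.linear_for _ _ _ _ ?f |- @GRing.linear_for _ _ _ _ ?g =>
    first [constr_eq f g | constr_eq f (fun x => g x)]; exact h
  | h : forall n, @GRing.linear_for _ _ _ _ (@?f n) |- @GRing.linear_for _ _ _ _ (?g ?m) =>
    let f' := eval cbv beta in (f m) in constr_eq f' (g m); exact (h m)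
  end.
Ltac bil_hyp :=
  match goal with h : bilin ?f |- bilin ?g => constr_eq f g; exact h end.
Ltac lin_step :=
  lazymatch goal with
  | |- bilin _ => first [ bil_hyp | split; intro; cbv beta ]
  | |- forall _, _ => intro
  | |- @GRing.linear_for _ _ _ _ ?f => lin_lin f
  end
with lin_lin f :=
  first [ lin_hyp
  | let g := eval cbv beta in f in
    match g with
    | (fun x => x) => apply: lin_id
    | (fun _ => 0) => apply: lin_0
    | (fun x => @GRing.add _ _ _) => apply: lin_D
    | (fun x => @GRing.opp _ _) => apply: lin_N
    | (fun x => @GRing.scale _ _ ?c _) => apply: lin_Z
    | (fun x => @GRing.scale _ _ _ _) => apply: lin_Zl
    | (fun x => @GRing.mul _ _ ?c) => apply: lin_Ml
    | (fun x => @GRing.mul _ ?c _) => apply: lin_Mr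
    | (fun x => if _ then _ else _) => apply: lin_if
    | (fun x => \big[_/_]_(i <- _ | _) _) => apply: lin_sum
    | (fun x => @tpureS _ _ _ _ ?w) => refine (lin_comp (@tpure_linl _ _ _ w) _)
    | (fun x => @tpureS _ _ _ ?v _) => refine (lin_comp (@tpure_linr _ _ _ v) _)
    | (fun x => @tliftS _ _ _ _ ?h x) => refine (tlift_lin _)
    | (fun x => @tliftS _ _ _ _ ?h _) => refine (lin_comp (tlift_lin (f := h) _) _)
    | (fun x => @tliftS _ _ _ _ _ ?t) => refine (@tlift_lin_param _ _ _ _ _ _ t _ _)
    | (fun x => @tmapS _ _ _ _ _ ?a ?b x) => refine (tmap_lin _ _)
    | (fun x => @tmapS _ _ _ _ _ ?a ?b _) => refine (lin_comp (tmap_lin (f := a) (g := b) _ _) _)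
    | (fun x => @tassocS _ _ _ _ _) => refine (lin_comp (@tassoc_lin _ _ _ _) _)
    | (fun x => ?h x) => lin_base h
    | (fun x => ?h x ?b) => refine (bilin_l b (f := h) _); bil_hyp
    | (fun x => ?h _ ?b) =>
      match goal with
      | l : @GRing.linear_for _ _ _ _ (fun y => ?h' y ?b') |- _ =>
        constr_eq h h'; constr_eq b b'; refine (lin_comp l _)
      end
    | (fun x => ?h _ ?b) => refine (lin_comp (bilin_l b (f := h) ltac:(bil_hyp)) _)
    | (fun x => @hcou ?k ?H _) => refine (lin_comp (W := (k^o)%type) (g := @hcou k H) _ _)
    | (fun x => ?h _) => refine (lin_comp (g := h) _ _)
    | ?h => lin_base h
    end ]
with lin_base h :=
  first [ lin_hyp
        | lazymatch h with
          | @tliftS _ _ _ _ _ => refine (tlift_lin _)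
          | @tmapS _ _ _ _ _ _ _ => refine (tmap_lin _ _)
          | @tassocS _ _ _ _ => refine (@tassoc_lin _ _ _ _)
          | @tpureS _ _ _ ?v => refine (@tpure_linr _ _ _ v)
          | @GRing.scale _ _ ?c => refine (@lin_Z _ _ _ c id (@lin_id _ _))
          | id => refine (@lin_id _ _)
          | ?h' ?a => refine (bilin_r a (f := h') _); bil_hyp
          end ].

Ltac lin := cbv beta; repeat lin_step.
Ltac tsimp :=
  repeat first [ rewrite tassocP | rewrite tmapP; [|lin|lin] | rewrite tliftP; [|lin] ].
Ltac on_pure := refine (tensor_ext _ _ _); [lin|lin|].

(** * Gradings and signs *)

Definition tmulS := sval (seal (@tmul)).
Definition parityS := sval (seal (@parity)).
Lemma tmulSE : @tmul = tmulS. Proof. exact: (svalP (seal (@tmul))). Qed.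
Lemma paritySE : @parity = parityS. Proof. exact: (svalP (seal (@parity))). Qed.
Arguments tmulS {k V} comp mul s t.
Arguments parityS {k V} comp x.

Lemma fsbig_bound (V : nmodType) (F : nat -> V) N : (forall n, (N <= n)%N -> F n = 0) ->
  \sum_(n \in [set: nat]) F n = \sum_(n < N) F n.
Proof.
move=> h; rewrite fsbig_ord; apply/esym/fsbig_widen => //= n [_ /negP].
by rewrite -leqNgt; exact: h.
Qed.

Lemma graded_lin (k : fieldType) (V : lmodType k) (comp : nat -> V -> V) :
  graded comp -> forall n, linear (comp n).
Proof. by case. Qed.

Section Graded.
Variables (k : fieldType) (V : lmodType k) (comp : nat -> V -> V).
Hypothesis Hg : graded comp.

Let comp_lin n : linear (comp n). Proof. by case: Hg. Qed.

Lemma comp_bound x : exists N, forall n, (N <= n)%N -> comp n x = 0.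
Proof.
case: Hg => _ _ /(_ x)/finite_fsetP[X XE] _.
exists (\max_(i <- X) i).+1 => n; apply: contraTeq => nz.
have : [set n | comp n x != 0]%classic n by [].
by rewrite XE /= => nX; rewrite -ltnNge ltnS; apply: leq_bigmax_seq.
Qed.

(** Parity and the even and odd parts are all of this form, so linearity and the value on
    homogeneous elements are proved once. *)
Definition wsum (K : nat -> k) (x : V) : V := \sum_(n \in [set: nat]) K n *: comp n x.

Lemma wsumE K x N : (forall n, (N <= n)%N -> comp n x = 0) ->
  wsum K x = \sum_(n < N) K n *: comp n x.
Proof. by move=> h; apply: fsbig_bound => n /h->; rewrite scaler0. Qed.

Lemma wsum_lin K : linear (wsum K).
Proof.
move=> c x y; case: (comp_bound x) => M Mx; case: (comp_bound y) => N Ny.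
have Hx n : (maxn M N <= n)%N -> comp n x = 0 by rewrite geq_max => /andP[/Mx].
have Hy n : (maxn M N <= n)%N -> comp n y = 0 by rewrite geq_max => /andP[_ /Ny].
have Hz n : (maxn M N <= n)%N -> comp n (c *: x + y) = 0.
  by move=> h; rewrite comp_lin Hx // Hy // scaler0 addr0.
rewrite (wsumE K Hx) (wsumE K Hy) (wsumE K Hz) scaler_sumr -big_split /=.
apply: eq_bigr => n _; rewrite comp_lin scalerDr !scalerA; congr (_ *: _ + _).
exact: mulrC.
Qed.
Let wl K : linear (wsum K) := wsum_lin K.

Lemma comp_comp m n x : comp m (comp n x) = if m == n then comp n x else 0.
Proof. by case: Hg. Qed.

Lemma compK n x : comp n (comp n x) = comp n x.
Proof. by rewrite comp_comp eqxx. Qed.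

Lemma comp_hom n m x : comp n x = x -> comp m x = if m == n then x else 0.
Proof. by move=> <-; exact: comp_comp. Qed.

Lemma comp_sum x : exists N, x = \sum_(n < N) comp n x.
Proof.
have [N h] := comp_bound x; exists N.
by case: Hg => _ _ _ /(_ x) {1}->; exact: fsbig_bound.
Qed.

Lemma graded_ind (P : V -> Prop) :
  P 0 -> (forall x y, P x -> P y -> P (x + y)) ->
  (forall n x, comp n x = x -> P x) -> forall x, P x.
Proof.
move=> P0 PD PH x; case: (comp_sum x) => N ->.
by elim/big_ind: _ => // n _; apply: (PH n); exact: compK.
Qed.

Lemma graded_ext (W : lmodType k) (f g : V -> W) : linear f -> linear g ->
  (forall n x, comp n x = x -> f x = g x) -> forall x, f x = g x.
Proof.
move=> lf lg e; apply: graded_ind => //; first by rewrite !linE0.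
by move=> x y ex ey; rewrite !linED // ex ey.
Qed.

Lemma wsum_hom K n x : comp n x = x -> wsum K x = K n *: x.
Proof.
move=> h; have hN m : (n.+1 <= m)%N -> comp m x = 0.
  by move=> lt; rewrite (comp_hom _ h) gtn_eqF.
rewrite (wsumE K hN) big_ord_recr /= h big1 ?add0r // => i _.
by rewrite (comp_hom _ h) (ltn_eqF (ltn_ord i)) scaler0.
Qed.

Definition evenc := wsum (fun n => (~~ odd n)%:R).
Definition oddc := wsum (fun n => (odd n)%:R).

Lemma parity_lin : linear (parityS comp).
Proof. by rewrite -paritySE; exact: (wsum_lin (fun n => (-1) ^+ n)). Qed.
Let pl : linear (parityS comp) := parity_lin.

Lemma parity_hom n x : comp n x = x -> parityS comp x = (-1) ^+ n *: x.
Proof. by rewrite -paritySE; exact: (wsum_hom (fun n => (-1) ^+ n)). Qed.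

Lemma parityK x : parityS comp (parityS comp x) = x.
Proof.
move: x; refine (graded_ext _ _ _); [lin|lin|] => n x h.
by rewrite (parity_hom h) (linEZ pl) (parity_hom h) scalerA -exprD -signr_odd oddD addbb scale1r.
Qed.

(** The n-fold parity operator, that is, the sign picked up by [x] when an element of degree [n]
    moves past it. *)
Definition parityn n x := if odd n then parityS comp x else x.

Lemma parityn_lin n : linear (parityn n).
Proof. by rewrite /parityn; case: (odd n) => //; exact: parity_lin. Qed.

Lemma parityn_hom m n x : comp m x = x -> parityn n x = (-1) ^+ (m * n) *: x.
Proof.
move=> h; rewrite /parityn -signr_odd oddM.
case: (odd n); last by rewrite andbF scale1r.
by rewrite (parity_hom h) andbT signr_odd.
Qed.

Section Tmul.
Variable mul : V -> V -> V.
Hypothesis bmul : bilin mul.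

(** The sign (-1)^(mn) depends on n only modulo 2: for even n the sum over m rebuilds [b], for odd n
    it rebuilds the parity of [b]. This removes the infinite sums from the product of tensors. *)
Lemma tmul_sumE a b c d :
  \sum_(m \in [set: nat]) \sum_(n \in [set: nat])
       (-1) ^+ (m * n) *: (mul a (comp n c) ⊠ mul (comp m b) d)
  = mul a (evenc c) ⊠ mul b d + mul a (oddc c) ⊠ mul (parityS comp b) d.
Proof.
have evl : linear evenc := wsum_lin (fun n => (~~ odd n)%:R).
have odl : linear oddc := wsum_lin (fun n => (odd n)%:R).
have bf N c' : (forall n, (N <= n)%N -> comp n c' = 0) ->
  forall m b', \sum_(n \in [set: nat])
       (-1) ^+ (m * n) *: (mul a (comp n c') ⊠ mul (comp m b') d) =
       \sum_(n < N) (-1) ^+ (m * n) *: (mul a (comp n c') ⊠ mul (comp m b') d).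
  move=> h m b'; apply: fsbig_bound => n /h ->; rewrite (linE0 (bilin_r a bmul)).
  by rewrite tpure0l scaler0.
have [N cN] := comp_bound c; have [M bM] := comp_bound b.
under eq_fsbigr => m _ do rewrite (bf N) //.
transitivity (\sum_(m < M) \sum_(n < N)
       (-1) ^+ (m * n) *: (mul a (comp n c) ⊠ mul (comp m b) d)).
  apply: fsbig_bound => m /bM ->; apply: big1 => n _; rewrite (linE0 (bilin_l d bmul)).
  by rewrite tpure0r scaler0.
have l1 v : linear (fun x => mul a x ⊠ mul v d) by lin.
have l2 v : linear (fun x => mul a v ⊠ mul x d) by lin.
rewrite /evenc /oddc !(wsumE _ cN).
have -> : parityS comp b = \sum_(m < M) (-1) ^+ m *: comp m b.
  by rewrite -paritySE; exact: (wsumE (fun n => (-1) ^+ n) bM).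
have {2}-> : b = \sum_(m < M) comp m b.
  by case: Hg => _ _ _ /(_ b) {1}->; exact: fsbig_bound.
rewrite !(linEsum (l1 _)) -big_split /= exchange_big; apply: eq_bigr => n _ /=.
rewrite !(linEsum (l2 _)) -big_split /=; apply: eq_bigr => m _.
rewrite !(linEZ (l1 _)) (linEZ (l2 _)) scalerA -scalerDl; congr (_ *: _).
rewrite -signr_odd oddM; case: (odd n); last by rewrite andbF mul0r addr0.
by rewrite andbT signr_odd add0r mul1r.
Qed.

Lemma tmulE s t : tmulS comp mul s t = tliftS (fun a b => tliftS (fun c d =>
  mul a (evenc c) ⊠ mul b d + mul a (oddc c) ⊠ mul (parityS comp b) d) t) s.
Proof.
rewrite -tmulSE /tmul tliftSE tpureSE.
by apply: eq_tlift => a b; apply: eq_tlift => c d; rewrite tmul_sumE.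
Qed.

Lemma tmul_bilin : bilin (tmulS comp mul).
Proof.
have evl : linear evenc := wsum_lin (fun n => (~~ odd n)%:R).
have odl : linear oddc := wsum_lin (fun n => (odd n)%:R).
have -> : tmulS comp mul = fun s t => tliftS (fun a b => tliftS (fun c d =>
  mul a (evenc c) ⊠ mul b d + mul a (oddc c) ⊠ mul (parityS comp b) d) t) s.
  by apply/funext => s; apply/funext => t; exact: tmulE.
lin.
Qed.

Lemma tmul_pure a b c d n : comp n c = c ->
  tmulS comp mul (a ⊠ b) (c ⊠ d) = mul a c ⊠ mul (parityn n b) d.
Proof.
move=> h.
have evl : linear evenc := wsum_lin (fun n => (~~ odd n)%:R).
have odl : linear oddc := wsum_lin (fun n => (odd n)%:R).
rewrite tmulE !tliftP; [|lin|lin]; rewrite /evenc /oddc !(wsum_hom _ h) /parityn.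
rewrite !(linEZ (bilin_r a bmul)) !tpureZl.
by case: (odd n); rewrite scale0r scale1r ?add0r ?addr0.
Qed.

End Tmul.
End Graded.

Arguments parityn {k V} comp n x.

(** * Super-Hopf algebras with primitive generators *)

Section GradedAlgebra.
Variables (k : fieldType) (H : superHopfData k).
Hypotheses (Hgr : graded (@hcomp k H)) (Hal : graded_algebra H).
Local Notation "x ** y" := (hmul x y) (at level 37, left associativity).
Local Notation comp := (@hcomp k H).
Local Notation P := (parityS (@hcomp k H)).
Local Notation Pn := (parityn (@hcomp k H)).
Local Notation T := (tmulS (@hcomp k H) (@hmul k H)).
Local Notation "𝟙" := (hone H).

Let bmul : bilin (@hmul k H). Proof. by case: Hal. Qed.
Let Tb : bilin T := tmul_bilin Hgr bmul.
Let Pl : linear P := parity_lin Hgr.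
Let Pnl n : linear (Pn n) := parityn_lin Hgr n.
Let cl n : linear (comp n). Proof. by case: Hgr. Qed.

Lemma hmulA : associative (@hmul k H). Proof. by case: Hal. Qed.
Lemma hmul1 x : 𝟙 ** x = x. Proof. by case: Hal => _ _ []. Qed.
Lemma hmulr1 x : x ** 𝟙 = x. Proof. by case: Hal => _ _ []. Qed.
Lemma comp_one : comp 0 𝟙 = 𝟙. Proof. by case: Hal. Qed.
Lemma comp_mul m n x y : comp m x = x -> comp n y = y -> comp (m + n) (x ** y) = x ** y.
Proof. by case: Hal => _ _ _ _ h hx hy; have := h m n x y; rewrite /= hx hy. Qed.

Lemma parity_one : P 𝟙 = 𝟙.
Proof. by rewrite (parity_hom Hgr comp_one) scale1r. Qed.
Lemma parityn_one n : Pn n 𝟙 = 𝟙.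
Proof. by rewrite /parityn parity_one if_same. Qed.

Lemma parityM x y : P (x ** y) = P x ** P y.
Proof.
move: x; refine (graded_ext Hgr _ _ _); [lin|lin|] => m x hx.
move: y; refine (graded_ext Hgr _ _ _); [lin|lin|] => n y hy.
rewrite (parity_hom Hgr hx) (parity_hom Hgr hy) (parity_hom Hgr (comp_mul hx hy)).
by rewrite (linEZ (bilin_l _ bmul)) (linEZ (bilin_r _ bmul)) scalerA exprD.
Qed.

Lemma paritynM n x y : Pn n (x ** y) = Pn n x ** Pn n y.
Proof. by rewrite /parityn; case: ifP => // _; exact: parityM. Qed.

Lemma parityn_add m n x : Pn m (Pn n x) = Pn (m + n) x.
Proof.
by rewrite /parityn oddD; case: (odd m); case: (odd n) => //=; rewrite (parityK Hgr).
Qed.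

Lemma parityn_hom' m n x : comp m x = x -> comp m (Pn n x) = Pn n x.
Proof. by move=> h; rewrite (parityn_hom Hgr n h) (linEZ (cl m)) h. Qed.

Lemma tmulP a b c d n : comp n c = c -> T (a ⊠ b) (c ⊠ d) = a ** c ⊠ Pn n b ** d.
Proof. exact: (tmul_pure Hgr bmul). Qed.

Lemma tmulA s t u : T s (T t u) = T (T s t) u.
Proof.
move: s; on_pure => a b.
move: t; on_pure => c d.
move: c; refine (graded_ext Hgr _ _ _); [lin|lin|] => n c hc.
move: u; on_pure => e f.
move: e; refine (graded_ext Hgr _ _ _); [lin|lin|] => m e he.
rewrite (tmulP _ _ _ hc) !(tmulP _ _ _ he) (tmulP _ _ _ (comp_mul hc he)).
by rewrite !hmulA paritynM parityn_add addnC.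
Qed.

Lemma tmul1 t : T (𝟙 ⊠ 𝟙) t = t.
Proof.
move: t; on_pure => c d.
move: c; refine (graded_ext Hgr _ _ _); [lin|lin|] => n c hc.
by rewrite (tmulP _ _ _ hc) parityn_one !hmul1.
Qed.

Lemma tmulr1 t : T t (𝟙 ⊠ 𝟙) = t.
Proof.
move: t; on_pure => c d.
by rewrite (tmulP _ _ _ comp_one) !hmulr1.
Qed.

Let T_prim a b : comp 0 b = b -> T (a ⊠ 𝟙 + 𝟙 ⊠ a) (b ⊠ 𝟙 + 𝟙 ⊠ b)
  = a ** b ⊠ 𝟙 + a ⊠ b + (b ⊠ a + 𝟙 ⊠ a ** b).
Proof.
move=> hb; rewrite (linED (bilin_r _ Tb)) !(linED (bilin_l _ Tb)).
by rewrite !(tmulP _ _ _ hb) !(tmulP _ _ _ comp_one) !hmul1 !hmulr1 addrACA.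
Qed.

(** The mixed terms are symmetric in [a] and [b], hence cancel in the commutator. This is why the
    coproduct of U(g) respects the Lie relators. *)
Lemma tmul_prim_bracket a b l : comp 0 a = a -> comp 0 b = b -> a ** b = b ** a + l ->
  T (a ⊠ 𝟙 + 𝟙 ⊠ a) (b ⊠ 𝟙 + 𝟙 ⊠ b)
  = T (b ⊠ 𝟙 + 𝟙 ⊠ b) (a ⊠ 𝟙 + 𝟙 ⊠ a) + (l ⊠ 𝟙 + 𝟙 ⊠ l).
Proof.
move=> ha hb ab; rewrite (T_prim a hb) (T_prim b ha) ab.
rewrite tpureDl tpureDr.
rewrite -!addrA; congr (_ + _); rewrite [LHS]addrCA [RHS]addrCA; congr (_ + _).
by rewrite [LHS]addrCA; congr (_ + _); rewrite [LHS]addrCA.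
Qed.

(** The two mixed terms [a ⊠ a] have opposite signs in odd degree. This is why the coproduct of the
    exterior algebra respects v v = 0. *)
Lemma tmul_prim_sq a n : odd n -> comp n a = a -> a ** a = 0 ->
  T (a ⊠ 𝟙 + 𝟙 ⊠ a) (a ⊠ 𝟙 + 𝟙 ⊠ a) = 0.
Proof.
move=> on ha aa; rewrite (linED (bilin_r _ Tb)) !(linED (bilin_l _ Tb)).
rewrite !(tmulP _ _ _ ha) !(tmulP _ _ _ comp_one) !hmul1 !hmulr1 aa.
rewrite tpure0l tpure0r add0r addr0.
rewrite (parityn_hom Hgr n ha) -signr_odd oddM on scaleN1r.
by rewrite tpureNr addNr.
Qed.

Lemma tmul_prim_flip z t : (forall a : H, comp 0 a = a) ->
  tliftS (fun a b => b ⊠ a) (T (z ⊠ 𝟙 + 𝟙 ⊠ z) t)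
  = T (z ⊠ 𝟙 + 𝟙 ⊠ z) (tliftS (fun a b => b ⊠ a) t).
Proof.
move=> h0; move: t; on_pure => a b.
rewrite [in RHS]tliftP; last by lin.
rewrite !(linED (bilin_l _ Tb)) !(tmulP _ _ _ (h0 _)) linED; last by lin.
by rewrite !tliftP; [rewrite addrC|lin|lin].
Qed.

Section EvenDerivation.
Variable d : H -> H.
Hypotheses (dl : linear d) (dM : forall x y, d (x ** y) = d x ** y + x ** d y).
Hypothesis dcomp : forall n x, d (comp n x) = comp n (d x).

Lemma even_parityn n x : d (Pn n x) = Pn n (d x).
Proof.
move: x; refine (graded_ext Hgr _ _ _); [lin|lin|] => m x hx.
have hdx : comp m (d x) = d x by rewrite -dcomp hx.
by rewrite (parityn_hom Hgr n hx) (parityn_hom Hgr n hdx) (linEZ dl).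
Qed.

(** No sign occurs in the second summand because [d] preserves degrees. *)
Definition tevender (t : tensor H H) := tmapS d id t + tmapS id d t.

Lemma tevender_lin : linear tevender.
Proof. by rewrite /tevender; lin. Qed.

Lemma tevenderM s t : tevender (T s t) = T (tevender s) t + T s (tevender t).
Proof.
have tl := tevender_lin.
move: s; on_pure => a b.
move: t; on_pure => c e.
move: c; refine (graded_ext Hgr _ _ _); [lin|lin|] => n c hc.
have hdc : comp n (d c) = d c by rewrite -dcomp hc.
rewrite (tmulP _ _ _ hc) /tevender; tsimp.
rewrite (linED (bilin_l _ Tb)) (linED (bilin_r _ Tb)) !(tmulP _ _ _ hc) (tmulP _ _ _ hdc).
rewrite !dM even_parityn tpureDl tpureDr.
by rewrite addrACA.
Qed.

Lemma tevender_prim z : d 𝟙 = 0 -> tevender (z ⊠ 𝟙 + 𝟙 ⊠ z) = d z ⊠ 𝟙 + 𝟙 ⊠ d z.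
Proof.
move=> d1; have l1 : linear (tmapS d (@id H)) by lin.
have l2 : linear (tmapS (@id H) d) by lin.
rewrite /tevender (linED l1) (linED l2); tsimp.
rewrite d1 tpure0l tpure0r.
by rewrite addr0 add0r.
Qed.

End EvenDerivation.

Definition thom n (t : tensor H H) := span (fun u => exists i j (a b : H),
  [/\ (i + j)%N = n, comp i a = a, comp j b = b & u = a ⊠ b]) t.

Lemma thom_pure i j a b : comp i a = a -> comp j b = b -> thom (i + j) (a ⊠ b).
Proof. by move=> ha hb; apply: span_incl; exists i, j, a, b. Qed.

Lemma thom_ext (W : lmodType k) n (f g : tensor H H -> W) : linear f -> linear g ->
  (forall i j (a b : H), (i + j)%N = n -> comp i a = a -> comp j b = b ->
    f (a ⊠ b) = g (a ⊠ b)) ->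
  forall t, thom n t -> f t = g t.
Proof.
move=> lf lg e; apply: span_ext => // _ [i [j [a [b [ij ha hb ->]]]]]; exact: e ij ha hb.
Qed.

Lemma thom_mul m n s t : thom m s -> thom n t -> thom (m + n) (T s t).
Proof.
move=> Hs Ht; apply: (span_lin (f := T^~ t) _ _ Hs); first by lin.
move=> _ [i [j [a [b [<- ha hb ->]]]]].
apply: (span_lin (f := T (a ⊠ b)) _ _ Ht); first by lin.
move=> _ [i' [j' [c [d [<- hc hd ->]]]]].
rewrite (tmulP _ _ _ hc) addnACA; apply: thom_pure; first exact: comp_mul.
by apply: comp_mul => //; exact: parityn_hom'.
Qed.

Lemma tcompE n t : tcomp comp n t = \sum_(i < n.+1) tmapS (comp i) (comp (n - i)%N) t.
Proof. by rewrite /tcomp tmapSE. Qed.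
Lemma tcomp_lin n : linear (tcomp comp n).
Proof.
have -> : tcomp comp n = fun t => \sum_(i < n.+1) tmapS (comp i) (comp (n - i)%N) t.
  by apply/funext => t; exact: tcompE.
lin.
Qed.

(** On a pure tensor with left degree i, only the summand of index i can survive, and it asks for
    right degree m - i. *)
Lemma tcomp_thom m n t : thom n t -> tcomp comp m t = if m == n then t else 0.
Proof.
have tl := tcomp_lin m; move: t; apply: span_ext; [lin|lin; exact: lin_0|].
move=> _ [i [j [a [b [<- ha hb ->]]]]]; rewrite tcompE.
under eq_bigr do rewrite tmapP // (comp_hom Hgr _ ha) (comp_hom Hgr _ hb).
case: (leqP i m) => le_im.
  rewrite (bigD1 (Ordinal (le_im : (i < m.+1)%N))) //= eqxx big1 ?addr0 => [|l ne].
    by rewrite eq_sym -(eqn_add2l i) subnKC // eq_sym; case: eqP => // _; rewrite tpure0r.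
  case: eqP => [e|_]; last by rewrite tpure0l.
  by move/eqP: ne; case; apply: val_inj.
rewrite ltn_eqF ?(leq_trans le_im) ?leq_addr // big1 // => l _.
rewrite ltn_eqF ?tpure0l //.
by apply: leq_ltn_trans le_im; rewrite -ltnS.
Qed.

Section SuperDerivation.
Variable d : H -> H.
(** Only the parity of the shift is prescribed, so that one section serves the differential of
    degree 1 and the augmentations of degree -1. *)
Hypotheses (dl : linear d) (dodd : forall n x, comp n x = x ->
  exists2 m, comp m (d x) = d x & odd m = ~~ odd n).

Lemma d_parity x : d (P x) = - P (d x).
Proof.
move: x; refine (graded_ext Hgr _ _ _); [lin|lin|] => n x hx.
have [m hm om] := dodd hx.
rewrite (parity_hom Hgr hx) (parity_hom Hgr hm) (linEZ dl).
by rewrite -signr_odd -[in RHS]signr_odd om -scaleNr; case: (odd n); rewrite ?opprK.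
Qed.

Lemma d_parityn n x : d (Pn n x) = (-1) ^+ n *: Pn n (d x).
Proof.
rewrite -signr_odd /parityn; case: (odd n); last by rewrite scale1r.
by rewrite d_parity scaleN1r.
Qed.

Definition tderiv (t : tensor H H) := tmapS d id t + tmapS P d t.

Lemma tderiv_lin : linear tderiv.
Proof. by rewrite /tderiv; lin. Qed.

(** The operator d ⊗ id + P ⊗ d is a super-derivation of the tensor square: the sign of moving [d]
    past the parity operator is the one built into the product. *)
Lemma tderivM s t : super_derivation d ->
  tderiv (T s t) = T (tderiv s) t + T (tmapS P P s) (tderiv t).
Proof.
rewrite /super_derivation paritySE => dM; have tl := tderiv_lin.
move: s; on_pure => a b.
move: t; on_pure => c e.
move: c; refine (graded_ext Hgr _ _ _); [lin|lin|] => n c hc.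
rewrite (tmulP _ _ _ hc) /tderiv; tsimp.
rewrite (linED (bilin_l _ Tb)) (linED (bilin_r _ Tb)) !(tmulP _ _ _ hc).
have [m hm om] := dodd hc; rewrite (tmulP _ _ _ hm).
have hPc : comp n (P c) = P c by rewrite (parity_hom Hgr hc) (linEZ (cl n)) hc.
rewrite (tmulP _ _ _ hPc) !dM !parityM.
rewrite tpureDl tpureDr addrACA.
congr (_ + _ + (_ + _)).
(* Two signs (-1)^n meet here, one from moving [d] past [Pn n] and one from [P c]; their product is
   1. *)
- rewrite d_parityn (parity_hom Hgr hc) (linEZ (bilin_l _ bmul)) (linEZ (bilin_r _ bmul)).
  rewrite tpureZr tpureZl scalerA.
  by rewrite -exprD -signr_odd oddD addbb scale1r.
- by rewrite /parityn om; case: (odd n); rewrite //= (parityK Hgr).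
- by rewrite /parityn; case: (odd n).
Qed.

End SuperDerivation.
End GradedAlgebra.

(* The generators [z] of [Z] are meant to be primitive; multiplicativity,
   coassociativity and the antipode identities are all deduced from recursions for
   right multiplication by a generator. *)
Section PrimitivelyGenerated.
Variables (k : fieldType) (H : superHopfData k).
Hypotheses (Hgr : graded (@hcomp k H)) (Hal : graded_algebra H).
Local Notation "x ** y" := (hmul x y) (at level 37, left associativity).
Local Notation comp := (@hcomp k H).
Local Notation P := (parityS (@hcomp k H)).
Local Notation Pn := (parityn (@hcomp k H)).
Local Notation T := (tmulS (@hcomp k H) (@hmul k H)).
Local Notation "𝟙" := (hone H).

Variable Z : nat -> H -> Prop.

Inductive gword : nat -> H -> Prop :=
| gword1 : gword 0 𝟙
| gwordM n e s z : gword n s -> Z e z -> gword (n + e) (s ** z).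

Hypothesis Zhom : forall e z, Z e z -> comp e z = z.
Hypothesis gen : forall x, span (fun y => exists n, gword n y) x.

Let bmul : bilin (@hmul k H). Proof. by case: Hal. Qed.
Let Tb : bilin T := tmul_bilin Hgr bmul.
Let Pl : linear P := parity_lin Hgr.
Let Pnl n : linear (Pn n) := parityn_lin Hgr n.
Let cl n : linear (comp n). Proof. by case: Hgr. Qed.

Lemma gword_comp n s : gword n s -> comp n s = s.
Proof. by elim=> [|m e t z _ ht /Zhom hz]; [exact: comp_one|exact: comp_mul]. Qed.

Lemma gword_ext (W : lmodType k) (f g : H -> W) : linear f -> linear g ->
  (forall n y, gword n y -> f y = g y) -> forall x, f x = g x.
Proof. by move=> lf lg e x; apply: span_ext (gen x) => // y [n]; exact: e. Qed.

Lemma gen_ext (W : lmodType k) (f g : H -> W) : linear f -> linear g ->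
  f 𝟙 = g 𝟙 -> (forall n e s z, gword n s -> Z e z -> f s = g s -> f (s ** z) = g (s ** z)) ->
  forall x, f x = g x.
Proof.
move=> lf lg e1 eM x; apply: span_ext (gen x) => // y [n].
by elim=> // m e s z gs Zz es; exact: (eM m e).
Qed.

(** Induction on the second factor as a word; the sign causes no trouble because the parity operator
    is multiplicative. *)
Lemma super_derivation_gen (d : H -> H) : linear d -> d 𝟙 = 0 ->
  (forall e s z, Z e z -> d (s ** z) = d s ** z + P s ** d z) -> super_derivation d.
Proof.
move=> dl d1 dM x y; rewrite paritySE; move: y; refine (gen_ext _ _ _ _); [lin|lin| |].
  by rewrite d1 (linE0 (bilin_r _ bmul)) addr0 !(hmulr1 Hal).
move=> n e s z _ Zz es; rewrite (hmulA Hal) (dM _ _ _ Zz) es (dM _ _ _ Zz).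
rewrite (linED (bilin_l _ bmul)) (linED (bilin_r _ bmul)) !(hmulA Hal) addrA.
by rewrite (parityM Hgr Hal).
Qed.

Lemma super_derivation_ext (d d' : H -> H) : linear d -> linear d' -> d 𝟙 = d' 𝟙 ->
  super_derivation d -> super_derivation d' ->
  (forall e z, Z e z -> d z = d' z) -> forall x, d x = d' x.
Proof.
rewrite /super_derivation => dl dl' d1 dM dM' dz; apply: gen_ext => // n e s z _ Zz es.
by rewrite dM dM' es (dz _ _ Zz).
Qed.

Hypotheses (cop_lin : linear (@hcop k H)) (cou_lin : linear (fun x : H => hcou x : k^o)).
Hypotheses (cop1 : hcop 𝟙 = 𝟙 ⊠ 𝟙) (cou1 : hcou 𝟙 = 1).
Hypothesis copM : forall e s z, Z e z -> hcop (s ** z) = T (hcop s) (z ⊠ 𝟙 + 𝟙 ⊠ z).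
Hypothesis couM : forall e s z, Z e z -> hcou (s ** z) = 0.

Lemma tmul_prim e z a b : Z e z ->
  T (a ⊠ b) (z ⊠ 𝟙 + 𝟙 ⊠ z) = a ** z ⊠ Pn e b + a ⊠ b ** z.
Proof.
move=> /Zhom hz; rewrite (linED (bilin_r _ Tb)).
by rewrite (tmulP Hgr Hal _ _ _ hz) (tmulP Hgr Hal _ _ _ (comp_one Hal)) !(hmulr1 Hal).
Qed.

Lemma cop_gen e z : Z e z -> hcop z = z ⊠ 𝟙 + 𝟙 ⊠ z.
Proof. by move=> Zz; rewrite -{1}(hmul1 Hal z) (copM _ Zz) cop1 (tmul1 Hgr Hal). Qed.

Lemma gword_cop n s : gword n s -> thom n (hcop s).
Proof.
have h1 := comp_one Hal.
elim=> [|m e t z _ ht Zz]; first by rewrite cop1; exact (thom_pure h1 h1).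
rewrite (copM _ Zz); apply: thom_mul => //; apply: spanD.
  by have := thom_pure (Zhom Zz) h1; rewrite addn0.
exact (thom_pure h1 (Zhom Zz)).
Qed.

Lemma cop_comp n x : hcop (comp n x) = tcomp comp n (hcop x).
Proof.
have tl := tcomp_lin Hgr n; move: x; refine (gword_ext _ _ _); [lin|lin|] => m y gy.
rewrite (tcomp_thom Hgr _ (gword_cop gy)) (comp_hom Hgr _ (gword_comp gy)).
by case: eqP; rewrite ?linE0.
Qed.

Lemma cou_comp n x : (0 < n)%N -> hcou (comp n x) = 0.
Proof.
move=> n0; move: x.
refine (gword_ext (W := k^o) (f := fun x => hcou (comp n x)) (g := fun _ => 0) _ _ _);
  [lin|exact: lin_0|] => m y gy.
rewrite (comp_hom Hgr _ (gword_comp gy)); case: gy => [|{}m e s z _ Zz].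
  by rewrite gtn_eqF // (linE0 cou_lin).
by case: eqP; rewrite ?(linE0 cou_lin) ?(couM _ Zz).
Qed.

Lemma cop_parity x : hcop (P x) = tmapS P P (hcop x).
Proof.
move: x; refine (gword_ext _ _ _); [lin|lin|] => m y gy.
rewrite (parity_hom Hgr (gword_comp gy)) (linEZ cop_lin).
move: (hcop y) (gword_cop gy); refine (thom_ext _ _ _); [lin|lin|] => i j a b e ha hb.
rewrite -e => {e}.
rewrite tmapP // (parity_hom Hgr ha) (parity_hom Hgr hb).
by rewrite tpureZl tpureZr scalerA exprD.
Qed.

Lemma cop_parityn n x : hcop (Pn n x) = tmapS (Pn n) (Pn n) (hcop x).
Proof.
rewrite /parityn; case: ifP => _; first exact: cop_parity.
rewrite -[LHS]/(id (hcop x)); apply/esym; move: (hcop x).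
by on_pure => a b; rewrite tmapP.
Qed.

Lemma cou_parity x : hcou (P x) = hcou x.
Proof.
move: x; refine (gword_ext (W := k^o) (f := fun x => hcou (P x)) (g := @hcou k H) _ _ _);
  [lin|lin|] => m y gy.
rewrite (parity_hom Hgr (gword_comp gy)); rewrite [LHS](linEZ cou_lin).
case: gy => [|{}m e s z _ Zz]; first by rewrite scale1r.
by rewrite (couM _ Zz) scaler0.
Qed.

Lemma cou_parityn n x : hcou (Pn n x) = hcou x.
Proof. by rewrite /parityn; case: ifP => // _; exact: cou_parity. Qed.

Lemma cop_mul x y : hcop (x ** y) = T (hcop x) (hcop y).
Proof.
move: y; refine (gen_ext _ _ _ _); [lin|lin| |].
  by rewrite cop1 (tmulr1 Hgr Hal) (hmulr1 Hal).
move=> n e s z _ Zz es.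
rewrite (hmulA Hal) (copM (x ** s) Zz) (copM s Zz) es (tmulA Hgr Hal).
reflexivity.
Qed.

Lemma cou_mul (x y : H) : hcou (x ** y) = hcou x * hcou y.
Proof.
move: y; refine (gen_ext (W := k^o) (f := fun y : H => @hcou k H (x ** y))
  (g := fun y : H => @hcou k H x * @hcou k H y) _ _ _ _); [lin|lin| |].
  by rewrite cou1 mulr1 (hmulr1 Hal).
by move=> n e s z _ Zz es; rewrite (hmulA Hal) (couM (x ** s) Zz) (couM s Zz) mulr0.
Qed.

(** Right multiplication by the threefold coproduct of the primitive element [z]; to reach the first
    factor, [z] passes both others, whence two copies of [Pn e]. *)
Let R3 e z (t : tensor H (tensor H H)) : tensor H (tensor H H) :=
  tmapS (fun u => u ** z) (tmapS (Pn e) (Pn e)) t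
  + tmapS id (fun s => T s (z ⊠ 𝟙 + 𝟙 ⊠ z)) t.

Let R3_lin e z : linear (R3 e z).
Proof. by rewrite /R3; lin. Qed.

Lemma cop_coassoc x :
  tassocS (tmapS (@hcop k H) id (hcop x)) = tmapS id (@hcop k H) (hcop x).
Proof.
move: x; refine (gen_ext _ _ _ _); [lin|lin| |].
  by rewrite cop1 !tmapP // cop1 tassocP.
move=> n e s z _ Zz es; rewrite (copM s Zz); have rl := R3_lin e z.
(* Both iterated coproducts of s z come from those of s by the same operator [R3 e z], so the
   induction hypothesis applies under it. *)
transitivity (R3 e z (tassocS (tmapS (@hcop k H) id (hcop s)))).
  move: (hcop s); on_pure => a b.
  rewrite (tmul_prim _ _ Zz) linED; [|lin]; rewrite !tmapP // (copM _ Zz).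
  rewrite (linED (@tassoc_lin _ _ _ _)); move: (hcop a).
  on_pure => a1 a2.
  rewrite (tmul_prim _ _ Zz) tpureDl (linED (@tassoc_lin _ _ _ _)).
  rewrite !tassocP /R3 !tmapP //; try lin.
  by rewrite (tmul_prim _ _ Zz) tpureDr addrA.
rewrite es; move: (hcop s); on_pure => a b.
rewrite (tmul_prim _ _ Zz) linED; [|lin]; rewrite !tmapP // (copM _ Zz) /R3 !tmapP //; try lin.
by rewrite cop_parityn.
Qed.

Lemma cop_counitl x : tliftS (fun a b : H => hcou a *: b) (hcop x) = x.
Proof.
move: x; refine (gen_ext _ _ _ _); [lin|lin| |].
  by rewrite cop1 tliftP ?cou1 ?scale1r //; lin.
move=> n e s z _ Zz es; rewrite (copM _ Zz) -[in RHS]es.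
move: (hcop s); on_pure => a b.
rewrite (tmul_prim _ _ Zz) linED; [|lin]; rewrite !tliftP; [|lin..].
by rewrite (couM _ Zz) scale0r add0r (linEZ (bilin_l _ bmul)).
Qed.

Lemma cop_counitr x : tliftS (fun a b : H => hcou b *: a) (hcop x) = x.
Proof.
move: x; refine (gen_ext _ _ _ _); [lin|lin| |].
  by rewrite cop1 tliftP ?cou1 ?scale1r //; lin.
move=> n e s z _ Zz es; rewrite (copM _ Zz) -[in RHS]es.
move: (hcop s); on_pure => a b.
rewrite (tmul_prim _ _ Zz) linED; [|lin]; rewrite !tliftP; [|lin..].
by rewrite (couM _ Zz) scale0r addr0 (linEZ (bilin_l _ bmul)) cou_parityn.
Qed.

Section Antipode.
Variable S : H -> H.
Hypotheses (Sl : linear S) (S1 : S 𝟙 = 𝟙).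
(** A super-antipode reverses products up to the sign (-1)^(e |s|), which [Pn e] encodes without
    mentioning the degree of [s]. *)
Hypothesis SM : forall e s z, Z e z -> S (s ** z) = - (z ** Pn e (S s)).

Lemma gword_S n s : gword n s -> comp n (S s) = S s.
Proof.
elim=> [|m e t z _ ht Zz]; first by rewrite S1 (comp_one Hal).
rewrite (SM _ Zz) (linEN (cl _)) addnC; congr (- _); apply: (comp_mul Hal).
  exact: Zhom Zz.
exact: (parityn_hom' Hgr).
Qed.

Lemma S_comp n x : S (comp n x) = comp n (S x).
Proof.
move: x; refine (gword_ext _ _ _); [lin|lin|] => m y gy.
rewrite (comp_hom Hgr _ (gword_comp gy)) (comp_hom Hgr _ (gword_S gy)).
by case: eqP; rewrite ?linE0.
Qed.

Lemma S_parityn n x : S (Pn n x) = Pn n (S x).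
Proof.
move: x; refine (gword_ext _ _ _); [lin|lin|] => m y gy.
by rewrite (parityn_hom Hgr n (gword_comp gy)) (parityn_hom Hgr n (gword_S gy)) (linEZ Sl).
Qed.

Lemma antipode_gen : antipode S.
Proof.
rewrite /antipode tliftSE; split=> //; first exact: S_comp.
  refine (gen_ext _ _ _ _); [lin|lin| |].
    by rewrite cop1 tliftP ?S1 ?cou1 ?scale1r ?(hmul1 Hal) //; lin.
  move=> n e s z _ Zz es; rewrite (copM _ Zz) (couM _ Zz) scale0r.
  (* On this side nothing cancels term by term: the sum for s z is, up to sign, the supercommutator
     of [z] with the sum for s, and the latter is a scalar by induction. *)
  transitivity (- (z ** Pn e (tliftS (fun a b => S a ** b) (hcop s)))
    + tliftS (fun a b => S a ** b) (hcop s) ** z); last first.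
    rewrite es (linEZ (Pnl e)) (linEZ (bilin_l _ bmul)) (linEZ (bilin_r _ bmul)).
    by rewrite (parityn_one Hgr Hal) (hmul1 Hal) (hmulr1 Hal) addNr.
  move: (hcop s); on_pure => a b.
  rewrite (tmul_prim _ _ Zz) linED; [|lin]; rewrite !tliftP; [|lin..].
  rewrite (SM _ Zz) (linEN (bilin_l _ bmul)) (paritynM Hgr Hal).
  by rewrite !(hmulA Hal).
refine (gen_ext _ _ _ _); [lin|lin| |].
  by rewrite cop1 tliftP ?S1 ?cou1 ?scale1r ?(hmul1 Hal) //; lin.
move=> n e s z _ Zz es; rewrite (copM _ Zz) (couM _ Zz) scale0r.
move: (hcop s); refine (tensor_ext _ _ _); [lin|exact: lin_0|] => a b.
rewrite (tmul_prim _ _ Zz) linED; [|lin]; rewrite !tliftP; [|lin..].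
(* On the other side the two terms cancel for each [a ⊠ b] separately. *)
by rewrite (SM _ Zz) (linEN (bilin_r _ bmul)) S_parityn (hmulA Hal) addrN.
Qed.

Lemma super_hopf_gen : super_hopf H.
Proof.
rewrite /super_hopf /graded_coalgebra; rewrite tliftSE tpureSE tmapSE tassocSE tmulSE.
split=> //; [split=> //| |by exists S; exact: antipode_gen].
- exact: cop_coassoc.
- by move=> x; split; [exact: cop_counitl|exact: cop_counitr].
- by move=> n x; split; [exact: cop_comp|exact: cou_comp].
by split=> //; [exact: cop_mul|exact: cou_mul].
Qed.

End Antipode.

Section Derivation.
Variable d : H -> H.
Hypotheses (dl : linear d) (d1 : d 𝟙 = 0) (dM : super_derivation d).
Hypothesis dodd : forall n x, comp n x = x ->
  exists2 m, comp m (d x) = d x & odd m = ~~ odd n.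

(** The two sides obey the same Leibniz rule along the algebra map Δ, by [tderivM], so they agree as
    soon as they agree on generators. *)
Lemma super_coderivation_gen :
  (forall e z, Z e z -> hcop (d z) = d z ⊠ 𝟙 + 𝟙 ⊠ d z) -> super_coderivation d.
Proof.
move=> dz x; rewrite paritySE tmapSE -/(tderiv d (hcop x)); have tl := tderiv_lin Hgr dl.
move: x; refine (gen_ext _ _ _ _); [lin|lin| |].
  by rewrite d1 (linE0 cop_lin) cop1 /tderiv !tmapP // d1
    tpure0l tpure0r addr0.
move=> n e s z _ Zz es.
rewrite dM paritySE (linED cop_lin) !cop_mul cop_parity es (tderivM Hgr Hal) //.
congr (_ + T _ _); rewrite (dz _ _ Zz) (cop_gen Zz) linED //.
rewrite /tderiv !tmapP // d1 !tpure0l !tpure0r.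
by rewrite addr0 add0r (parity_one Hgr Hal).
Qed.

(** An odd [d] anticommutes with parity, so the cross terms of d d (s z) cancel. *)
Lemma super_derivation_sq : (forall e z, Z e z -> d (d z) = 0) -> forall x, d (d x) = 0.
Proof.
move=> dz x; move: x; refine (gen_ext _ _ _ _); [lin|exact: lin_0|by rewrite d1 linE0|].
move=> n e s z _ Zz es; rewrite dM linED // !dM es (dz _ _ Zz) paritySE.
rewrite (linE0 (bilin_l _ bmul)) (linE0 (bilin_r _ bmul)) add0r addr0.
by rewrite (d_parity Hgr dl dodd) (linEN (bilin_l _ bmul)) addrN.
Qed.

End Derivation.
End PrimitivelyGenerated.

(** * Presented algebras *)

Lemma graded_of_span (k : fieldType) (V : lmodType k) (comp : nat -> V -> V) :
  (forall n, linear (comp n)) ->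
  (forall x, span (fun y => exists m, forall n, comp n y = if n == m then y else 0) x) ->
  graded comp.
Proof.
move=> cl sp.
(* The decomposition is asserted for every larger bound as well, so that the bounds of two summands
   can be replaced by their maximum. *)
have bnd x : exists N, forall M, (N <= M)%N -> comp M x = 0 /\ x = \sum_(n < M) comp n x.
  move: x (sp x); apply: span_ind => [|c x y [N hN] [M hM]|x [m hm]].
  - exists 0%N => M _; split; first exact: linE0.
    by rewrite big1 // => i _; exact: linE0.
  - exists (maxn N M) => K; rewrite geq_max => /andP[/hN[e1 s1] /hM[e2 s2]]; split.
      by rewrite cl e1 e2 scaler0 addr0.
    by rewrite {1}s1 {1}s2 scaler_sumr -big_split; apply: eq_bigr => n _; rewrite cl.
  - exists m.+1 => M lt; rewrite hm gtn_eqF //; split=> //.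
    rewrite (bigD1 (Ordinal lt)) //= hm eqxx big1 ?addr0 // => i ne.
    by rewrite hm; case: eqP => // e; case/eqP: ne; exact: val_inj.
split=> // [m n x|x|x].
- move: x (sp x); apply: span_ind => [|c x y ex ey|x [j hj]].
  + by rewrite !linE0 // if_same.
  + by rewrite !cl ex ey; case: eqP; rewrite // scaler0 addr0.
  + rewrite (hj n); case: (eqVneq n j) => [->|nj]; first by rewrite hj.
    by rewrite linE0 // if_same.
- have [N hN] := bnd x; apply: (sub_finite_set _ (finite_II N)) => n /=.
  by apply: contraNltn => /hN[-> _].
- have [N hN] := bnd x; rewrite (fsbig_bound (N := N)); first by case: (hN N).
  by move=> n /hN[].
Qed.

Section PresentedAlgebra.
Variables (k : fieldType) (X : choiceType).

Lemma fword_mul (u v : seq X) : fword k u * fword k v = fword k (u ++ v).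
Proof. by rewrite /fword malgM_def fgmulUU mulr1; congr << _ >>; apply/eqP; rewrite fmP fmM. Qed.

Lemma falg_span (a : falg k X) : span (fun b => exists w, b = fword k w) a.
Proof.
by apply: (span_mono _ (malg_span a)) => _ [[w] ->]; exists w.
Qed.

Lemma falg_ext (W : lmodType k) (f g : falg k X -> W) : linear f -> linear g ->
  (forall w, f (fword k w) = g (fword k w)) -> forall a, f a = g a.
Proof. by move=> lf lg e a; apply: span_ext (falg_span a) => // _ [w ->]. Qed.

Lemma falg_mul_bilin : bilin (fun a b : falg k X => a * b).
Proof.
split=> [b|a] c x y; first by rewrite mulrDl scalerAl.
by rewrite mulrDr falg_scalerAr.
Qed.

Definition wlin (W : lmodType k) (f : seq X -> W) : falg k X -> W :=
  flin (fun m : {fmonom X} => f m).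

Lemma wlin_lin (W : lmodType k) (f : seq X -> W) : linear (wlin f).
Proof. exact: flin_linear. Qed.

Lemma wlinE (W : lmodType k) (f : seq X -> W) w : wlin f (fword k w) = f w.
Proof. exact: flinU. Qed.

Lemma eq_wlin (W : lmodType k) (f g : seq X -> W) a : f =1 g -> wlin f a = wlin g a.
Proof. by move=> /funext->. Qed.

Lemma wlin_comp (W W' : lmodType k) (h : W -> W') (f : seq X -> W) a : linear h ->
  wlin (fun w => h (f w)) a = h (wlin f a).
Proof.
move=> lh; have l1 := wlin_lin f; have l2 := wlin_lin (fun w => h (f w)).
by move: a; refine (falg_ext _ _ _); [lin|lin|] => w; rewrite !wlinE.
Qed.

Lemma wlin_ctx (W : lmodType k) (f : seq X -> W) u v a :
  wlin f (fword k u * a * fword k v) = wlin (fun w => f (u ++ w ++ v)) a.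
Proof.
have l1 := wlin_lin f; have l2 := wlin_lin (fun w => f (u ++ w ++ v)).
have bm := falg_mul_bilin.
have l3 : linear (fun a => fword k u * a * fword k v).
  exact: (lin_comp (bilin_l _ bm) (bilin_r _ bm)).
move: a; refine (falg_ext (lin_comp l1 l3) l2 _) => w.
by rewrite !fword_mul !wlinE catA.
Qed.

Variable R : falg k X -> Prop.

(** The ideal allows arbitrary outer factors; by linearity it suffices to test words around a
    relator. *)
Lemma pliftE (W : lmodType k) (f : seq X -> W) :
  (forall u v a, R a -> wlin (fun w => f (u ++ w ++ v)) a = 0) ->
  linear (plift (R := R) f) /\ forall w, plift f (pword R w) = f w.
Proof.
move=> fR; have [|L E] := @qliftE k _ W (fun m : {fmonom X} => f m) (ideal_gen R).
  move=> _ [a r b Rr].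
  have l1 := wlin_lin f; have bm := falg_mul_bilin.
  rewrite -[LHS]/(wlin f (a * r * b)).
  refine (falg_ext (g := fun _ => 0) (lin_comp l1 (bilin_r (a * r) bm)) (@lin_0 _ _ _) _ b).
  move=> v; move: a; refine (falg_ext (g := fun _ => 0)
    (lin_comp l1 (lin_comp (bilin_l (fword k v) bm) (bilin_l r bm))) (@lin_0 _ _ _) _) => u.
  by rewrite wlin_ctx fR.
by split=> // w; rewrite /plift /pword E; exact: flinU.
Qed.

Lemma palg_span (x : palg R) : span (fun y => exists w, y = pword R w) x.
Proof.
rewrite -(qpiK x); apply: (span_lin _ _ (falg_span _)); first exact: qpi_linear.
by move=> _ [w ->]; apply: span_incl; exists w.
Qed.

Lemma palg_ext (W : lmodType k) (f g : palg R -> W) : linear f -> linear g ->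
  (forall w, f (pword R w) = g (pword R w)) -> forall x, f x = g x.
Proof. by move=> lf lg e x; apply: span_ext (palg_span x) => // _ [w ->]. Qed.

End PresentedAlgebra.

Ltac on_words := refine (palg_ext _ _ _); [lin|lin|].

Section PresentedMultiplication.
Variables (k : fieldType) (X : choiceType) (R : falg k X -> Prop).

Lemma pmul_bilin : bilin (@pmul k X R).
Proof.
have ql := @qpi_linear _ _ (ideal_gen R); have bm := @falg_mul_bilin k X.
have sur (x : palg R) : exists a, qpi (ideal_gen R) a = x.
  by exists (generic_quotient.repr x); exact: qpiK.
split=> [y|x] c u v; have [b <-] := sur u; have [d <-] := sur v.
- have [a <-] := sur y.
  have e1 := etrans (congr1 (fun z => pmul z (qpi _ a)) (esym (ql c b d))) (pmulE R _ a).
  have e2 := etrans (congr1 (qpi (ideal_gen R)) (bilin_l a bm c b d)) (ql c (b * a) (d * a)).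
  have e3 := f_equal2 (fun s t => c *: s + t) (esym (pmulE R b a)) (esym (pmulE R d a)).
  exact (etrans e1 (etrans e2 e3)).
- have [a <-] := sur x.
  have e1 := etrans (congr1 (fun z => pmul (qpi _ a) z) (esym (ql c b d))) (pmulE R a _).
  have e2 := etrans (congr1 (qpi (ideal_gen R)) (bilin_r a bm c b d)) (ql c (a * b) (a * d)).
  have e3 := f_equal2 (fun s t => c *: s + t) (esym (pmulE R a b)) (esym (pmulE R a d)).
  exact (etrans e1 (etrans e2 e3)).
Qed.

Lemma pword_mul u v : pmul (pword R u) (pword R v) = pword R (u ++ v).
Proof. by rewrite /pword pmulE fword_mul. Qed.

Lemma pword_wlin a : wlin (pword R) a = qpi (ideal_gen R) a.
Proof.
have l1 := wlin_lin (pword R); have l2 := @qpi_linear _ _ (ideal_gen R).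
by move: a; refine (falg_ext _ _ _); [lin|lin|] => w; rewrite wlinE.
Qed.

Lemma pword_rel u v a : R a -> wlin (fun w => pword R (u ++ w ++ v)) a = 0.
Proof.
move=> Ra; rewrite -wlin_ctx pword_wlin -(linE0 (@qpi_linear _ _ (ideal_gen R))).
by apply/qpiE; rewrite subr0; apply: span_incl; exact: IdealGen.
Qed.

Lemma pmulA : associative (@pmul k X R).
Proof.
have bm := pmul_bilin => x y z.
move: x; on_words => u.
move: y; on_words => v.
move: z; on_words => w.
by rewrite !pword_mul catA.
Qed.

Lemma pmul1 x : pmul (pword R [::]) x = x.
Proof.
have bm := pmul_bilin; move: x; on_words => u.
by rewrite pword_mul.
Qed.

Lemma pmulr1 x : pmul x (pword R [::]) = x.
Proof.
have bm := pmul_bilin; move: x; on_words => u.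
by rewrite pword_mul cats0.
Qed.

End PresentedMultiplication.

Arguments wlin {k X W} f a.

Section PrimHopf.
Variables (k : fieldType) (X : choiceType) (R : falg k X -> Prop) (e : nat).
Local Notation H := (primHopf R e).
Local Notation W := (pword R).
Local Notation Wd w := (pword R w : H).
Local Notation "x ** y" := (@hmul k H x y) (at level 37, left associativity).

Lemma prim_mulE u v : Wd u ** Wd v = Wd (u ++ v).
Proof. exact: pword_mul. Qed.

Definition pcompw n (w : seq X) : palg R := if (e * size w == n)%N then W w else 0.
Hypothesis Rcomp : forall n u v a, R a -> wlin (fun w => pcompw n (u ++ w ++ v)) a = 0.

Let cE n : linear (@hcomp k H n) /\ forall w, hcomp n (Wd w) = pcompw n w.
Proof. exact: (pliftE (@Rcomp n)). Qed.

Lemma prim_compE n w : hcomp n (Wd w) = if (e * size w == n)%N then W w else 0.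
Proof. exact: (cE n).2. Qed.

Lemma prim_comp_word w : hcomp (e * size w)%N (Wd w) = W w.
Proof. by rewrite prim_compE eqxx. Qed.

Lemma prim_graded : graded (@hcomp k H).
Proof.
apply: graded_of_span => [n|x]; first exact: (cE n).1.
apply: (span_mono _ (palg_span (x : palg R))) => _ [w ->].
by exists (e * size w)%N => n; rewrite (cE n).2 /pcompw eq_sym.
Qed.

Lemma prim_graded_algebra : graded_algebra H.
Proof.
have cl n := (cE n).1; have bm : bilin (@hmul k H) := @pmul_bilin k X R.
split.
- exact: bm.
- exact: pmulA.
- by split; [exact: pmul1|exact: pmulr1].
- by rewrite -[RHS](prim_comp_word [::]) /= muln0.
- move=> m n x y; cbv zeta.
  move: x; on_words => u.
  move: y; on_words => v.
  rewrite !prim_compE; case: eqP => [<-|_]; last by rewrite (linE0 (bilin_l _ bm)) linE0.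
  case: eqP => [<-|_]; last by rewrite (linE0 (bilin_r _ bm)) linE0.
  by rewrite prim_mulE -mulnDr -size_cat; exact: prim_comp_word.
Qed.

Let Hgr := prim_graded.
Let Hal := prim_graded_algebra.
Local Notation T := (tmulS (@hcomp k H) (@hmul k H)).
Local Notation "𝟙" := (hone H).
Let bmul : bilin (@hmul k H) := @pmul_bilin k X R.
Let Tb : bilin T := tmul_bilin Hgr bmul.

Definition prim_elt (x : X) : tensor H H := Wd [:: x] ⊠ 𝟙 + 𝟙 ⊠ Wd [:: x].
Definition pcopw (w : seq X) : tensor H H := foldr (fun x => T (prim_elt x)) (𝟙 ⊠ 𝟙) w.

Lemma pcopw_cat u v : pcopw (u ++ v) = T (pcopw u) (pcopw v).
Proof.
elim: u => [|x u IH] /=; first by rewrite (tmul1 Hgr Hal).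
by rewrite IH (tmulA Hgr Hal).
Qed.

(** No surrounding words appear here: [pcopw] is multiplicative, so vanishing on a relator spreads
    to the ideal. *)
Hypothesis Rcop : forall a, R a -> wlin pcopw a = 0.
Hypothesis Rcou : forall u v a, R a ->
  wlin (fun w => (if u ++ w ++ v is [::] then 1 else 0) : k^o) a = 0.

Let copE : linear (@hcop k H) /\ forall w, hcop (Wd w) = pcopw w.
Proof.
have -> : @hcop k H = plift (R := R) pcopw.
  by rewrite /= tmulSE tpureSE.
apply: pliftE => u v a Ra.
rewrite (eq_wlin _ (g := fun w => T (pcopw u) (T (pcopw w) (pcopw v)))).
  have l1 : linear (fun t => T (pcopw u) (T t (pcopw v))) by lin.
  by rewrite (wlin_comp _ _ l1) (Rcop Ra); exact: (linE0 l1).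
by move=> w; rewrite !pcopw_cat.
Qed.

Let couE : linear (fun x : H => hcou x : k^o) /\
  forall w, @hcou k H (W w) = if w is [::] then 1 else 0.
Proof. exact: (pliftE (W := k^o) Rcou). Qed.

Lemma prim_cop_lin : linear (@hcop k H). Proof. exact: copE.1. Qed.
Lemma prim_copE w : hcop (Wd w) = pcopw w. Proof. exact: copE.2. Qed.
Lemma prim_cou_lin : linear (fun x : H => hcou x : k^o). Proof. exact: couE.1. Qed.
Lemma prim_couE w : @hcou k H (W w) = if w is [::] then 1 else 0. Proof. exact: couE.2. Qed.

(** Each generator contributes -1 as a primitive element and (-1)^(e i) for passing the [i]
    generators before it when the word is reversed. *)
Definition psign n : k := iteri n (fun i s => - (-1) ^+ (e * i) * s) 1.
Definition pSw (w : seq X) : palg R := psign (size w) *: W (rev w).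
Hypothesis RS : forall u v a, R a -> wlin (fun w => pSw (u ++ w ++ v)) a = 0.
Definition pantipode : H -> H := plift pSw.

Let SE : linear pantipode /\ forall w, pantipode (Wd w) = pSw w.
Proof. exact: (pliftE RS). Qed.

Definition prim_gen (n : nat) (z : H) := n = e /\ exists x, z = Wd [:: x].

Lemma prim_gen_hom n z : prim_gen n z -> hcomp n z = z.
Proof. by case=> -> [x ->]; rewrite prim_compE muln1 eqxx. Qed.

Lemma prim_generated (x : H) : span (fun y => exists n, gword prim_gen n y) x.
Proof.
apply: (span_mono _ (palg_span (x : palg R))) => _ [w ->].
elim/last_ind: w => [|w x' [n IH]]; first by exists 0%N; exact: gword1.
exists (n + e)%N; rewrite -cats1 -prim_mulE.
by apply: gwordM IH _; split=> //; exists x'.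
Qed.

Lemma prim_elt_cop x : pcopw [:: x] = prim_elt x.
Proof. exact: (tmulr1 Hgr Hal). Qed.

Lemma prim_copM n (s z : H) : prim_gen n z -> hcop (s ** z) = T (hcop s) (z ⊠ 𝟙 + 𝟙 ⊠ z).
Proof.
case=> _ [x ->]; have cl := prim_cop_lin.
move: s; on_words => w.
rewrite prim_mulE (prim_copE (w ++ [:: x])) (prim_copE w).
by rewrite pcopw_cat prim_elt_cop.
Qed.

Lemma prim_couM n (s z : H) : prim_gen n z -> hcou (s ** z) = 0.
Proof.
case=> _ [x ->]; have cl := prim_cou_lin.
move: s; refine (palg_ext (W := k^o) (f := fun s : H => hcou (s ** Wd [:: x]))
  (g := fun _ => 0) _ _ _); [lin|exact: lin_0|] => w.
rewrite prim_mulE.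
by rewrite prim_couE; case: w.
Qed.

Lemma prim_SM n (s z : H) : prim_gen n z ->
  pantipode (s ** z) = - (z ** parityn (@hcomp k H) n (pantipode s)).
Proof.
case=> -> [x ->]; have Sl := SE.1; have pl := parityn_lin Hgr e.
move: s; on_words => w.
rewrite prim_mulE (SE.2 (w ++ [:: x])) (SE.2 w) /pSw.
rewrite (linEZ pl) (linEZ (bilin_r _ bmul)) cats1 size_rcons rev_rcons.
rewrite (parityn_hom Hgr e (prim_comp_word (rev w))) (linEZ (bilin_r _ bmul)) scalerA.
rewrite prim_mulE /= -scaleNr; congr (_ *: _).
rewrite size_rev mulNr mulrC; congr (- (_ * _)).
(* The two exponents differ by a further factor e, and e * e has the parity of e. *)
by rewrite -[RHS]signr_odd !oddM -signr_odd oddM; case: (odd e) => //=; rewrite ?andbT ?andbF.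
Qed.

Lemma prim_super_hopf : super_hopf H.
Proof.
apply: (super_hopf_gen Hgr Hal prim_gen_hom prim_generated prim_cop_lin prim_cou_lin
  _ _ prim_copM prim_couM SE.1 _ prim_SM).
- exact: (prim_copE [::]).
- exact: (prim_couE [::]).
- by rewrite [LHS](SE.2 [::]) /pSw scale1r.
Qed.

End PrimHopf.

(** * Enveloping algebras *)

Section Multilinear.
Variables (k : fieldType) (V : lmodType k).

Lemma wlin_linear_rel (W : lmodType k) (f : seq V -> W) c x y :
  wlin f (fword k [:: c *: x + y] - c *: fword k [:: x] - fword k [:: y])
  = f [:: c *: x + y] - c *: f [:: x] - f [:: y].
Proof.
have l := wlin_lin f; rewrite (linEB l) (linEB l (fword k _)) (linEZ l).
exact: (f_equal2 (fun s t => s - t) (f_equal2 (fun s t => s - c *: t) (wlinE _ _) (wlinE _ _))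
  (wlinE _ _)).
Qed.

Lemma multilinear_rel (W : lmodType k) (f : seq V -> W) a :
  linear (fun x => f [:: x]) -> linear_rel a -> wlin f a = 0.
Proof.
move=> lf [c x y]; rewrite wlin_linear_rel lf.
by rewrite addrAC addrK subrr.
Qed.

Lemma pword_linear (R : falg k V -> Prop) u v : (forall a, linear_rel a -> R a) ->
  linear (fun x => pword R (u ++ x :: v)).
Proof.
move=> lR c x y.
have := pword_rel u v (lR _ (LinearRel c x y)); rewrite wlin_linear_rel.
by move/eqP; rewrite subr_eq0 subr_eq addrC => /eqP.
Qed.

End Multilinear.

(** * Conjugation in a cocommutative Hopf algebra *)

Section CocommutativeHopf.
Variables (k : fieldType) (H : superHopfData k).
Local Notation "x ** y" := (@hmul k H x y) (at level 37, left associativity).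
Hypotheses (bmul : bilin (@hmul k H)) (Hco : graded_coalgebra H).
Hypothesis cocomm : forall x : H, tliftS (fun a b => b ⊠ a) (hcop x) = hcop x.

Lemma eq_cop3 (V : lmodType k) (f f' : H -> H -> H -> V) h :
  (forall a b c, f a b c = f' a b c) -> cop3 f h = cop3 f' h.
Proof.
move=> e; suff -> : f = f' by [].
by apply/funext => a; apply/funext => b; apply/funext => c; exact: e.
Qed.

(** Cocommutativity exchanges the first two legs; after reassociating, S(h2) h3 collapses by the
    antipode identity. [Phi] and [Psi] are the expression before and after the exchange. This is
    what makes the trivial coaction compatible with every action of U(g). *)
Lemma cop3_conj (V : lmodType k) (F : H -> V) (S : H -> H) (h : H) :
  linear F -> antipode S ->
  cop3 (fun h1 h2 h3 => F h2 ⊗ (S h1 ** h3)) h = F h ⊗ hone H.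
Proof.
rewrite /cop3 tpureSE tliftSE tmapSE => lF [Sl _ + _]; rewrite tliftSE => SK.
case: Hco => cl el; rewrite tassocSE tmapSE tliftSE => coA coE _.
pose Phi := tliftS (fun p (c : H) => tliftS (fun a b => F b ⊠ (S a ** c)) p).
pose Psi := tliftS (fun (a : H) p => F a ⊠ tliftS (fun b c => S b ** c) p).
have Phil : linear Phi by rewrite /Phi; lin.
have Psil : linear Psi by rewrite /Psi; lin.
rewrite -[LHS]/(Phi (tmapS (@hcop k H) id (hcop h))).
transitivity (Psi (tassocS (tmapS (@hcop k H) id (hcop h)))).
  move: (hcop h); on_pure => a c.
  rewrite !tmapP //; rewrite -{1}cocomm /=; move: (hcop a).
  on_pure => a1 a2.
  by rewrite tassocP /Phi /Psi; tsimp.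
rewrite coA.
transitivity (tliftS (fun a b => hcou b *: (F a ⊠ hone H)) (hcop h)).
  move: (hcop h); on_pure => a b.
  by rewrite tmapP // /Psi; tsimp; rewrite SK tpureZr.
rewrite -[in RHS](coE h).2; move: (hcop h).
on_pure => a b.
by tsimp; rewrite (linEZ lF) tpureZl.
Qed.

End CocommutativeHopf.

Section Enveloping.
Variables (k : fieldType) (g : lieAlgType k).
Local Notation U := (Uenv g).
Local Notation R := (@env_rel k g).
Local Notation W w := (pword R w : U).
Local Notation "x ** y" := (@hmul k U x y) (at level 37, left associativity).

Lemma wlin_lie_rel (V : lmodType k) (f : seq g -> V) x y :
  wlin f (fword k [:: x; y] - fword k [:: y; x] - fword k [:: lie x y])
  = f [:: x; y] - f [:: y; x] - f [:: lie x y].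
Proof.
have l := wlin_lin f; rewrite (linEB l) (linEB l (fword k _)).
exact: (f_equal2 (fun s t => s - t) (f_equal2 (fun s t => s - t) (wlinE _ _) (wlinE _ _))
  (wlinE _ _)).
Qed.

Lemma env_rel_vanish (V : lmodType k) (f : seq g -> V) :
  linear (fun x => f [:: x]) -> (forall x y, f [:: x; y] = f [:: y; x] + f [:: lie x y]) ->
  forall a, R a -> wlin f a = 0.
Proof.
move=> lf fl _ [a /multilinear_rel|x y]; first exact.
by rewrite wlin_lie_rel fl [f [:: y; x] + _]addrC addrK subrr.
Qed.

Lemma env_word_linear u v : linear (fun x => W (u ++ x :: v)).
Proof. by apply: pword_linear => a; exact: env_lin. Qed.

Lemma env_word_lie u v x y :
  W (u ++ x :: y :: v) = W (u ++ y :: x :: v) + W (u ++ lie x y :: v).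
Proof.
have := pword_rel u v (@env_lie k g x y); rewrite wlin_lie_rel /=.
by move/eqP; rewrite subr_eq0 subr_eq addrC => /eqP.
Qed.

Lemma uin_lin : linear (@uin k g).
Proof. exact: (env_word_linear [::] [::]). Qed.

Fact env_comp n u v a : R a -> wlin (fun w => pcompw R 0 n (u ++ w ++ v)) a = 0.
Proof.
rewrite /pcompw; under eq_wlin do rewrite mul0n.
by case: eqP => _; [exact: pword_rel|move: a; apply: env_rel_vanish => [|x y]; [exact:
  lin_0|rewrite addr0]].
Qed.

Lemma env_graded : graded (@hcomp k U). Proof. exact: (prim_graded env_comp). Qed.
Lemma env_graded_algebra : graded_algebra U.
Proof. exact: (prim_graded_algebra env_comp). Qed.

Lemma env_comp0 (a : U) : hcomp 0 a = a.
Proof.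
have cl : linear (@hcomp k U 0) by case: env_graded.
move: a; on_words => w.
by rewrite (prim_compE env_comp).
Qed.

Lemma env_mul_bilin : bilin (@hmul k U). Proof. exact: pmul_bilin. Qed.
Local Notation T := (tmulS (@hcomp k U) (@hmul k U)).

Lemma env_tmul (a b c d : U) : T (a ⊠ b) (c ⊠ d) = a ** c ⊠ b ** d.
Proof. exact: (tmulP env_graded env_graded_algebra a b d (env_comp0 c)). Qed.

Fact env_cop a : R a -> wlin (pcopw R 0) a = 0.
Proof.
have ul := uin_lin; have bm := env_mul_bilin.
have bT := tmul_bilin env_graded bm.
have pE x : pcopw R 0 [:: x] = uin x ⊠ hone U + hone U ⊠ uin x.
  exact: (prim_elt_cop env_comp).
move: a; apply: env_rel_vanish => [|x y].
  have -> : (fun x : g => pcopw R 0 [:: x]) = fun x => uin x ⊠ hone U + hone U ⊠ uin x.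
    by apply/funext.
  lin.
have eq_xy : uin x ** uin y = uin y ** uin x + uin (lie x y).
  exact: etrans (prim_mulE R 0 [:: x] [:: y]) (etrans (env_word_lie [::] [::] x y)
    (congr1 (+%R^~ _) (esym (prim_mulE R 0 [:: y] [:: x])))).
have cE u v : pcopw R 0 [:: u; v] =
    T (uin u ⊠ hone U + hone U ⊠ uin u) (uin v ⊠ hone U + hone U ⊠ uin v).
  by rewrite [LHS](pcopw_cat env_comp [:: u] [:: v]) !pE.
rewrite cE cE pE.
exact: (tmul_prim_bracket env_graded env_graded_algebra (env_comp0 _) (env_comp0 _) eq_xy).
Qed.

Fact env_cou u v a : R a ->
  wlin (fun w => (if u ++ w ++ v is [::] then 1 else 0) : k^o) a = 0.
Proof.
have z x (w : seq g) : (if u ++ (x :: w) ++ v is [::] then 1 else 0) = 0 :> k^o by case: u.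
by apply: env_rel_vanish => [c x y|x y]; rewrite !z ?scaler0 addr0.
Qed.

Fact env_antipode u v a : R a -> wlin (fun w => pSw R 0 (u ++ w ++ v)) a = 0.
Proof.
have rw x : rev (u ++ [:: x] ++ v) = rev v ++ x :: rev u.
  by rewrite catA cats1 rev_cat rev_rcons.
have rw2 x y : rev (u ++ [:: x; y] ++ v) = rev v ++ y :: x :: rev u.
  by rewrite !rev_cat -catA.
apply: env_rel_vanish => [c x y|x y].
  rewrite /pSw !size_cat /= !rw (env_word_linear (rev v) (rev u)).
  by rewrite scalerDr !scalerA mulrC.
rewrite /pSw !rw2 rw !size_cat /= (env_word_lie (rev v) (rev u) x y) !addnS.
(* Reversal exchanges x and y in the relator, while the bracket term is one letter shorter and so
   has the opposite sign; the two effects compensate. *)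
have -> n : psign k 0 n.+1 = - psign k 0 n by rewrite /psign /= mul0n mulN1r.
have AC (V : lmodType k) (s : k) (A B : V) : - s *: A = - s *: (A + B) + s *: B.
  by rewrite !scaleNr scalerDr opprD addrNK.
exact: AC.
Qed.

Lemma env_super_hopf : super_hopf U.
Proof. exact: (prim_super_hopf env_comp env_cop env_cou env_antipode). Qed.

Lemma env_hopf : hopf U.
Proof. by split; [exact: env_super_hopf|exact: env_comp0]. Qed.

Lemma env_cop_lin : linear (@hcop k U). Proof. exact: (prim_cop_lin env_comp env_cop). Qed.
Lemma env_cou_lin : linear (fun x : U => hcou x : k^o).
Proof. exact: (prim_cou_lin env_cou). Qed.
Lemma env_copE w : hcop (W w) = pcopw R 0 w. Proof. exact: (prim_copE env_comp env_cop). Qed.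
Lemma env_couE w : hcou (W w) = if w is [::] then 1 else 0.
Proof. exact: (prim_couE 0 env_cou). Qed.
Lemma env_cop_cons x w :
  hcop (W (x :: w)) = T (uin x ⊠ hone U + hone U ⊠ uin x) (hcop (W w)).
Proof. by rewrite !env_copE. Qed.
Lemma env_cop_uin x : hcop (uin x : U) = uin x ⊠ hone U + hone U ⊠ uin x.
Proof. by rewrite [LHS](env_copE [:: x]) (prim_elt_cop env_comp). Qed.
Lemma env_cop1 : hcop (hone U) = hone U ⊠ hone U. Proof. exact: (env_copE [::]). Qed.
Lemma env_mulE u v : W u ** W v = W (u ++ v). Proof. exact: prim_mulE. Qed.

Lemma env_copM (a b : U) : hcop (a ** b) = T (hcop a) (hcop b).
Proof.
have [_ _ _ [e _ _ _] _] := env_super_hopf.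
by rewrite e tmulSE.
Qed.

Lemma env_couM (a b : U) : hcou (a ** b) = hcou a * hcou b.
Proof. by have [_ _ _ []] := env_super_hopf. Qed.

Lemma env_cou1 : hcou (hone U) = 1. Proof. exact: (env_couE [::]). Qed.
Lemma env_cou_uin x : hcou (uin x : U) = 0. Proof. exact: (env_couE [:: x]). Qed.

Lemma env_cocomm (x : U) : tliftS (fun a b => b ⊠ a) (hcop x) = hcop x.
Proof.
have bm := env_mul_bilin; have cl := env_cop_lin.
have bT := tmul_bilin env_graded bm.
move: x; on_words => w.
elim: w => [|x w IH]; first by rewrite [hcop _]env_cop1; tsimp.
rewrite env_cop_cons -[in RHS]IH.
exact: (tmul_prim_flip env_graded env_graded_algebra _ _ env_comp0).
Qed.

End Enveloping.

(** * Modules over U(g) and the extension of a cocycle *)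

Section EnvelopingAction.
Variables (k : fieldType) (g : lieAlgType k) (V : lmodType k) (act : V -> g -> V).
Hypothesis hact : right_module act.
Local Notation U := (Uenv g).
Local Notation R := (@env_rel k g).
Local Notation W w := (pword R w : U).
Local Notation "x ** y" := (@hmul k U x y) (at level 37, left associativity).
Let bact : bilin act := hact.1.

Lemma foldl_act_lin w : linear (fun v => foldl act v w).
Proof.
elim: w => [|x w IH] /=; first exact: lin_id.
exact: (lin_comp IH (bilin_l x bact)).
Qed.

Let uactE v : linear (uact act v) /\ forall w, uact act v (W w) = foldl act v w.
Proof.
apply: pliftE => s t a; apply: env_rel_vanish => [c x y|x y]; rewrite !foldl_cat /=.
  by rewrite (bilin_r _ bact) (foldl_act_lin t).
by rewrite -(linED (foldl_act_lin t)) hact.2 addrC subrK.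
Qed.

Lemma uact_word v w : uact act v (W w) = foldl act v w. Proof. exact: (uactE v).2. Qed.

Lemma uact_bilin : bilin (uact act).
Proof.
split=> [a c u v|v]; last exact: (uactE v).1.
have lu v' := (uactE v').1.
move: a; on_words => w.
by rewrite !uact_word foldl_act_lin.
Qed.

Lemma uact1 v : uact act v (hone U) = v. Proof. exact: (uact_word v [::]). Qed.
Lemma uact_uin v x : uact act v (uin x) = act v x. Proof. exact: (uact_word v [:: x]). Qed.
Lemma uactM v (a b : U) : uact act v (a ** b) = uact act (uact act v a) b.
Proof.
have bu := uact_bilin; have bm := @env_mul_bilin k g.
move: a; on_words => s.
move: b; on_words => t.
by rewrite env_mulE !uact_word foldl_cat.
Qed.

(** For the trivial coaction the compatibility compares v h ⊗ 1 with v h2 ⊗ S(h1) h3, which is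
    [cop3_conj]. *)
Lemma uact_crossed : crossed_module (uact act) (@trivial_coact k g V).
Proof.
have bu := uact_bilin; have [_ _ Hco _ _] := @env_super_hopf k g.
have bm := @env_mul_bilin k g; have cl := @env_cou_lin k g.
split.
- exact: bu.
- by split; [exact: uact1|exact: uactM].
- by rewrite /trivial_coact tpureSE; lin.
- rewrite /trivial_coact tassocSE tmapSE tpureSE tliftSE; split=> v.
    by rewrite !tmapP ?tassocP ?env_cop1 //; [exact: env_cop_lin|lin].
  by rewrite tliftP ?env_cou1 ?scale1r //; lin.
- move=> S aS v h; apply: (etrans (esym (cop3_conj bm Hco (@env_cocomm k g) h (bilin_r v bu)
  aS))).
  apply: eq_cop3 => h1 h2 h3; rewrite /trivial_coact tpureSE tliftSE.
  apply: esym; rewrite tliftP; last by lin.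
  by rewrite (hmulr1 (@env_graded_algebra k g) (S h1)).
Qed.

Variable om : g -> V.
Hypothesis hom : cocycle act om.

Definition omw (w : seq g) : V := if w is x :: w' then foldl act (om x) w' else 0.

Lemma omw_cat u v : omw (u ++ v) = foldl act (omw u) v + (if u is [::] then omw v else 0).
Proof.
case: u => [|x u] /=; last by rewrite foldl_cat addr0.
by rewrite (linE0 (foldl_act_lin v)) add0r.
Qed.

(** A Lie relator at the front of a word is respected by the cocycle identity, one further inside by
    the module identity. *)
Let omE : linear (omext act om) /\ forall w, omext act om (W w) = omw w.
Proof.
apply: pliftE => s t a; apply: env_rel_vanish => [c x y|x y] /=.
  case: s => [|z s] /=; first by rewrite hom.1 (foldl_act_lin t).
  by rewrite !foldl_cat /= (bilin_r _ bact) (foldl_act_lin t).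
case: s => [|z s] /=.
  by rewrite -(linED (foldl_act_lin t)) hom.2 addrC subrK.
by rewrite !foldl_cat /= -(linED (foldl_act_lin t)) hact.2 addrC subrK.
Qed.

Lemma omext_lin : linear (omext act om). Proof. exact: omE.1. Qed.
Lemma omext_uin x : omext act om (uin x) = om x. Proof. exact: (omE.2 [:: x]). Qed.
Lemma omext1 : omext act om (hone U) = 0. Proof. exact: (omE.2 [::]). Qed.
Lemma omextM (a b : U) :
  omext act om (a ** b) = uact act (omext act om a) b + hcou a *: omext act om b.
Proof.
have bu := uact_bilin; have bm := @env_mul_bilin k g; have lo := omext_lin.
have cl := @env_cou_lin k g.
move: a; on_words => s.
move: b; on_words => t.
rewrite env_mulE !omE.2 uact_word omw_cat env_couE.
by case: s => [|x s]; rewrite ?scale1r ?scale0r.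
Qed.

Lemma omext_proj (a : U) : omext act om (proj_aug a) = omext act om a.
Proof. by rewrite /proj_aug (linEB omext_lin) (linEZ omext_lin) omext1 scaler0 subr0. Qed.

(** The adjoint coaction of a cocommutative Hopf algebra is trivial, again by [cop3_conj], so the
    colinearity condition is that for trivial coactions. *)
Lemma omext_crossed :
  aug_crossed_morphism (uact act) (@trivial_coact k g V) (omext act om).
Proof.
have bu := uact_bilin; have [_ _ Hco _ _] := @env_super_hopf k g.
have bm := @env_mul_bilin k g.
split; first exact: omext_lin.
  by move=> a h a0; rewrite omextM a0 scale0r addr0.
by move=> S aS a _; exact: (cop3_conj bm Hco (@env_cocomm k g) a omext_lin aS).
Qed.

End EnvelopingAction.

(** * Bases and contractions on the Grassmann algebra *)

Lemma mcoeff_lin (k : fieldType) (K : choiceType) (m : K) :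
  linear (fun z : {malg k[K]} => z@_m : k^o).
Proof. by move=> c u w; rewrite mcoeffD mcoeffZ. Qed.

Section Basis.
Variables (k : fieldType) (V : lmodType k).

Let indep (S : set V) := forall x : {malg k[V]},
  (forall m, m \in msupp x -> S m) -> flin id x = 0 -> x = 0.

(** A linear relation has finite support, so a relation on the union of a chain already lives on one
    of its members. *)
Let indep_maximal : exists A, indep A /\ forall B, (A `<` B)%classic -> ~ indep B.
Proof.
apply: Zorn_bigcup => F Fi Ft x Sx x0.
(* The empty support is kept apart because the chain [F] may be empty. *)
have [s0|[A FA sA]] : (msupp x : seq V) = [::] \/ exists2 A, F A & {in msupp x, forall m, A m}.
  have Ss m : m \in (msupp x : seq V) -> (\bigcup_(X in F) X)%classic m by exact: Sx.
  have sub_seq (s : seq V) : (forall m, m \in s -> (\bigcup_(X in F) X)%classic m) ->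
      s = [::] \/ exists2 A, F A & {in s, forall m, A m}; last first.
    by case: (sub_seq _ Ss) => [|[A FA sA]]; [left|right; exists A].
  elim: s => [|m s IH] {}Ss; [by left|right].
  have [A FA Am] : (\bigcup_(X in F) X)%classic m by apply: Ss; rewrite mem_head.
  case: IH => [n ns|->|[B FB sB]]; first by apply: Ss; rewrite inE ns orbT.
    by exists A => // n; rewrite inE => /eqP ->.
  case: (Ft A B FA FB) => sub; [exists B|exists A] => // n; rewrite inE.
    by case/predU1P => [->|/sB //]; exact: sub.
  by case/predU1P => [->//|/sB]; exact: sub.
- by apply/malgP => m; rewrite mcoeff0; apply: mcoeff_outdom; rewrite -[_ \in _]/(m \in (msupp x
  : seq V)) s0.
- exact: (Fi A FA x).
Qed.

Lemma basis_exists : exists (B : choiceType) (b : B -> V) (co : V -> {malg k[B]}),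
  [/\ linear co, forall v, flin b (co v) = v & forall e, co (b e) = << e >>].
Proof.
have [A [iA mA]] := indep_maximal.
have flin_span (y : {malg k[V]}) : (forall m, m \in msupp y -> A m) -> span A (flin id y).
  move=> sy; rewrite /flin big_seq; apply: span_sum => m my; apply/spanZ/span_incl.
  exact: sy.
have spA v : span A v.
  apply: contrapT => nv.
  have Av : ~ A v by move=> /span_incl.
  apply: (mA (A `|` [set v])%classic).
    split; first by move=> m; left.
    by move=> /(_ v (or_intror erefl)).
  (* If the coefficient [c] of [v] is zero, the relation lives on [A]; otherwise it expresses [v]
     through [A], against the choice of [v]. *)
  move=> x Sx x0; pose c := x@_v; pose y := x - c *: << v >>.
  have yA m : m \in msupp y -> A m.
    rewrite -mcoeff_neq0 /y mcoeffB mcoeffZ mcoeffU.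
    case: (eqVneq v m) => [<-|nvm]; first by rewrite mulr1n mulr1 subrr eqxx.
    rewrite mulr0n mulr0 subr0 mcoeff_neq0 => /Sx[//|e].
    by rewrite e eqxx in nvm.
  have fy : flin id y = - (c *: v).
    by rewrite linearB linearZ /= flinU x0 sub0r.
  case: (eqVneq c 0) => [c0|nc].
    by apply: iA x0 => m mx; apply: yA; rewrite /y c0 scale0r subr0.
  case: nv; have -> : v = (- c^-1) *: flin id y.
    by rewrite fy scalerN scaleNr opprK scalerA mulVf // scale1r.
  exact/spanZ/flin_span.
pose B : choiceType := {v : V | `[< A v >]}; pose b (e : B) : V := val e.
have sur v : exists x : {malg k[B]}, flin b x = v.
  elim: (spA v) => [|c u w Au _ [x <-]]; first by exists 0; rewrite raddf0.
  exists (c *: << exist (fun v => `[< A v >]) u (asboolT Au) : B >> + x).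
  by rewrite linearP /= flinU.
have inj (x : {malg k[B]}) : flin b x = 0 -> x = 0.
  (* Coefficients indexed by the subtype [B] are moved to coefficients indexed by [V], where the
     independence of [A] is stated. *)
  pose h : {malg k[B]} -> {malg k[V]} := flin (fun e => << b e >>).
  have hl : linear h := flin_linear _.
  have cl := @mcoeff_lin k.
  have hE e (z : {malg k[B]}) : (h z)@_(b e) = z@_e.
    move: z; refine (malg_ext (W := k^o) (f := fun z => (h z)@_(b e)) (g := fun z => z@_e)
      (lin_comp (cl _ _) hl) (cl _ _) _) => m.
    by rewrite /h flinU !mcoeffU (inj_eq val_inj).
  have hA m (z : {malg k[B]}) : ~ A m -> (h z)@_m = 0.
    move=> nA; move: z; refine (malg_ext (W := k^o) (f := fun z => (h z)@_m) (g := fun z => 0)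
      (lin_comp (cl _ _) hl) (@lin_0 _ _ _) _) => e.
    rewrite /h flinU mcoeffU; case: eqP => // em; case: nA; rewrite -em.
    exact: asboolW (valP e).
  have fh : flin id (h x) = flin b x.
    have l1 : linear (flin (id : V -> V)) := flin_linear _; have l2 := flin_linear b.
    move: x; refine (malg_ext (lin_comp l1 hl) l2 _) => e.
    by rewrite /h !flinU.
  move=> x0; have hx0 : h x = 0.
    apply: iA; last by rewrite fh.
    move=> m; rewrite -mcoeff_neq0 => nz; apply: contrapT => /hA e.
    by rewrite e eqxx in nz.
  by apply/malgP => e; rewrite mcoeff0 -hE hx0 mcoeff0.
have [co coE] := choice sur; exists B, b, co; split=> // [c u v|e].
- apply/eqP; rewrite -subr_eq0; apply/eqP/inj.
  by rewrite linearB linearP /= !coE subrr.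
- apply/eqP; rewrite -subr_eq0; apply/eqP/inj.
  by rewrite linearB /= coE flinU subrr.
Qed.

End Basis.

Section Words.
Variables (k : fieldType) (V : lmodType k) (X : choiceType).

Lemma wlinD (W : lmodType k) (f h : seq X -> W) (a : falg k X) :
  wlin (fun w => f w + h w) a = wlin f a + wlin h a.
Proof.
have l1 := wlin_lin f; have l2 := wlin_lin h; have l3 := wlin_lin (fun w => f w + h w).
by move: a; refine (falg_ext l3 (lin_D l1 l2) _) => w; rewrite !wlinE.
Qed.

Lemma wlin_ideal (R : falg k X -> Prop) (W : lmodType k) (f : seq X -> W) :
  (forall u v a, R a -> wlin (fun w => f (u ++ w ++ v)) a = 0) ->
  forall a, ideal R a -> wlin f a = 0.
Proof.
move=> fR a Ra; have [pl pE] := pliftE fR.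
have <- : plift f (qpi (ideal_gen R) a) = wlin f a.
  have ql := @qpi_linear _ _ (ideal_gen R); have l1 := wlin_lin f.
  by move: {Ra} a; refine (falg_ext (lin_comp pl ql) l1 _) => w; rewrite [LHS]pE wlinE.
have -> : qpi (ideal_gen R) a = qpi (ideal_gen R) 0 by apply/qpiE; rewrite subr0.
by rewrite (linE0 (@qpi_linear _ _ _)) (linE0 pl).
Qed.

Lemma ideal_ctx (R : falg k X -> Prop) a b c : ideal R b -> ideal R (a * b * c).
Proof.
move=> Rb; have e : qpi (ideal_gen R) b = qpi (ideal_gen R) 0 by apply/qpiE; rewrite subr0.
suff : qpi (ideal_gen R) (a * b * c) = qpi (ideal_gen R) 0 by move/qpiE; rewrite subr0.
rewrite -pmulE -pmulE e pmulE pmulE mulr0 mul0r; reflexivity.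
Qed.

Lemma ideal_incl (R : falg k X -> Prop) a : R a -> ideal R a.
Proof.
move=> Ra; apply: span_incl.
have e : a = 1 * a * 1 by rewrite mul1r mulr1.
by rewrite [X in ideal_gen _ X]e; exact: IdealGen.
Qed.

Lemma ideal_sub (R R' : falg k X -> Prop) :
  (forall a, R a -> ideal R' a) -> forall a, ideal R a -> ideal R' a.
Proof.
move=> sR; apply: span_ind => [|c x y|_ [a r b Rr]]; [exact: span0|exact: spanZD|].
exact/ideal_ctx/sR.
Qed.

Lemma wlin_ideal_ctx (R : falg k X -> Prop) (W : lmodType k) (f : seq X -> W) :
  (forall u v a, R a -> wlin (fun w => f (u ++ w ++ v)) a = 0) ->
  forall u v a, ideal R a -> wlin (fun w => f (u ++ w ++ v)) a = 0.
Proof. by move=> fR u v a Ra; rewrite -wlin_ctx; apply: (wlin_ideal fR); exact: ideal_ctx. Qed.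

End Words.

Section Grassmann.
Variables (k : fieldType) (V : lmodType k).
Local Notation GR := (@grassmann_rel k V).
Local Notation G := (palg GR).
Local Notation W := (pword GR).
Local Notation "x ** y" := (@pmul k V GR x y) (at level 37, left associativity).
Let bm : bilin (@pmul k V GR) := @pmul_bilin k V GR.

Lemma grassmann_vanish (M : lmodType k) (f : seq V -> M) :
  linear (fun x => f [:: x]) -> (forall v, f [:: v; v] = 0) ->
  forall a, GR a -> wlin f a = 0.
Proof.
move=> lf sq _ [a /multilinear_rel|v]; first exact.
by rewrite wlinE.
Qed.

Lemma grass_lin u v : linear (fun x => W (u ++ x :: v)).
Proof. by apply: pword_linear => a; exact: grassmann_lin. Qed.
Lemma grass_sq u v w : W (u ++ v :: v :: w) = 0.
Proof. by have := pword_rel u w (grassmann_sq v); rewrite wlinE. Qed.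
Lemma grass_anti u v v' w : W (u ++ v :: v' :: w) = - W (u ++ v' :: v :: w).
Proof.
apply/eqP; rewrite -addr_eq0; apply/eqP.
have := grass_sq u (v + v') w; rewrite (linED (grass_lin u ((v + v') :: w))) -!(cat_rcons _ u (v
  + v' :: w)).
rewrite (linED (grass_lin (rcons u v) w)) (linED (grass_lin (rcons u v') w)) !(cat_rcons _ u).
by rewrite (grass_sq u v) (grass_sq u v') add0r addr0.
Qed.

(** With the next lemma: left multiplication by a letter preserves the form a y + z, which
    [contr_ker] uses to bring one basis vector to the front. *)
Lemma grass_mul_sq (a y z : G) : a ** a = 0 -> a ** (a ** y + z) = a ** z.
Proof.
move=> aa; have e1 := linED (bilin_r a bm) (a ** y) z.
have e2 := etrans (pmulA a a y) (etrans (congr1 (fun t => t ** y) aa) (linE0 (bilin_l y bm))).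
exact (etrans e1 (etrans (congr1 (fun t => t + a ** z) e2) (add0r _))).
Qed.

Lemma grass_mul_anti (a c y z : G) : c ** a = - (a ** c) ->
  c ** (a ** y + z) = a ** (- (c ** y)) + c ** z.
Proof.
move=> ca; have e1 := linED (bilin_r c bm) (a ** y) z.
have e2 := etrans (pmulA c a y) (etrans (congr1 (fun t => t ** y) ca)
  (linEN (bilin_l y bm) (a ** c))).
have e3 := etrans (congr1 -%R (esym (pmulA a c y))) (esym (linEN (bilin_r a bm) (c ** y))).
exact (etrans e1 (congr1 (fun t => t + c ** z) (etrans e2 e3))).
Qed.

Section Contraction.
Variable f : V -> k.
Hypothesis lf : linear (f : V -> k^o).

(** The interior product with the linear form [f]. *)
Fixpoint contrw (w : seq V) : G :=
  if w is v :: w' then f v *: W w' - W [:: v] ** contrw w' else 0.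

(** On x x w the two terms f(x) x w cancel, and in the remaining term x x vanishes. *)
Lemma contr_rel u v a : GR a -> wlin (fun w => contrw (u ++ w ++ v)) a = 0.
Proof.
elim: u => [|z u IH] Ra /=.
  have W1 := grass_lin [::] [::]; move: a Ra; apply: grassmann_vanish => [|x] /=.
    by lin.
  rewrite (linEB (bilin_r _ bm)) (linEZ (bilin_r _ bm)) pmulA !pword_mul /=.
  by rewrite (grass_sq [::]) (linE0 (bilin_l _ bm)) subr0 subrr.
rewrite (eq_wlin (g := fun w => f z *: W (u ++ w ++ v) + - (W [:: z] ** contrw (u ++ w ++ v))))
  //.
rewrite wlinD.
have l1 : linear (fun y : G => f z *: y) by lin.
have l2 : linear (fun y : G => - (W [:: z] ** y)) by lin.
by rewrite (wlin_comp _ _ l1) (wlin_comp _ _ l2) IH // pword_rel //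
  scaler0 (linE0 (bilin_r _ bm)) oppr0 addr0.
Qed.

Definition contr : G -> G := plift contrw.
Lemma contr_lin : linear contr. Proof. exact: (pliftE contr_rel).1. Qed.
Lemma contrE w : contr (W w) = contrw w. Proof. exact: (pliftE contr_rel).2. Qed.
Lemma contr_cons v y : contr (W [:: v] ** y) = f v *: y - W [:: v] ** contr y.
Proof.
have cl := contr_lin; move: y; on_words => w.
by rewrite pword_mul !contrE.
Qed.

Lemma contrw_sum w : contrw w =
  \sum_(j < size w) ((-1) ^+ j * f w`_j) *: W (take j w ++ drop j.+1 w).
Proof.
elim: w => [|v w IH] /=; first by rewrite big_ord0.
rewrite big_ord_recl /= expr0 mul1r drop0 IH; congr (_ + _).
rewrite (linEsum (bilin_r _ bm)) -sumrN; apply: eq_bigr => j _.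
by rewrite (linEZ (bilin_r _ bm)) pword_mul exprS mulN1r mulNr scaleNr.
Qed.

End Contraction.

Definition grass_epsw (w : seq V) : k^o := if w is [::] then 1 else 0.
Definition grass_eps : G -> k^o := plift grass_epsw.
Lemma grass_epsE : linear grass_eps /\ forall w, grass_eps (W w) = grass_epsw w.
Proof.
apply: pliftE => u v a; have z x (w : seq V) : grass_epsw (u ++ (x :: w) ++ v) = 0 by case: u.
by apply: grassmann_vanish => [c x y|x]; rewrite !z ?scaler0 ?addr0.
Qed.

Definition coord_form (B : choiceType) (co : V -> {malg k[B]}) (e : B) : V -> k := fun v => (co
  v)@_e.

(* The finitely many basis vectors occurring in [xi] are eliminated one after the
   other. *)
Lemma contr_ker (B : choiceType) (b : B -> V) (co : V -> {malg k[B]}) :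
  linear co -> (forall v, flin b (co v) = v) -> (forall e, co (b e) = << e >>) ->
  forall xi : G, (forall e, contr (coord_form co e) xi = 0) -> grass_eps xi = 0 -> xi = 0.
Proof.
move=> cl coE cob xi; have [el epE] := grass_epsE.
have fl e : linear (coord_form co e : V -> k^o) by exact: (lin_comp (@mcoeff_lin k B e) cl).
have dl e := contr_lin (fl e).
pose A (E : seq B) := span (fun y : G => exists2 es : seq B, {subset es <= E} & y = W (map b es)).
have A_mono (E E' : seq B) : {subset E <= E'} -> forall y, A E y -> A E' y.
  by move=> s; apply: span_mono => _ [es sE ->]; exists es => // e /sE; exact: s.
have A_word (es E : seq B) : {subset es <= E} -> A E (W (map b es)).
  by move=> sE; apply: span_incl; exists es.
have A_mul E y z : A E y -> A E z -> A E (y ** z).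
  move=> Ay Az; apply: (span_lin (f := fun y => y ** z) _ _ Ay); first by lin.
  move=> _ [es sE ->]; apply: (span_lin (f := fun z => W (map b es) ** z) _ _ Az); first by lin.
  move=> _ [es' sE' ->]; rewrite pword_mul -map_cat; apply: A_word => e.
  by rewrite mem_cat => /orP[/sE|/sE'].
have A_gen v : exists E, A E (W [:: v]).
  have W1 := grass_lin [::] [::]; rewrite -(coE v).
  move: (malg_span (co v)); elim=> [|c x y [e ->] _ [E AE]].
    by exists [::]; rewrite raddf0 (linE0 W1); exact: span0.
  exists (e :: E); rewrite linearP /= flinU (W1 c); apply: spanZD.
    by apply: (A_word [:: e]) => e'; rewrite !inE => ->.
  by apply: A_mono AE => e' e'E; rewrite inE e'E orbT.
have A_all y : exists E, A E y.
  move: (palg_span y); elim=> [|c _ z [w ->] _ [E' AE']].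
    by exists [::]; exact: span0.
  suff [E AE] : exists E, A E (W w).
    exists (E ++ E'); apply: spanZD.
      by apply: A_mono AE => e eE; rewrite mem_cat eE.
    by apply: A_mono AE' => e eE; rewrite mem_cat eE orbT.
  elim: w => [|v w [E AE]]; first by exists [::]; apply: (A_word [::]).
  have [E1 AE1] := A_gen v; exists (E ++ E1); rewrite -(pword_mul GR [:: v]); apply: A_mul.
    by apply: A_mono AE1 => e eE; rewrite mem_cat eE orbT.
  by apply: A_mono AE => e eE; rewrite mem_cat eE.
have be e e' : coord_form co e (b e') = (e' == e)%:R by rewrite /coord_form cob mcoeffU.
have kill e E y : e \notin E -> A E y -> contr (coord_form co e) y = 0.
  move=> eE; move: y; apply: span_ext => //; first exact: lin_0.
  move=> _ [es sE ->]; rewrite (contrE (fl e)); elim: es sE => //= e' es IH sE.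
  have /negPf ne : e' != e by apply: contraNneq eE => <-; apply: sE; rewrite mem_head.
  rewrite be ne scale0r sub0r IH ?(linE0 (bilin_r _ bm)) ?oppr0 // => e1 e1s.
  by apply: sE; rewrite inE e1s orbT.
move=> xi0 exi; have [E AE] := A_all xi; elim: E xi AE xi0 exi => [|e E IH] xi AE xi0 exi.
  have [c ec] : exists c, xi = c *: W [::].
    move: xi AE {xi0 exi}; apply: span_ind => [|c x y [d ->] [d' ->]|_ [[|e es] sE ->]].
    - by exists 0; rewrite scale0r.
    - by exists (c * d + d'); rewrite scalerDl scalerA.
    - by exists 1; rewrite scale1r.
    - by have := sE e; rewrite mem_head => /(_ isT).
  by move: exi; rewrite ec (linEZ el) epE /= => /eqP; rewrite mulf_eq0 oner_eq0 orbF => /eqP ->;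
    rewrite scale0r.
have [eE|eE] := boolP (e \in E).
  by apply: IH => //; apply: A_mono AE => e'; rewrite inE => /predU1P[->|].
(* Since [b e] has square zero and anticommutes with the other letters, it can be collected in
   front. Contracting with the coordinate of [e] then returns [y], so [y] is zero and [xi] avoids
   [b e]. *)
suff [y [z [Ay Az xiE]]] : exists y z, [/\ A E y, A E z & xi = W [:: b e] ** y + z].
  have y0 : y = 0.
    have := xi0 e; rewrite xiE (linED (dl e)) (contr_cons (fl e)) be eqxx scale1r.
    by rewrite (kill e E y) // (kill e E z) // (linE0 (bilin_r _ bm)) subr0 addr0.
  by apply: IH xi0 exi; rewrite xiE y0 (linE0 (bilin_r _ bm)) add0r.
move: xi AE {xi0 exi}; apply: span_ind => [|c x x'|_ [es sE ->]].
- exists 0, 0; split; [exact: span0|exact: span0|].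
  by rewrite (linE0 (bilin_r _ bm)) addr0.
- move=> [y [z [Ay Az ->]]] [y' [z' [Ay' Az' ->]]].
  exists (c *: y + y'), (c *: z + z'); split; [exact: spanZD|exact: spanZD|].
  by rewrite (bilin_r _ bm) scalerDr -!addrA; congr (_ + _); rewrite addrCA.
elim: es sE => [|e' es IHs] sE.
  exists 0, (W [::]); split; [exact: span0|by apply: (A_word [::])|].
  by rewrite (linE0 (bilin_r _ bm)) add0r.
have [|y [z [Ay Az e1]]] := IHs; first by move=> e1 e1s; apply: sE; rewrite inE e1s orbT.
rewrite /= -(pword_mul GR [:: b e']) e1.
have := sE e'; rewrite mem_head => /(_ isT); rewrite inE => /predU1P[->|e'E].
  exists z, 0; split=> //; first exact: span0.
  have aa : W [:: b e] ** W [:: b e] = 0.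
    by rewrite (pword_mul GR [:: b e] [:: b e]) (grass_sq [::]).
  by rewrite addr0; exact (grass_mul_sq y z aa).
have Ae' : A E (W [:: b e']) by apply: (A_word [:: e']) => e2; rewrite inE => /eqP ->.
exists (- (W [:: b e'] ** y)), (W [:: b e'] ** z); split; [exact/spanN/A_mul|exact: A_mul|].
apply: grass_mul_anti.
exact (etrans (pword_mul GR [:: b e'] [:: b e]) (etrans (grass_anti [::] (b e') (b e) [::])
  (congr1 -%R (esym (pword_mul GR [:: b e] [:: b e']))))).
Qed.

End Grassmann.

(** * Kernels of the antisymmetrisers *)

Section Antisymmetrizer.
Variables (k : fieldType) (V : lmodType k).
Local Notation GR := (@grassmann_rel k V).
Local Notation G := (palg GR).
Local Notation W := (pword GR).

Lemma size_take_drop (w : seq V) j : (j < size w)%N ->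
  (size (take j w ++ drop j.+1 w)).+1 = size w.
Proof.
move=> lt; rewrite size_cat size_drop size_takel ?(ltnW lt) // -addnS -subSn //.
by rewrite subSS subnKC // ltnW.
Qed.

(* The pairing with f_0 /\ ... /\ f_(n-1). On words it is a determinant, hence a value
   of the antisymmetriser, and it separates the points of the Grassmann algebra. *)
Fixpoint grass_val n (f : nat -> V -> k) (xi : G) : k :=
  if n is n'.+1 then grass_val n' (fun i => f i.+1) (contr (f 0%N) xi) else grass_eps xi.

Lemma grass_val_lin n f : (forall i, linear (f i : V -> k^o)) ->
  linear (grass_val n f : G -> k^o).
Proof.
elim: n f => [|n IH] f lf /=; first exact: (grass_epsE V).1.
exact: (lin_comp (IH _ (fun i => lf i.+1)) (contr_lin (lf 0%N))).
Qed.

Let detw n (f : nat -> V -> k) (w : seq V) : k := \det (\matrix_(i < n, j < n) f i w`_j).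

(** Contraction with [f 0] is the Laplace expansion along the first row; on words of the wrong
    length the recursion ends at a counit that vanishes. *)
Lemma grass_val_word n f w : (forall i, linear (f i : V -> k^o)) ->
  grass_val n f (W w) = if size w == n then detw n f w else 0.
Proof.
elim: n f w => [|n IH] f w lf /=.
  by rewrite (grass_epsE V).2 /detw det_mx00; case: w.
have vl := grass_val_lin n (fun i => lf i.+1).
rewrite (contrE (lf 0%N)) contrw_sum (linEsum vl).
rewrite -(big_mkord xpredT (fun j => grass_val n (fun i => f i.+1)
  (((-1) ^+ j * f 0%N w`_j) *: W (take j w ++ drop j.+1 w)))).
have sz := @size_take_drop w.
case: eqP => [e|ne]; last first.
  rewrite big_nat_cond big1 // => j; rewrite andbT => /andP[_ lt].
  rewrite [LHS](linEZ vl) IH ?ifN ?scaler0 //; apply/eqP => e; apply: ne.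
  by rewrite -(sz j lt) e.
rewrite e big_mkord /detw (expand_det_row _ ord0); apply: eq_bigr => j _.
have lt : (j < size w)%N by rewrite e.
rewrite [LHS](linEZ vl) IH // -eqSS (sz j lt) e eqxx mxE /cofactor add0n.
rewrite -[LHS]/((-1) ^+ j * _ * detw _ _ _) -mulrA mulrCA; congr (_ * (_ * _)).
rewrite /detw; congr determinant; apply/matrixP => a b; rewrite !mxE /=; congr (f _ _).
rewrite nth_cat size_takel ?(ltnW lt) // /bump; case: ltnP => lb.
  by rewrite nth_take.
by rewrite nth_drop addSn subnKC.
Qed.

(** Induction on a bound for the word lengths: contractions shorten words, and an element all of
    whose contractions and whose counit vanish is zero by [contr_ker]. *)
Lemma grass_val_inj (xi : G) :
  (forall n f, (forall i, linear (f i : V -> k^o)) -> grass_val n f xi = 0) -> xi = 0.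
Proof.
have [B [b [co [cl coE cob]]]] := basis_exists V.
pose F N := span (fun y : G => exists2 w, (size w < N)%N & y = W w).
have [N FN] : exists N, F N xi.
  have F_mono N M : (N <= M)%N -> forall y, F N y -> F M y.
    by move=> le; apply: span_mono => _ [w lt ->]; exists w => //; exact: leq_trans le.
  elim: (palg_span xi) => [|c _ y [w ->] _ [N FN]]; first by exists 0%N; exact: span0.
  exists (maxn N (size w).+1); apply: spanZD; last by apply: F_mono FN; exact: leq_maxl.
  by apply: span_incl; exists w; rewrite // leq_maxr.
elim: N xi FN => [|N IH] xi FN v0.
  by move: xi FN {v0}; apply: span_ext; [exact: lin_id|exact: lin_0|move=> _ [w //]].
apply: (contr_ker cl coE cob) => [e|]; last exact: (v0 0%N (fun _ _ => 0) (fun _ => @lin_0 _ _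
  _)).
have le : linear (coord_form co e : V -> k^o) by exact: (lin_comp (@mcoeff_lin k B e) cl).
apply: IH => [|n f lf].
  apply: (span_lin (contr_lin le) _ FN) => _ [w lt ->].
  rewrite (contrE le) contrw_sum; apply: span_sum => j _; apply/spanZ/span_incl.
  by exists (take j w ++ drop j.+1 w) => //; rewrite -ltnS size_take_drop.
(* A value of the contraction is a value of [xi] for the list of forms preceded by the contracting
   one. *)
pose f' i := if i is i'.+1 then f i' else coord_form co e.
by apply: (v0 n.+1 f') => -[|i]; [exact: le|exact: lf].
Qed.

(** The form f_0 ⊗ ... ⊗ f_(n-1) on the tensor algebra, extended by zero to the other degrees. *)
Let phi n (f : nat -> V -> k) (w : seq V) : k^o :=
  if size w == n then \prod_(i < n) f i w`_i else 0.

(** The signed sum over permutations in the antisymmetriser is the one in the Leibniz formula. *)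
Let phi_antisym n f w : wlin (phi n f) (antisym_word w) = if size w == n then detw n f w else 0.
Proof.
have l1 := wlin_lin (phi n f); rewrite /antisym_word (linEsum l1).
under eq_bigr => s _ do rewrite (linEZ l1) wlinE /phi size_map size_enum_ord.
case: eqP => [e|_]; last by rewrite big1 // => s _; rewrite scaler0.
case: n / e {l1}; apply: eq_bigr => s _; congr (_ * _); apply: eq_bigr => i _.
rewrite mxE; congr (f _ _).
by rewrite (nth_map i) ?size_enum_ord // nth_ord_enum (tnth_nth 0).
Qed.

Let phi_linear n f a : (forall i, linear (f i : V -> k^o)) ->
  ideal (@linear_rel k V) a -> wlin (phi n f) a = 0.
Proof.
move=> lf; apply: wlin_ideal => u v b; apply: multilinear_rel; rewrite /phi.
under [X in GRing.linear_for _ X]funext => x do rewrite size_cat /=.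
case: eqP => [e|_]; last exact: lin_0.
have lt : (size u < n)%N by rewrite -e addnS ltnS leq_addr.
pose C := \prod_(i < n | i != Ordinal lt) f i (u ++ 0 :: v)`_i.
have E x : \prod_(i < n) f i (u ++ x :: v)`_i = f (size u) x * C.
  rewrite (bigD1 (Ordinal lt)) //= nth_cat ltnn subnn /=; congr (_ * _).
  apply: eq_bigr => i ne; congr (f _ _); rewrite !nth_cat; case: ltnP => // le.
  rewrite -[(i - size u)%N]prednK ?subn_gt0 ?ltn_neqAle ?le ?andbT //.
  by apply: contraNneq ne => ei; apply/eqP/val_inj.
have l := lf (size u); have l' : linear (fun x => f (size u) x * C : k^o) by lin.
by move=> c x y; rewrite !E; exact: l'.
Qed.

(** If the antisymmetrised [r] is zero in the tensor algebra, every multilinear form kills it; by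
    [phi_antisym] these values are the determinants of [r], and those separate the points of the
    Grassmann algebra. *)
Lemma Bminus_grassmann (r : falg k V) : Bminus_rel r -> ideal GR r.
Proof.
move=> Br; suff : wlin W r = 0.
  rewrite pword_wlin -(linE0 (@qpi_linear _ _ (ideal_gen GR))).
  by move/qpiE; rewrite subr0.
apply: grass_val_inj => n f lf; have vl := grass_val_lin n lf.
have l1 := wlin_lin W; have l2 : linear (@antisym k V) := flin_linear _.
have l3 := wlin_lin (phi n f).
rewrite -(phi_linear n lf Br); move: {Br} r.
refine (falg_ext (lin_comp vl l1) (lin_comp l3 l2) _) => w.
by rewrite wlinE (grass_val_word n w lf) -phi_antisym; congr (wlin _ _); rewrite /antisym flinU.
Qed.

Lemma grassmann_Bminus (r : falg k V) : GR r -> Bminus_rel r.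
Proof.
have l2 : linear (@antisym k V) := flin_linear _.
have aE (w : seq V) : antisym (fword k w) = antisym_word w by rewrite /antisym flinU.
have a1 (v : V) : antisym (fword k [:: v]) = fword k [:: v].
  rewrite aE /antisym_word (bigD1 (1%g : 'S_1)) //= big1 ?addr0 => [|s]; last by rewrite permS1
    eqxx.
  rewrite odd_perm1 expr0 scale1r; congr fword; apply: (eq_from_nth (x0 := 0)).
    by rewrite size_map size_enum_ord.
  move=> i; rewrite size_map size_enum_ord => lt.
  by rewrite (nth_map (Ordinal lt)) ?size_enum_ord // perm1 (tnth_nth 0) (nth_ord_enum (Ordinal
    lt) (Ordinal lt)).
move=> [_ [c x y]|v]; rewrite /Bminus_rel.
  have e := etrans (linEB l2 _ _) (f_equal2 (fun s t => s - t) (etrans (linEB l2 _ _)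
    (f_equal2 (fun s t => s - t) (a1 (c *: x + y)) (etrans (linEZ l2 c _)
    (congr1 (fun t => c *: t) (a1 x))))) (a1 y)).
  by rewrite e; apply/ideal_incl/LinearRel.
rewrite aE /antisym_word.
have sw (s : 'S_2) : [seq tnth (in_tuple [:: v; v]) (s i) | i <- enum 'I_2] = [:: v; v].
  apply: (eq_from_nth (x0 := 0)) => [|i]; first by rewrite size_map size_enum_ord.
  rewrite size_map size_enum_ord => lt.
  rewrite (nth_map (Ordinal lt)) ?size_enum_ord // (tnth_nth 0).
  have vv j : (j < 2)%N -> nth 0 [:: v; v] j = v by case: j => [|[]].
  by rewrite !vv.
under eq_bigr => s _ do rewrite sw.
rewrite -scaler_suml.
(* On v v all permuted words coincide, leaving the sum of the signs; it is the determinant of a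
   matrix with two equal rows. *)
have -> : \sum_(s : 'S_2) (-1) ^+ s = \det (\matrix_(i < 2, j < 2) 1) :> k.
  by apply: eq_bigr => s _; rewrite big1 ?mulr1 // => i _; rewrite mxE.
rewrite (determinant_alternate (i1 := ord0) (i2 := ord_max)) //; last by move=> j; rewrite !mxE.
by rewrite scale0r; exact: span0.
Qed.

Lemma Bminus_ideal (x : falg k V) : ideal (@Bminus_rel k V) x <-> ideal GR x.
Proof.
split; apply: ideal_sub => a; first exact: Bminus_grassmann.
by move=> /grassmann_Bminus Ba; exact: ideal_incl.
Qed.

End Antisymmetrizer.

(** * The exterior algebra *)

Section SkewDerivationOfWords.
Variables (k : fieldType) (V M : lmodType k).
Variables (c : V -> seq V -> M) (m : V -> M -> M).
Hypotheses (clin : forall w, linear (c^~ w)) (mbil : bilin m).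
Hypothesis crel : forall z u v a, grassmann_rel a -> wlin (fun w => c z (u ++ w ++ v)) a = 0.
Hypothesis csq : forall v w, c v (v :: w) = m v (c v w).
Hypothesis msq : forall v y, m v (m v y) = 0.

(** The common shape of odd derivations out of the exterior algebra: [c v w'] is the image of the
    letter times the rest, and [m v] is multiplication by the letter. *)
Fixpoint skeww (w : seq V) : M := if w is v :: w' then c v w' - m v (skeww w') else 0.

(** On x x w the terms c x (x w) and m x (c x w) cancel by [csq], and the rest is killed by
    [msq]. *)
Lemma skeww_rel u v a : grassmann_rel a -> wlin (fun w => skeww (u ++ w ++ v)) a = 0.
Proof.
elim: u => [|z u IH] Ra /=.
  move: a Ra; apply: grassmann_vanish => [|x] /=; first by lin; exact: clin.
  by rewrite (linEB (bilin_r _ mbil)) csq msq subr0 subrr.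
have l := bilin_r z mbil; have l2 : linear (fun y : M => - m z y) by lin.
rewrite (eq_wlin (g := fun w => c z (u ++ w ++ v) + - (m z (skeww (u ++ w ++ v))))) //.
by rewrite wlinD (wlin_comp _ _ l2) IH // crel // (linE0 l) oppr0 addr0.
Qed.

End SkewDerivationOfWords.

Section ExteriorAlgebra.
Variables (k : fieldType) (V : lmodType k).
Local Notation GR := (@grassmann_rel k V).
Local Notation R := (@Bminus_rel k V).
Local Notation L := (Lam V).
Local Notation W w := (pword R w : L).
Local Notation "x ** y" := (@hmul k L x y) (at level 37, left associativity).

(** [Lam] is presented by the kernels of the antisymmetrisers, about which nothing is known letter
    by letter; this reduces well-definedness to the linear relators and v v. *)
Lemma Bminus_rel_vanish (M : lmodType k) (f : seq V -> M) :
  (forall u v a, GR a -> wlin (fun w => f (u ++ w ++ v)) a = 0) ->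
  forall u v a, R a -> wlin (fun w => f (u ++ w ++ v)) a = 0.
Proof. by move=> fG u v a /Bminus_grassmann; exact: wlin_ideal_ctx. Qed.

Lemma lam_plift (M : lmodType k) (f : seq V -> M) :
  (forall u v a, GR a -> wlin (fun w => f (u ++ w ++ v)) a = 0) ->
  linear (plift (R := R) f) /\ forall w, plift f (pword R w) = f w.
Proof. by move=> fG; apply: pliftE; exact: Bminus_rel_vanish. Qed.

Lemma lam_word_rel u v a : GR a -> wlin (fun w => pword R (u ++ w ++ v)) a = 0.
Proof. by move=> /grassmann_Bminus; exact: pword_rel. Qed.
Lemma lam_word_linear u v : linear (fun x => W (u ++ x :: v)).
Proof. by apply: pword_linear => a la; exact/grassmann_Bminus/grassmann_lin. Qed.
Lemma lam_word_sq u v w : W (u ++ v :: v :: w) = 0.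
Proof. by have := lam_word_rel u w (grassmann_sq v); rewrite wlinE. Qed.

Lemma lam_word_anti u v v' w : W (u ++ v :: v' :: w) = - W (u ++ v' :: v :: w).
Proof.
apply/eqP; rewrite -addr_eq0; apply/eqP.
have := lam_word_sq u (v + v') w.
rewrite (linED (lam_word_linear u ((v + v') :: w))) -!(cat_rcons _ u (v + v' :: w)).
rewrite (linED (lam_word_linear (rcons u v) w)) (linED (lam_word_linear (rcons u v') w)).
by rewrite !(cat_rcons _ u) (lam_word_sq u v) (lam_word_sq u v') add0r addr0.
Qed.

Lemma lam1_lin : linear (@lam1 k V). Proof. exact: (lam_word_linear [::] [::]). Qed.
Lemma lam_mul_bilin : bilin (@hmul k L). Proof. exact: pmul_bilin. Qed.
Lemma lam_mulE u v : W u ** W v = W (u ++ v). Proof. exact: prim_mulE. Qed.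
Lemma lam1_sq (v : V) : lam1 v ** lam1 v = 0.
Proof. exact: etrans (lam_mulE [:: v] [:: v]) (lam_word_sq [::] v [::]). Qed.

Fact lam_comp_rel n u v a : R a -> wlin (fun w => pcompw R 1 n (u ++ w ++ v)) a = 0.
Proof.
move: u v a; apply: Bminus_rel_vanish => u v; rewrite /pcompw.
apply: grassmann_vanish => [|x].
  have l := lam_word_linear u v.
  by move=> c x y; rewrite !size_cat /=; case: eqP => _; [exact: l|rewrite scaler0 addr0].
by rewrite [pword _ _](lam_word_sq u) if_same.
Qed.

Lemma lam_graded : graded (@hcomp k L). Proof. exact: (prim_graded lam_comp_rel). Qed.
Lemma lam_graded_algebra : graded_algebra L.
Proof. exact: (prim_graded_algebra lam_comp_rel). Qed.
Lemma lam_compE n w : hcomp n (W w) = if size w == n then W w else 0.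
Proof. by rewrite (prim_compE lam_comp_rel) mul1n. Qed.
Lemma lam_comp_word w : hcomp (size w) (W w) = W w.
Proof. by rewrite lam_compE eqxx. Qed.
Lemma lam1_comp (v : V) : hcomp 1 (lam1 v) = lam1 v.
Proof. exact: (lam_comp_word [:: v]). Qed.

Local Notation T := (tmulS (@hcomp k L) (@hmul k L)).

Fact lam_cop_rel a : R a -> wlin (pcopw R 1) a = 0.
Proof.
have bm := lam_mul_bilin; have bT := tmul_bilin lam_graded bm; have ll := lam1_lin.
have pE x : pcopw R 1 [:: x] = lam1 x ⊠ hone L + hone L ⊠ lam1 x.
  exact: (prim_elt_cop lam_comp_rel).
move=> /Bminus_grassmann; apply: wlin_ideal => u v b Gb.
have l1 : linear (fun t => T (pcopw R 1 u) (T t (pcopw R 1 v))) by lin.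
rewrite (eq_wlin _ (g := fun w => T (pcopw R 1 u) (T (pcopw R 1 w) (pcopw R 1 v)))); last first.
  by move=> w; rewrite !(pcopw_cat lam_comp_rel).
rewrite (wlin_comp _ _ l1); suff -> : wlin (pcopw R 1) b = 0 by exact: (linE0 l1).
move: b Gb; apply: grassmann_vanish => [|x].
  have -> : (fun x : V => pcopw R 1 [:: x]) = fun x => lam1 x ⊠ hone L + hone L ⊠ lam1 x.
    by apply/funext.
  lin.
rewrite [LHS](pcopw_cat lam_comp_rel [:: x] [:: x]) !pE.
exact: (tmul_prim_sq (n := 1) lam_graded lam_graded_algebra isT (lam1_comp x) (lam1_sq x)).
Qed.

Fact lam_cou_rel u v a : R a ->
  wlin (fun w => (if u ++ w ++ v is [::] then 1 else 0) : k^o) a = 0.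
Proof.
move: u v a; apply: (@Bminus_rel_vanish k^o (fun w => if w is [::] then 1 else 0)) => u v.
have z x (w : seq V) : (if u ++ (x :: w) ++ v is [::] then 1 else 0) = 0 :> k^o by case: u.
by apply: grassmann_vanish => [c x y|x]; rewrite !z ?scaler0 ?addr0.
Qed.

Fact lam_antipode_rel u v a : R a -> wlin (fun w => pSw R 1 (u ++ w ++ v)) a = 0.
Proof.
move: u v a; apply: Bminus_rel_vanish => u v; rewrite /pSw.
apply: grassmann_vanish => [|x].
  have l := lam_word_linear (rev v) (rev u) => c x y.
  have rw z : rev (u ++ [:: z] ++ v) = rev v ++ z :: rev u.
    by rewrite catA cats1 rev_cat rev_rcons.
  by rewrite !size_cat /= !rw l scalerDr !scalerA mulrC.
have -> : rev (u ++ [:: x; x] ++ v) = rev v ++ x :: x :: rev u by rewrite !rev_cat -catA.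
by rewrite [pword _ _](lam_word_sq (rev v)) scaler0.
Qed.

Lemma lam_super_hopf : super_hopf L.
Proof. exact: (prim_super_hopf lam_comp_rel lam_cop_rel lam_cou_rel lam_antipode_rel). Qed.
Lemma lam_cop_lin : linear (@hcop k L). Proof. exact: (prim_cop_lin lam_comp_rel lam_cop_rel).
  Qed.
Lemma lam_cou_lin : linear (fun x : L => hcou x : k^o).
Proof. exact: (prim_cou_lin lam_cou_rel). Qed.
Lemma lam_copE w : hcop (W w) = pcopw R 1 w.
Proof. exact: (prim_copE lam_comp_rel lam_cop_rel). Qed.
Lemma lam_couE w : hcou (W w) = if w is [::] then 1 else 0.
Proof. exact: (prim_couE 1 lam_cou_rel). Qed.
Lemma lam_cop1 : hcop (hone L) = hone L ⊠ hone L. Proof. exact: (lam_copE [::]). Qed.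
Lemma lam_cou1 : hcou (hone L) = 1. Proof. exact: (lam_couE [::]). Qed.
Lemma lam_cop_lam1 (v : V) : hcop (lam1 v : L) = lam1 v ⊠ hone L + hone L ⊠ lam1 v.
Proof. by rewrite [LHS](lam_copE [:: v]) (prim_elt_cop lam_comp_rel). Qed.
Lemma lam_copM (a b : L) : hcop (a ** b) = T (hcop a) (hcop b).
Proof. by have [_ _ _ [e _ _ _] _] := lam_super_hopf; rewrite e tmulSE. Qed.
Lemma lam_couM (a b : L) : hcou (a ** b) = hcou a * hcou b.
Proof. by have [_ _ _ []] := lam_super_hopf. Qed.
Lemma lam_cou_lam1 (v : V) : hcou (lam1 v : L) = 0. Proof. exact: (lam_couE [:: v]). Qed.

Lemma lam_cons v w : W (v :: w) = lam1 v ** W w. Proof. exact: esym (lam_mulE [:: v] w). Qed.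

(** Reading off the letter of a one-letter word is well defined: in any context v v is longer than
    one letter. *)
Lemma lam1_inj : injective (@lam1 k V).
Proof.
pose f (w : seq V) : V := if w is [:: v] then v else 0.
have [|pl pE] := @lam_plift V f.
  move=> u v; apply: grassmann_vanish => [|x].
    by case: u => [|? [|? ?]]; case: v => [|? ?] //= c x y; rewrite scaler0 addr0.
  by case: u => [|? [|? ?]].
by move=> x y e; rewrite -[x]/(f [:: x]) -[y]/(f [:: y]) -!pE -[pword _ _]/(lam1 x) e.
Qed.

Lemma lam_deg1 (eta : L) : hcomp 1 eta = eta <-> exists v, eta = lam1 v.
Proof.
split=> [<-|[v ->]]; last exact: lam1_comp.
have cl := graded_lin lam_graded 1.
move: (palg_span (eta : palg R)); elim=> [|c _ y [w ->] _ [v ev]].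
  by exists 0; rewrite (linE0 cl) (linE0 lam1_lin).
have [v' e'] : exists v, hcomp 1 (W w) = lam1 v.
  rewrite lam_compE; case: w => [|x [|y' w]] /=; last 1 first.
  - by exists 0; rewrite (linE0 lam1_lin).
  - by exists 0; rewrite (linE0 lam1_lin).
  - by exists x; exact erefl.
exists (c *: v' + v).
exact (etrans (cl c _ _) (etrans (f_equal2 (fun s t => c *: s + t) e' ev)
  (esym (lam1_lin c v' v)))).
Qed.

Lemma lam1_comm (v : V) (eta : L) : lam1 v ** eta = parityS (@hcomp k L) eta ** lam1 v.
Proof.
have bm := lam_mul_bilin; have pl := parity_lin lam_graded.
move: eta; on_words => w.
rewrite (parity_hom lam_graded (lam_comp_word w)) (linEZ (bilin_l _ bm)).
rewrite [LHS](lam_mulE [:: v] w) [_ ** _](lam_mulE w [:: v]) /=.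
elim: w => [|x w IH]; first by rewrite scale1r.
rewrite (lam_word_anti [::] v x w) (lam_cons x (v :: w)) IH (linEZ (bilin_r _ bm)).
by rewrite -lam_cons /= exprS mulN1r scaleNr.
Qed.

End ExteriorAlgebra.

(** * Lie algebra actions by derivations *)

Section DerivationAction.
Variables (k : fieldType) (g : lieAlgType k) (V : lmodType k) (act : V -> g -> V).
Hypothesis hact : right_module act.
Variables (L : superHopfData k) (la1 : V -> L) (D : L -> g -> L).
Hypotheses (Hgr : graded (@hcomp k L)) (Hal : graded_algebra L) (ll : linear la1).
Hypothesis L_ext : forall (M : lmodType k) (f h : L -> M), linear f -> linear h ->
  f (hone L) = h (hone L) ->
  (forall v eta, f eta = h eta -> f (hmul (la1 v) eta) = h (hmul (la1 v) eta)) ->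
  forall eta, f eta = h eta.
Local Notation "x ** y" := (@hmul k L x y) (at level 37, left associativity).
Hypothesis Dl : forall x, linear (fun eta => D eta x).
Hypothesis D_one : forall x, D (hone L) x = 0.
Hypothesis D_cons : forall v eta x,
  D (la1 v ** eta) x = la1 (act v x) ** eta + la1 v ** D eta x.
Let bact : bilin act := hact.1.
Let bm : bilin (@hmul k L). Proof. by case: Hal. Qed.

Lemma der_lam1 v x : D (la1 v) x = la1 (act v x).
Proof.
by rewrite -[la1 v](hmulr1 Hal) D_cons D_one (linE0 (bilin_r _ bm)) addr0 (hmulr1 Hal).
Qed.

Lemma derM (a b : L) x : D (a ** b) x = D a x ** b + a ** D b x.
Proof.
have Dlx := Dl x; have la := hmulA Hal.
move: a; refine (L_ext _ _ _ _); [lin|lin| |] => [|v a IH].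
  by rewrite D_one (linE0 (bilin_l _ bm)) add0r !(hmul1 Hal).
rewrite -la D_cons IH D_cons (linED (bilin_r _ bm)) (linED (bilin_l _ bm)).
by rewrite !la addrA.
Qed.

Lemma der_bilin : bilin D.
Proof.
split=> [x|eta] => [|c x y]; first exact: Dl.
have Dlx := Dl x; have Dly := Dl y; have Dlz := Dl (c *: x + y).
move: eta; refine (L_ext _ _ _ _); [lin|lin| |] => [|v a IH].
  by rewrite !D_one scaler0 addr0.
rewrite !D_cons IH (bilin_r _ bact) ll (bilin_l _ bm) (bilin_r _ bm) scalerDr.
by rewrite addrACA.
Qed.

Lemma der_right_module : right_module D.
Proof.
split; first exact: der_bilin.
move=> eta x y; have Dlx := Dl x; have Dly := Dl y; have Dlz := Dl (lie x y).
move: eta; refine (L_ext _ _ _ _); [lin|lin| |] => [|v a IH].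
  by rewrite !D_one (linE0 Dlx) (linE0 Dly) subr0.
rewrite !D_cons IH hact.2 (linEB ll) (linEB (bilin_l _ bm)) (linEB (bilin_r _ bm)).
rewrite !(linED Dlx) !(linED Dly) !D_cons.
(* [P] and [Q] are the mixed terms, with x and y acting on different factors; they cancel in the
   commutator of two derivations. *)
have AC (Z : zmodType) (A B C E P Q : Z) :
    A - B + (C - E) = A + P + (Q + C) - (B + Q + (P + E)).
  rewrite [Q + C]addrC [A + P + _]addrACA [P + E]addrC [B + Q + _]addrACA [Q + P]addrC.
  by rewrite opprD [RHS]addrACA subrr addr0 opprD [RHS]addrACA.
exact: AC.
Qed.

Hypothesis D_comp : forall n eta x, D (hcomp n eta) x = hcomp n (D eta x).
Hypotheses (cl : linear (@hcop k L)) (cop1 : hcop (hone L) = hone L ⊠ hone L).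
Hypothesis copM : forall a b : L,
  hcop (a ** b) = tmulS (@hcomp k L) (@hmul k L) (hcop a) (hcop b).
Hypothesis cop_la1 : forall v, hcop (la1 v) = la1 v ⊠ hone L + hone L ⊠ la1 v.

(** Both sides are derivations along the coproduct, so the letters, which are primitive, decide. *)
Lemma der_cop (eta : L) x : hcop (D eta x) =
  tmapS (fun e => D e x) id (hcop eta) + tmapS id (fun e => D e x) (hcop eta).
Proof.
have Dlx := Dl x.
pose D2 := tevender (fun e : L => D e x); have D2l : linear D2 := tevender_lin Dlx.
rewrite -[RHS]/(D2 (hcop eta)).
move: eta; refine (L_ext _ _ _ _); [lin|lin| |] => [|v a IH].
  rewrite D_one (linE0 cl) cop1 /D2 /tevender; tsimp.
  by rewrite D_one tpure0l tpure0r addr0.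
rewrite D_cons (linED cl) !copM IH !cop_la1.
rewrite /D2 (tevenderM Hgr Hal Dlx); last 2 first.
- by move=> a' b'; exact: derM.
- by move=> n a'; exact: D_comp.
by rewrite (tevender_prim Dlx) ?D_one // der_lam1.
Qed.

Hypothesis cou_lin : linear (fun x : L => hcou x : k^o).
Hypothesis couM : forall a b : L, hcou (a ** b) = hcou a * hcou b.
Hypothesis cou_la1 : forall v, hcou (la1 v) = 0.

Lemma der_cou (eta : L) x : hcou (D eta x) = 0.
Proof.
have Dlx := Dl x.
move: eta; refine (L_ext (M := k^o) (f := fun eta => @hcou k L (D eta x))
  (h := fun _ => 0) _ _ _ _); [lin|exact: lin_0| |] => [|v a IH].
  by rewrite D_one (linE0 cou_lin).
by rewrite D_cons [LHS](linED cou_lin) !couM !cou_la1 !mul0r addr0.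
Qed.

Variable S : L -> L.
Hypotheses (Sl : linear S) (S1 : S (hone L) = hone L).
Hypothesis SM : forall s v, S (s ** la1 v) = - (la1 v ** parityn (@hcomp k L) 1 (S s)).
Hypothesis L_ext_r : forall (M : lmodType k) (f h : L -> M), linear f -> linear h ->
  f (hone L) = h (hone L) ->
  (forall v eta, f eta = h eta -> f (hmul eta (la1 v)) = h (hmul eta (la1 v))) ->
  forall eta, f eta = h eta.

(** The induction appends letters on the right, where the recursion [SM] of the antipode applies. *)
Lemma der_antipode (eta : L) x : S (D eta x) = D (S eta) x.
Proof.
have Dlx := Dl x.
move: eta; refine (L_ext_r _ _ _ _); [lin|lin| |] => [|v s IH].
  by rewrite S1 D_one (linE0 Sl).
rewrite derM der_lam1 (linED Sl) !SM IH (linEN Dlx) derM der_lam1 opprD addrC.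
congr (- _ - (_ ** _)); apply/esym; apply: (even_parityn Hgr Dlx) => m a; exact: D_comp.
Qed.

End DerivationAction.

Section LieActionOnExterior.
Variables (k : fieldType) (g : lieAlgType k) (V : lmodType k) (act : V -> g -> V).
Hypothesis hact : right_module act.
Local Notation R := (@Bminus_rel k V).
Local Notation L := (Lam V).
Local Notation W w := (pword R w : L).
Local Notation "x ** y" := (@hmul k L x y) (at level 37, left associativity).
Let bact : bilin act := hact.1.
Let bm := @lam_mul_bilin k V.
Let ll := @lam1_lin k V.

Definition gactw (x : g) (w : seq V) : L :=
  \sum_(i < size w) W (set_nth 0 w i (act (nth 0 w i) x)).

Lemma gactw_cons x v w : gactw x (v :: w) = W (act v x :: w) + lam1 v ** gactw x w.
Proof.
rewrite /gactw big_ord_recl; congr (_ + _).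
rewrite (linEsum (bilin_r _ bm)); apply: eq_bigr => i _.
exact: (lam_cons v (set_nth 0 w i (act (nth 0 w i) x))).
Qed.

Lemma gactw_rel x u v a : @grassmann_rel k V a ->
  wlin (fun w => gactw x (u ++ w ++ v)) a = 0.
Proof.
elim: u => [|z u IH] Ra.
  move: a Ra; apply: grassmann_vanish => [|y].
    have l1 := lam_word_linear [::] v; have l2 := bilin_l x bact.
    have -> : (fun y => gactw x ([::] ++ [:: y] ++ v))
        = fun y => W (act y x :: v) + lam1 y ** gactw x v.
      by apply/funext => y; exact: gactw_cons.
    by apply: lin_D; [exact: (lin_comp l1 l2)|lin].
  rewrite [LHS]gactw_cons gactw_cons (linED (bilin_r _ bm)).
  (* For the relator y y the two words with one factor acted upon are negatives of each other; the
     term with y y in front vanishes next. *)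
  rewrite -lam_cons (lam_word_anti [::] y) addrA subrr add0r.
  by rewrite (hmulA (@lam_graded_algebra k V)) lam1_sq (linE0 (bilin_l _ bm)).
rewrite (eq_wlin (g := fun w => W ((act z x :: u) ++ w ++ v) + lam1 z ** gactw x (u ++ w ++ v))).
  have l := bilin_r (lam1 z : L) bm.
  by rewrite wlinD (wlin_comp _ _ l) IH // (linE0 l) addr0; exact: lam_word_rel.
by move=> w; exact: gactw_cons.
Qed.

Let gE x : linear (fun eta : L => gact act eta x) /\ forall w, gact act (W w) x = gactw x w.
Proof. by apply: lam_plift => u v a; exact: gactw_rel. Qed.
Let gl x : linear (fun eta : L => gact act eta x) := (gE x).1.

Lemma gact_word x w : gact act (W w) x = gactw x w. Proof. exact: (gE x).2. Qed.
Lemma gact_one x : gact act (hone L) x = 0.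
Proof. by rewrite [LHS](gact_word x [::]) /gactw big_ord0. Qed.
Lemma gact_lam1 v x : gact act (lam1 v) x = lam1 (act v x).
Proof.
rewrite [LHS](gact_word x [:: v]) gactw_cons /gactw big_ord0.
by rewrite (linE0 (bilin_r _ bm)) addr0.
Qed.
Lemma gact_cons v (eta : L) x :
  gact act (lam1 v ** eta) x = lam1 (act v x) ** eta + lam1 v ** gact act eta x.
Proof.
have glx := gl x.
move: eta; on_words => w.
exact (etrans (congr1 (fun e => gact act e x) (esym (lam_cons v w)))
  (etrans (gact_word x (v :: w)) (etrans (gactw_cons x v w)
  (f_equal2 +%R (lam_cons (act v x) w) (congr1 (hmul (lam1 v)) (esym (gact_word x w))))))).
Qed.

Lemma lam_ind_ext (M : lmodType k) (f h : L -> M) : linear f -> linear h ->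
  f (hone L) = h (hone L) ->
  (forall v eta, f eta = h eta -> f (lam1 v ** eta) = h (lam1 v ** eta)) ->
  forall eta, f eta = h eta.
Proof.
move=> lf lh e1 eM; refine (palg_ext lf lh _) => w.
by elim: w => [|v w IH]; [exact: e1|rewrite [pword _ _]lam_cons; exact: eM].
Qed.

Let Hal := @lam_graded_algebra k V.

Lemma gactM (a b : L) x : gact act (a ** b) x = gact act a x ** b + a ** gact act b x.
Proof. exact: (derM Hal lam_ind_ext gl gact_one gact_cons). Qed.

Lemma gact_comp n (eta : L) x : gact act (hcomp n eta) x = hcomp n (gact act eta x).
Proof.
have glx := gl x; have cl := graded_lin (@lam_graded k V) n.
move: eta; on_words => w.
rewrite lam_compE !gact_word /gactw (linEsum cl).
transitivity (if size w == n then gactw x w else 0).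
  by case: eqP => _; [exact: gact_word|exact: (linE0 glx)].
have sz (i : 'I_(size w)) y : size (set_nth 0 w i y) = size w.
  by rewrite size_set_nth; apply/maxn_idPr/ltn_ord.
case: eqP => [e|ne].
  by apply: eq_bigr => i _; rewrite lam_compE sz (introT eqP e).
by rewrite big1 // => i _; rewrite lam_compE sz (introF eqP ne).
Qed.

Lemma gact_right_module : right_module (gact act : L -> g -> L).
Proof. exact: (der_right_module hact Hal ll lam_ind_ext gl gact_one gact_cons). Qed.

Lemma gact_cop (eta : L) x : hcop (gact act eta x) =
  tmapS (fun e => gact act e x) id (hcop eta) + tmapS id (fun e => gact act e x) (hcop eta).
Proof.
exact: (der_cop (@lam_graded k V) Hal lam_ind_ext gl gact_one gact_cons gact_comp
  (@lam_cop_lin k V) (@lam_cop1 k V) (@lam_copM k V) (@lam_cop_lam1 k V)).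
Qed.

Lemma gact_cou (eta : L) x : hcou (gact act eta x) = 0.
Proof.
exact: (der_cou lam_ind_ext gl gact_one gact_cons (@lam_cou_lin k V) (@lam_couM k V)
  (@lam_cou_lam1 k V)).
Qed.

Definition lam_antipode : L -> L := @pantipode k V R 1.

Lemma lam_antipode_lin : linear lam_antipode.
Proof. exact: (pliftE (@lam_antipode_rel k V)).1. Qed.
Lemma lam_antipode1 : lam_antipode (hone L) = hone L.
Proof. by rewrite [LHS]((pliftE (@lam_antipode_rel k V)).2 [::]) /pSw scale1r. Qed.
Lemma lam_antipodeM (s : L) v :
  lam_antipode (s ** lam1 v) = - (lam1 v ** parityn (@hcomp k L) 1 (lam_antipode s)).
Proof.
by apply: (prim_SM (@lam_comp_rel k V) (@lam_antipode_rel k V)); split; [|exists v].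
Qed.

Lemma lam_ind_ext_r (M : lmodType k) (f h : L -> M) : linear f -> linear h ->
  f (hone L) = h (hone L) ->
  (forall v eta, f eta = h eta -> f (eta ** lam1 v) = h (eta ** lam1 v)) ->
  forall eta, f eta = h eta.
Proof.
move=> lf lh e1 eM; apply: (gen_ext (@prim_generated k V R 1) lf lh e1).
by move=> n e s z _ [_ [v ->]]; exact: eM.
Qed.

Lemma gact_antipode (eta : L) x : lam_antipode (gact act eta x) = gact act (lam_antipode eta) x.
Proof.
exact: (der_antipode (@lam_graded k V) Hal lam_ind_ext gl gact_one gact_cons gact_comp
  lam_antipode_lin lam_antipode1 lam_antipodeM lam_ind_ext_r).
Qed.

End LieActionOnExterior.

(** * Cross products *)

Section SmashProduct.
Variables (k : fieldType) (A L : superHopfData k) (X : Type) (V : Type).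
Variables (iA : X -> A) (la : V -> L) (D : L -> X -> L) (act : L -> A -> L).
Local Notation "a ** b" := (@hmul k A a b) (at level 37, left associativity).
Local Notation "a *** b" := (@hmul k L a b) (at level 37, left associativity).
Local Notation "𝟙A" := (hone A).
Local Notation "𝟙L" := (hone L).
Local Notation TA := (tmulS (@hcomp k A) (@hmul k A)).
Local Notation TL := (tmulS (@hcomp k L) (@hmul k L)).

Hypotheses (Agr : graded (@hcomp k A)) (Aal : graded_algebra A).
Hypothesis A0 : forall a : A, hcomp 0 a = a.
Hypothesis A_gen : forall a : A,
  span (fun y => exists n, gword (fun n z => n = 0%N /\ exists x, z = iA x) n y) a.
Hypotheses (Acop_lin : linear (@hcop k A)) (Acop1 : hcop 𝟙A = 𝟙A ⊠ 𝟙A).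
Hypothesis AcopM : forall a b : A, hcop (a ** b) = TA (hcop a) (hcop b).
Hypothesis Acop_iA : forall x, hcop (iA x) = iA x ⊠ 𝟙A + 𝟙A ⊠ iA x.
Hypotheses (Acou_lin : linear (fun a : A => hcou a : k^o)) (Acou1 : hcou 𝟙A = 1).
Hypothesis AcouM : forall a b : A, hcou (a ** b) = hcou a * hcou b.
Hypothesis Acou_iA : forall x, hcou (iA x) = 0.
Hypothesis Acounitr : forall a : A, tliftS (fun b c : A => hcou c *: b) (hcop a) = a.
Variable SA : A -> A.
Hypotheses (SA_lin : linear SA) (SA1 : SA 𝟙A = 𝟙A).
Hypothesis SAM : forall a x, SA (a ** iA x) = - (iA x ** SA a).

Hypotheses (Lgr : graded (@hcomp k L)) (Lal : graded_algebra L).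
Hypothesis la_comp : forall v, hcomp 1 (la v) = la v.
Hypothesis L_gen : forall a : L,
  span (fun y => exists n, gword (fun n z => n = 1%N /\ exists v, z = la v) n y) a.
Hypotheses (Lcop_lin : linear (@hcop k L)) (Lcop1 : hcop 𝟙L = 𝟙L ⊠ 𝟙L).
Hypothesis LcopM : forall a b : L, hcop (a *** b) = TL (hcop a) (hcop b).
Hypothesis Lcop_la : forall v, hcop (la v) = la v ⊠ 𝟙L + 𝟙L ⊠ la v.
Hypotheses (Lcou_lin : linear (fun a : L => hcou a : k^o)) (Lcou1 : hcou 𝟙L = 1).
Hypothesis LcouM : forall a b : L, hcou (a *** b) = hcou a * hcou b.
Hypothesis Lcou_la : forall v, hcou (la v) = 0.
Variable SL : L -> L.
Hypotheses (SL_lin : linear SL) (SL1 : SL 𝟙L = 𝟙L).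
Hypothesis SLM : forall s v, SL (s *** la v) = - (la v *** parityn (@hcomp k L) 1 (SL s)).

Hypotheses (D_lin : forall x, linear (fun e => D e x)) (D1 : forall x, D 𝟙L x = 0).
Hypothesis DM : forall a b x, D (a *** b) x = D a x *** b + a *** D b x.
Hypothesis D_comp : forall n e x, D (hcomp n e) x = hcomp n (D e x).
Hypothesis D_cop : forall e x, hcop (D e x) =
  tmapS (fun e => D e x) id (hcop e) + tmapS id (fun e => D e x) (hcop e).
Hypothesis D_cou : forall e x, hcou (D e x) = 0.
Hypothesis D_SL : forall e x, SL (D e x) = D (SL e) x.

Hypotheses (bact : bilin act) (act1 : forall e, act e 𝟙A = e).
Hypothesis actM : forall e a x, act e (a ** iA x) = D (act e a) x.

(* The structure maps of the cross product are variables subject to the defining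
   equations, which keeps conversion from unfolding them. *)
Variables (ocomp : nat -> tensor A L -> tensor A L).
Variables (omul : tensor A L -> tensor A L -> tensor A L) (oone : tensor A L).
Variables (ocop : tensor A L -> tensor (tensor A L) (tensor A L)) (ocou : tensor A L -> k).
Hypothesis ocompE : forall n t, ocomp n t = tmapS id (@hcomp k L n) t.
Hypothesis omulE : forall s t, omul s t = tliftS (fun a e => tliftS (fun b z =>
  tliftS (fun b1 b2 => (a ** b1) ⊠ (act e b2 *** z)) (hcop b)) t) s.
Hypothesis ooneE : oone = 𝟙A ⊠ 𝟙L.
Hypothesis ocopE : forall s, ocop s = tliftS (fun a e => tliftS (fun a1 a2 =>
  tliftS (fun e1 e2 => (a1 ⊠ e1) ⊠ (a2 ⊠ e2)) (hcop e)) (hcop a)) s.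
Hypothesis ocouE : forall s, ocou s = tliftS (X := k^o) (fun (a : A) (e : L) => hcou a * hcou e)
  s.

Definition smashO : superHopfData k := SuperHopfData ocomp omul oone ocop ocou.
Local Notation O := smashO.
Local Notation "s ⋆ t" := (@hmul k O s t) (at level 37, left associativity).
Local Notation TO := (tmulS (@hcomp k O) (@hmul k O)).
Local Notation PO := (parityS (@hcomp k O)).
Local Notation "𝟙" := (hone O).

Let bA : bilin (@hmul k A). Proof. by case: Aal. Qed.
Let bL : bilin (@hmul k L). Proof. by case: Lal. Qed.
Let bTA : bilin TA := tmul_bilin Agr bA.
Let bTL : bilin TL := tmul_bilin Lgr bL.
Let compL n : linear (@hcomp k L n) := graded_lin Lgr n.

Let A_ext (M : lmodType k) (f h : A -> M) : linear f -> linear h -> f 𝟙A = h 𝟙A ->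
  (forall a x, f a = h a -> f (a ** iA x) = h (a ** iA x)) -> forall a, f a = h a.
Proof.
move=> lf lh e1 eM; apply: (gen_ext A_gen lf lh e1).
by move=> n e s z _ [_ [x ->]]; exact: eM.
Qed.

Let L_ext (M : lmodType k) (f h : L -> M) : linear f -> linear h -> f 𝟙L = h 𝟙L ->
  (forall e v, f e = h e -> f (e *** la v) = h (e *** la v)) -> forall e, f e = h e.
Proof.
move=> lf lh e1 eM; apply: (gen_ext L_gen lf lh e1).
by move=> n e s z _ [_ [x ->]]; exact: eM.
Qed.

Let TA_prim x a b : TA (a ⊠ b) (iA x ⊠ 𝟙A + 𝟙A ⊠ iA x) = a ** iA x ⊠ b + a ⊠ b ** iA x.
Proof.
rewrite (linED (bilin_r _ bTA)) (tmulP Agr Aal _ _ _ (A0 _)) (tmulP Agr Aal _ _ _ (A0 _)).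
by rewrite !(hmulr1 Aal).
Qed.

(* [Mx x] and [Rz z] are the right multiplications by [iA x] and [z]; associativity
   follows because [s ⋆ _] commutes with both. *)
Let Mx x (t : tensor A L) : tensor A L :=
  tmapS (fun a => a ** iA x) id t + tmapS id (fun e => D e x) t.
Let Rz z (t : tensor A L) : tensor A L := tmapS id (fun e => e *** z) t.
Let Mx_lin x : linear (Mx x).
Proof. by have Dx := D_lin x; rewrite /Mx; lin. Qed.
Let Rz_lin z : linear (Rz z). Proof. by rewrite /Rz; lin. Qed.
Let MxP x a e : Mx x (a ⊠ e) = a ** iA x ⊠ e + a ⊠ D e x.
Proof. by have Dx := D_lin x; rewrite /Mx !tmapP //; lin. Qed.
Let RzP z a e : Rz z (a ⊠ e) = a ⊠ e *** z.
Proof. by rewrite /Rz tmapP //; lin. Qed.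

Let omul_bilin : bilin (@hmul k O).
Proof.
have -> : @hmul k O = fun s t => tliftS (fun a e => tliftS (fun b z =>
  tliftS (fun b1 b2 => (a ** b1) ⊠ (act e b2 *** z)) (hcop b)) t) s.
  by apply/funext => s; apply/funext => t; exact: omulE.
lin.
Qed.

Let mulP a e b z : (a ⊠ e) ⋆ (b ⊠ z)
  = tliftS (fun b1 b2 => (a ** b1) ⊠ (act e b2 *** z)) (hcop b).
Proof. by rewrite [LHS]omulE; tsimp. Qed.

Let mul_one s z : s ⋆ (𝟙A ⊠ z) = Rz z s.
Proof.
have bm := omul_bilin; have rl := Rz_lin z.
move: s; on_pure => a e.
by rewrite mulP Acop1 RzP; tsimp; rewrite (hmulr1 Aal) act1.
Qed.

Let mul_Rz s t z : s ⋆ Rz z t = Rz z (s ⋆ t).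
Proof.
have bm := omul_bilin; have rl := Rz_lin z.
move: s; on_pure => a e.
move: t; on_pure => b y.
rewrite RzP !mulP; move: (hcop b); on_pure => b1 b2.
by tsimp; rewrite RzP (hmulA Lal).
Qed.

Let mul_Mx s t x : s ⋆ Mx x t = Mx x (s ⋆ t).
Proof.
have bm := omul_bilin; have ml := Mx_lin x.
move: s; on_pure => a e.
move: t; on_pure => b z.
rewrite MxP (linED (bilin_r _ bm)) !mulP AcopM Acop_iA.
move: (hcop b); on_pure => b1 b2.
rewrite TA_prim linED; last by lin.
by tsimp; rewrite MxP actM DM tpureDr (hmulA Aal) addrA.
Qed.

Let Rz_one s : Rz 𝟙L s = s.
Proof.
have rl := Rz_lin 𝟙L.
move: s; on_pure => a e.
by rewrite RzP (hmulr1 Lal).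
Qed.

Let Mx_word x a : a ** iA x ⊠ 𝟙L = Mx x (a ⊠ 𝟙L).
Proof. by rewrite MxP D1 tpure0r addr0. Qed.

Let Rz_word a z : a ⊠ z = Rz z (a ⊠ 𝟙L).
Proof. by rewrite RzP (hmul1 Lal). Qed.

Let mulA_O s t u : s ⋆ (t ⋆ u) = (s ⋆ t) ⋆ u.
Proof.
have bm := omul_bilin.
move: u; on_pure => c z.
rewrite Rz_word !mul_Rz; congr (Rz z _).
move: c; refine (A_ext _ _ _ _); [lin|lin| |] => [|c x IH].
  by rewrite !mul_one !Rz_one.
by rewrite Mx_word !mul_Mx IH.
Qed.

Let mul1_O s : (𝟙A ⊠ 𝟙L) ⋆ s = s.
Proof.
have bm := omul_bilin.
move: s; on_pure => c z.
rewrite (Rz_word c) mul_Rz; congr (Rz z _).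
move: c; refine (A_ext _ _ _ _); [lin|lin| |] => [|c x IH].
  by rewrite mul_one Rz_one.
by rewrite Mx_word mul_Mx IH.
Qed.

Lemma smash_one : 𝟙 = 𝟙A ⊠ 𝟙L. Proof. exact: ooneE. Qed.

Let act_comp n e a : act (hcomp n e) a = hcomp n (act e a).
Proof.
have cn := compL n.
move: a; refine (A_ext _ _ _ _); [lin|lin| |] => [|a x IH]; first by rewrite !act1.
by rewrite !actM IH D_comp.
Qed.

Lemma smash_compE n t : @hcomp k O n t = tmapS id (@hcomp k L n) t.
Proof. exact: ocompE. Qed.

Lemma smash_comp_lin n : linear (@hcomp k O n).
Proof.
have cn := compL n.
have -> : @hcomp k O n = tmapS id (@hcomp k L n) by apply/funext => t; exact: ocompE.
lin.
Qed.

Lemma smash_compP n (a : A) (e : L) : @hcomp k O n (a ⊠ e) = a ⊠ hcomp n e.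
Proof. by rewrite smash_compE tmapP //; lin. Qed.

Lemma smash_graded : graded (@hcomp k O).
Proof.
apply: graded_of_span; first exact: smash_comp_lin.
elim/tensor_ind => [|c s t hs ht|a e]; [exact: span0|exact: spanZD|].
have [N ->] := comp_sum Lgr e; rewrite (linEsum (@tpure_linr _ _ _ _)).
apply: span_sum => n _; apply: span_incl; exists (nat_of_ord n) => m.
rewrite smash_compP (comp_comp Lgr); case: eqP => // _.
by rewrite tpure0r.
Qed.

Lemma smash_graded_algebra : graded_algebra O.
Proof.
split.
- exact: omul_bilin.
- exact: mulA_O.
- split=> s; rewrite smash_one; first exact: mul1_O.
  by rewrite mul_one Rz_one.
- by rewrite smash_one smash_compP (comp_one Lal).
move=> m n s t; cbv zeta; have bm := omul_bilin.
have cm := smash_comp_lin m; have cn := smash_comp_lin n; have cmn := smash_comp_lin (m + n).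
move: s; on_pure => a e.
move: t; on_pure => b z.
rewrite !smash_compP mulP; move: (hcop b); on_pure => b1 b2.
tsimp; rewrite smash_compP; congr (_ ⊠ _).
by apply: (comp_mul Lal); rewrite ?act_comp (compK Lgr).
Qed.

Let Ogr := smash_graded.
Let Oal := smash_graded_algebra.
Let bO : bilin (@hmul k O) := omul_bilin.
Let bTO : bilin TO := tmul_bilin Ogr bO.

Lemma smash_parityn n (a : A) (e : L) :
  parityn (@hcomp k O) n (a ⊠ e) = a ⊠ parityn (@hcomp k L) n e.
Proof.
have l1 := parityn_lin Ogr n; have l2 := parityn_lin Lgr n.
move: e; refine (graded_ext Lgr _ _ _); [lin|lin|] => m e he.
have h : @hcomp k O m (a ⊠ e) = a ⊠ e by rewrite smash_compP he.
by rewrite (parityn_hom Ogr n h) (parityn_hom Lgr n he) tpureZr.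
Qed.

Lemma smash_parity (a : A) (e : L) : PO (a ⊠ e) = a ⊠ parityS (@hcomp k L) e.
Proof. exact: (smash_parityn 1). Qed.

Definition smash_gen (n : nat) (z : O) : Prop :=
  (n = 0%N /\ exists x, z = iA x ⊠ 𝟙L) \/ (n = 1%N /\ exists v, z = 𝟙A ⊠ la v).

Let genA x : smash_gen 0 (iA x ⊠ 𝟙L). Proof. by left; split=> //; exists x. Qed.
Let genL v : smash_gen 1 (𝟙A ⊠ la v). Proof. by right; split=> //; exists v. Qed.

Lemma smash_gen_hom n z : smash_gen n z -> hcomp n z = z.
Proof.
by case=> -[-> [x ->]]; rewrite smash_compP ?(comp_one Lal) ?la_comp.
Qed.

Lemma smash_mul_iA s x : s ⋆ (iA x ⊠ 𝟙L) = Mx x s.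
Proof. by rewrite -{1}(hmul1 Aal (iA x)) Mx_word mul_Mx -smash_one (hmulr1 Oal). Qed.

Lemma smash_mulP_iA (a : A) (e : L) x : (a ⊠ e) ⋆ (iA x ⊠ 𝟙L) = a ** iA x ⊠ e + a ⊠ D e x.
Proof. by rewrite smash_mul_iA MxP. Qed.

Lemma smash_mulP_L (a : A) (e z : L) : (a ⊠ e) ⋆ (𝟙A ⊠ z) = a ⊠ e *** z.
Proof. by rewrite mul_one RzP. Qed.

Lemma smash_mul_A (a b : A) (z : L) : (a ⊠ 𝟙L) ⋆ (b ⊠ z) = a ** b ⊠ z.
Proof.
rewrite (Rz_word b) mul_Rz (Rz_word (a ** b)); congr (Rz z _).
move: b; refine (A_ext _ _ _ _); [lin|lin| |] => [|b x IH].
  by rewrite mul_one Rz_one (hmulr1 Aal).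
by rewrite Mx_word mul_Mx IH -Mx_word (hmulA Aal).
Qed.

(** A word in the generators of [A] followed by one in those of [L] multiplies to the corresponding
    pure tensor, so no reordering is involved. *)
Lemma smash_generated (s : O) : span (fun y => exists n, gword smash_gen n y) s.
Proof.
have hA m a : gword (fun n z => n = 0%N /\ exists x, z = iA x) m a ->
    exists n, gword smash_gen n (a ⊠ 𝟙L : O).
  elim=> [|{}m e {}a z _ [n IH] [_ [x ->]]].
    by exists 0%N; rewrite -smash_one; exact: gword1.
  by exists (n + 0)%N; rewrite Mx_word -smash_mul_iA; exact: gwordM IH (genA x).
have hL m e a : gword (fun n z => n = 0%N /\ exists x, z = iA x) m a ->
    forall m', gword (fun n z => n = 1%N /\ exists v, z = la v) m' e ->
    exists n, gword smash_gen n (a ⊠ e : O).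
  move=> ga m'; elim=> [|{}m' e' {}e z _ [n IH] [_ [v ->]]]; first exact: hA ga.
  by exists (n + 1)%N; rewrite -smash_mulP_L; exact: gwordM IH (genL v).
move: s; elim/tensor_ind => [|c s t hs ht|a e]; [exact: span0|exact: spanZD|].
have l1 : linear (fun a : A => a ⊠ e) by lin.
apply: (span_lin l1 _ (A_gen a)) => a' [m ga].
have l2 : linear (fun e : L => a' ⊠ e) by lin.
apply: (span_lin l2 _ (L_gen e)) => e' [m' ge].
by apply: span_incl; exact: hL ga _ ge.
Qed.

(** The exchange of the two middle factors; it carries no sign because [A] is concentrated in degree
    0. *)
Let swap (p : tensor A A) (q : tensor L L) : tensor O O :=
  tliftS (fun a1 a2 => tliftS (fun e1 e2 => (a1 ⊠ e1) ⊠ (a2 ⊠ e2)) q) p.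
Let swap_bilin : bilin swap. Proof. by rewrite /swap; lin. Qed.
Let swapP a1 a2 e1 e2 : swap (a1 ⊠ a2) (e1 ⊠ e2) = (a1 ⊠ e1) ⊠ (a2 ⊠ e2).
Proof. by rewrite /swap; tsimp. Qed.

Lemma smash_cop_lin : linear (@hcop k O).
Proof.
have -> : @hcop k O = tliftS (fun a e => tliftS (fun a1 a2 =>
  tliftS (fun e1 e2 => (a1 ⊠ e1) ⊠ (a2 ⊠ e2)) (hcop e)) (hcop a)).
  by apply/funext => s; exact: ocopE.
lin.
Qed.

Let copP a e : @hcop k O (a ⊠ e) = swap (hcop a) (hcop e).
Proof. by rewrite [LHS]ocopE; tsimp. Qed.

Lemma smash_cou_lin : linear (fun s : O => hcou s : k^o).
Proof.
have -> : (fun s : O => hcou s : k^o) = tliftS (X := k^o) (fun (a : A) (e : L) => hcou a * hcou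
  e).
  by apply/funext => s; exact: ocouE.
lin.
Qed.

Lemma smash_couP (a : A) (e : L) : @hcou k O (a ⊠ e) = hcou a * hcou e.
Proof. by rewrite [LHS]ocouE tliftP //; lin. Qed.

Let cop1_O : @hcop k O 𝟙 = 𝟙 ⊠ 𝟙.
Proof. by rewrite smash_one copP Acop1 Lcop1 swapP. Qed.

Let cou1_O : @hcou k O 𝟙 = 1.
Proof. by rewrite smash_one smash_couP Acou1 Lcou1 mulr1. Qed.

Lemma smash_copM n (s z : O) : smash_gen n z -> hcop (s ⋆ z) = TO (hcop s) (z ⊠ 𝟙 + 𝟙 ⊠ z).
Proof.
have cl := smash_cop_lin; have bs := swap_bilin; have Aprim := TA_prim.
move=> gz; have := smash_gen_hom gz; case: gz => -[-> [x ->]] hz.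
  have Dx := D_lin x; move: s; on_pure => a e.
  rewrite smash_mulP_iA (linED cl) !copP AcopM Acop_iA D_cop.
  move: (hcop a); on_pure => a1 a2.
  move: (hcop e); on_pure => e1 e2.
  rewrite Aprim !tmapP // (linED (bilin_l _ bs)) (linED (bilin_r _ bs)) !swapP.
  rewrite (linED (bilin_r _ bTO)) (tmulP Ogr Oal _ _ _ hz) (tmulP Ogr Oal _ _ _ (comp_one Oal)).
  rewrite !(hmulr1 Oal) !smash_mulP_iA.
  rewrite tpureDl tpureDr.
  by rewrite addrACA.
move: s; on_pure => a e.
rewrite smash_mulP_L !copP LcopM Lcop_la.
move: (hcop a); on_pure => a1 a2.
move: (hcop e); on_pure => e1 e2.
rewrite (linED (bilin_r _ bTL)) (tmulP Lgr Lal _ _ _ (la_comp x)).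
rewrite (tmulP Lgr Lal _ _ _ (comp_one Lal)) !(hmulr1 Lal).
rewrite (linED (bilin_r _ bs)) !swapP.
rewrite (linED (bilin_r _ bTO)) (tmulP Ogr Oal _ _ _ hz) (tmulP Ogr Oal _ _ _ (comp_one Oal)).
by rewrite !(hmulr1 Oal) smash_parityn !smash_mulP_L.
Qed.

Lemma smash_couM n (s z : O) : smash_gen n z -> hcou (s ⋆ z) = 0.
Proof.
have cl := smash_cou_lin; case=> -[_ [x ->]]; move: s.
  refine (tensor_ext (X := k^o) (f := fun s => @hcou k O (s ⋆ (iA x ⊠ 𝟙L)))
    (g := fun _ => 0) _ _ _); [lin|exact: lin_0|] => a e.
  by rewrite smash_mulP_iA [LHS](linED cl) !smash_couP D_cou AcouM Acou_iA !mulr0 mul0r addr0.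
refine (tensor_ext (X := k^o) (f := fun s => @hcou k O (s ⋆ (𝟙A ⊠ la x)))
  (g := fun _ => 0) _ _ _); [lin|exact: lin_0|] => a e.
by rewrite smash_mulP_L smash_couP LcouM Lcou_la !mulr0.
Qed.

(** The pure tensor is the product of its two factors, and an antipode reverses products; there is
    no sign because [a] is even. *)
Definition smash_antipode (s : O) : O := tliftS (fun a e => (𝟙A ⊠ SL e) ⋆ (SA a ⊠ 𝟙L)) s.

Let S_lin : linear smash_antipode. Proof. by rewrite /smash_antipode; lin. Qed.
Let SP a e : smash_antipode (a ⊠ e) = (𝟙A ⊠ SL e) ⋆ (SA a ⊠ 𝟙L).
Proof. by rewrite /smash_antipode tliftP //; lin. Qed.

Lemma smash_SM n (s z : O) : smash_gen n z ->
  smash_antipode (s ⋆ z) = - (z ⋆ parityn (@hcomp k O) n (smash_antipode s)).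
Proof.
have sl := S_lin; have pl := parityn_lin Ogr n; have OA := hmulA Oal.
case=> -[en [x ->]]; rewrite en {en} in pl *.
  move: s; on_pure => a e.
  rewrite smash_mulP_iA (linED sl) !SP SAM D_SL.
  rewrite tpureNl (linEN (bilin_r _ bO)) -smash_mul_A !OA.
  (* Moving [iA x] to the left of [SL e] produces a term with [D (SL e) x], which cancels the image
     of [a ⊠ D e x]. *)
  rewrite smash_mulP_iA (hmul1 Aal) smash_mul_A (hmulr1 Aal) (linED (bilin_l _ bO)).
  by rewrite opprD addrNK.
move: s; on_pure => a e.
rewrite smash_mulP_L !SP SLM tpureNr (linEN (bilin_l _ bO)).
rewrite (paritynM Ogr Oal) !smash_parityn (parityn_one Lgr Lal) OA.
by rewrite smash_mulP_L.
Qed.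

Lemma smash_super_hopf : super_hopf O.
Proof.
apply: (super_hopf_gen Ogr Oal smash_gen_hom smash_generated smash_cop_lin smash_cou_lin
  cop1_O cou1_O smash_copM smash_couM S_lin _ smash_SM).
by rewrite smash_one SP SL1 SA1 smash_mul_A (hmul1 Aal).
Qed.

Lemma smash_cop_A (a : A) : hcop a = a ⊠ 𝟙A + 𝟙A ⊠ a ->
  @hcop k O (a ⊠ 𝟙L) = (a ⊠ 𝟙L) ⊠ 𝟙 + 𝟙 ⊠ (a ⊠ 𝟙L).
Proof. by move=> e; rewrite copP e Lcop1 (linED (bilin_l _ swap_bilin)) !swapP smash_one. Qed.

Lemma smash_cop_L (e : L) : hcop e = e ⊠ 𝟙L + 𝟙L ⊠ e ->
  @hcop k O (𝟙A ⊠ e) = (𝟙A ⊠ e) ⊠ 𝟙 + 𝟙 ⊠ (𝟙A ⊠ e).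
Proof. by move=> h; rewrite copP h Acop1 (linED (bilin_r _ swap_bilin)) !swapP smash_one. Qed.

Lemma smash_cop_inl (a : A) :
  @hcop k O (a ⊠ 𝟙L) = tmapS (fun a => a ⊠ 𝟙L : O) (fun a => a ⊠ 𝟙L : O) (hcop a).
Proof.
rewrite copP Lcop1; have bs := swap_bilin; move: (hcop a).
by on_pure => a1 a2; rewrite swapP tmapP //; lin.
Qed.

(** * The differential of a cross product *)

Section Differential.
Variable w : A -> L.
Hypotheses (w_lin : linear w) (w1 : w 𝟙A = 0).
Hypothesis wM : forall a x, w (a ** iA x) = D (w a) x + hcou a *: w (iA x).
Hypothesis w_comp : forall a, hcomp 1 (w a) = w a.
Hypothesis w_comm : forall a e, w a *** e = parityS (@hcomp k L) e *** w a.
Hypothesis w_cop : forall x, hcop (w (iA x)) = w (iA x) ⊠ 𝟙L + 𝟙L ⊠ w (iA x).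
Variable d : O -> O.
Hypothesis dE : forall s, d s = tliftS (fun a e =>
  tliftS (fun a1 a2 => a1 ⊠ (w a2 *** e)) (hcop a)) s.

Lemma smash_d_lin : linear d.
Proof.
have -> : d = tliftS (fun a e => tliftS (fun a1 a2 => a1 ⊠ (w a2 *** e)) (hcop a)).
  by apply/funext => s; exact: dE.
lin.
Qed.

Let dP a e : d (a ⊠ e) = tliftS (fun a1 a2 => a1 ⊠ (w a2 *** e)) (hcop a).
Proof. by rewrite dE tliftP //; lin. Qed.

(** Stated for every primitive [a], not only for generators, because the Lie derivative applies it
    to the value of an augmentation, which is only known to be primitive. *)
Lemma smash_d_prim (a : A) (e : L) : hcop a = a ⊠ 𝟙A + 𝟙A ⊠ a -> d (a ⊠ e) = 𝟙A ⊠ w a *** e.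
Proof.
move=> ha; rewrite dP ha linED; last by lin.
by tsimp; rewrite w1 (linE0 (bilin_l _ bL)) tpure0r add0r.
Qed.

Lemma smash_d_L e : d (𝟙A ⊠ e) = 0.
Proof.
by rewrite dP Acop1; tsimp; rewrite w1 (linE0 (bilin_l _ bL)) tpure0r.
Qed.

Lemma smash_d_gen n (s z : O) : smash_gen n z -> d (s ⋆ z) = d s ⋆ z + PO s ⋆ d z.
Proof.
have dl := smash_d_lin; have pl := parity_lin Ogr.
case=> -[_ [x ->]].
  rewrite (smash_d_prim _ (Acop_iA x)) (hmulr1 Lal); have ml := Mx_lin x.
  move: s; on_pure => a e.
  rewrite smash_mulP_iA (linED dl) !dP smash_parity smash_mulP_L -w_comm smash_mul_iA.
  have lw : linear (fun b : A => b ⊠ w (iA x) *** e) by lin.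
  (* Writing [a] through the counit turns every term into a function of [hcop a]; the inserted
     counit matches the one in [wM]. *)
  rewrite -[a ⊠ w (iA x) *** e](f_equal (fun b => b ⊠ w (iA x) *** e) (Acounitr a)).
  rewrite AcopM Acop_iA; have Aprim := TA_prim.
  move: (hcop a); on_pure => a1 a2.
  rewrite Aprim linED; last by lin.
  tsimp; rewrite MxP DM wM (linED (bilin_l _ bL)) (linEZ (bilin_l _ bL)).
  rewrite (linEZ lw) tpureDr tpureDr.
  rewrite tpureZr -!addrA; congr (_ + (_ + _)).
  by rewrite addrC.
rewrite smash_d_L (linE0 (bilin_r _ bO)) addr0.
move: s; on_pure => a e.
rewrite smash_mulP_L !dP; move: (hcop a); on_pure => a1 a2.
by tsimp; rewrite smash_mulP_L (hmulA Lal).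
Qed.

Lemma smash_d_comp n s : hcomp n.+1 (d (hcomp n s)) = d (hcomp n s).
Proof.
have dl := smash_d_lin; have c1 := smash_comp_lin n; have c2 := smash_comp_lin n.+1.
move: s; on_pure => a e.
rewrite smash_compP dP; move: (hcop a); on_pure => a1 a2.
tsimp; rewrite smash_compP -add1n; congr (_ ⊠ _).
by apply: (comp_mul Lal); [exact: w_comp|exact: (compK Lgr)].
Qed.

Let d_odd n x : @hcomp k O n x = x -> exists2 m, @hcomp k O m (d x) = d x & odd m = ~~ odd n.
Proof. by move=> <-; exists n.+1; [exact: smash_d_comp|]. Qed.

Lemma smash_d1 : d 𝟙 = 0. Proof. by rewrite smash_one smash_d_L. Qed.

Lemma smash_d_derivation : super_derivation d.
Proof.
exact: (super_derivation_gen Ogr Oal smash_generated smash_d_lin smash_d1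
  (fun e s z => @smash_d_gen e s z)).
Qed.

Lemma smash_d_coderivation : super_coderivation d.
Proof.
apply: (super_coderivation_gen Ogr Oal smash_gen_hom smash_generated smash_cop_lin
  cop1_O smash_copM smash_d_lin smash_d1
  smash_d_derivation d_odd).
move=> e z [[_ [x ->]]|[_ [v ->]]].
  by rewrite (smash_d_prim _ (Acop_iA x)) (hmulr1 Lal); exact: smash_cop_L.
rewrite smash_d_L (linE0 smash_cop_lin).
by rewrite tpure0l tpure0r addr0.
Qed.

Lemma smash_d_sq s : d (d s) = 0.
Proof.
apply: (super_derivation_sq Ogr Oal smash_generated smash_d_lin smash_d1
  smash_d_derivation d_odd).
move=> e z [[_ [x ->]]|[_ [v ->]]].
  by rewrite (smash_d_prim _ (Acop_iA x)) smash_d_L.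
by rewrite smash_d_L (linE0 smash_d_lin).
Qed.

End Differential.

(** * Augmentations of a cross product *)

Section Augmentation.
Variables (I : L -> O) (j : V -> A).
Hypotheses (I_lin : linear I) (I1 : I 𝟙L = 0).
Hypothesis IM : forall e z,
  I (e *** z) = I e ⋆ (𝟙A ⊠ z) + (𝟙A ⊠ parityS (@hcomp k L) e) ⋆ I z.
Hypothesis I_la : forall v, I (la v) = j v ⊠ 𝟙L.
Hypothesis j_cop : forall v, hcop (j v) = j v ⊠ 𝟙A + 𝟙A ⊠ j v.
(** Equivariance of [j], expressed through [I] because [V] carries no action in this section. *)
Hypothesis j_equiv : forall v x, I (D (la v) x) = (j v ** iA x - iA x ** j v) ⊠ 𝟙L.

Definition smash_aug (s : O) : O := tliftS (fun a e => (a ⊠ 𝟙L) ⋆ I e) s.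
Local Notation i := smash_aug.

Let i_lin : linear i. Proof. by rewrite /smash_aug; lin. Qed.
Let iP a e : i (a ⊠ e) = (a ⊠ 𝟙L) ⋆ I e.
Proof. by rewrite /smash_aug tliftP //; lin. Qed.

Let OA : associative (@hmul k O) := hmulA Oal.

Let comm_iA e x : (𝟙A ⊠ e) ⋆ (iA x ⊠ 𝟙L) = (iA x ⊠ 𝟙L) ⋆ (𝟙A ⊠ e) + 𝟙A ⊠ D e x.
Proof. by rewrite smash_mulP_iA smash_mul_A (hmul1 Aal) (hmulr1 Aal). Qed.

(** The condition for extending [I] by zero on [A]: the extension must respect the exchange rule e x
    = x e + D e x of the cross product. *)
Let I_comm e x : I e ⋆ (iA x ⊠ 𝟙L) = (iA x ⊠ 𝟙L) ⋆ I e + I (D e x).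
Proof.
have Dx := D_lin x; have pl := parity_lin Lgr.
have DP e' : D (parityS (@hcomp k L) e') x = parityS (@hcomp k L) (D e' x).
  by apply: (even_parityn Lgr Dx _ 1) => m a; exact: D_comp.
move: e; refine (L_ext _ _ _ _); [lin|lin| |] => [|e v IH].
  by rewrite D1 I1 (linE0 I_lin) (linE0 (bilin_l _ bO)) (linE0 (bilin_r _ bO)) addr0.
rewrite IM I_la DM (linED I_lin) !IM j_equiv I_la.
rewrite (linED (bilin_l _ bO)) -OA comm_iA (linED (bilin_r _ bO)) OA IH.
rewrite -[_ ⋆ (j v ⊠ 𝟙L) ⋆ _]OA smash_mul_A.
have -> : j v ** iA x ⊠ 𝟙L = (iA x ⊠ 𝟙L) ⋆ (j v ⊠ 𝟙L) + (j v ** iA x - iA x ** j v) ⊠ 𝟙L.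
  by rewrite smash_mul_A -tpureDl addrC subrK.
rewrite [in X in _ + X](linED (bilin_r _ bO)) [in X in _ + (X + _)]OA comm_iA DP.
rewrite !(linED (bilin_l _ bO)) (linED (bilin_r _ bO)) !OA.
set t1 := _ ⋆ _ ⋆ (𝟙A ⊠ la v); set t2 := _ ⋆ (𝟙A ⊠ la v); set t3 := _ ⋆ (𝟙A ⊠ D _ _).
set t4 := _ ⋆ _ ⋆ (j v ⊠ 𝟙L); set t5 := _ ⋆ (j v ⊠ 𝟙L); set t6 := _ ⋆ (_ ⊠ 𝟙L).
clearbody t1 t2 t3 t4 t5 t6.
by rewrite (addrACA t2) (addrACA t1) !addrA.
Qed.

Lemma smash_aug_la v : i (𝟙A ⊠ la v) = j v ⊠ 𝟙L.
Proof. by rewrite iP I_la smash_mul_A (hmul1 Aal). Qed.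

Let i_gen n (s z : O) : smash_gen n z -> i (s ⋆ z) = i s ⋆ z + PO s ⋆ i z.
Proof.
have il := i_lin; have pl := parity_lin Ogr.
case=> -[_ [x ->]]; move: s.
  on_pure => a e.
  rewrite smash_mulP_iA (linED il) !iP I1 (linE0 (bilin_r _ bO)) (linE0 (bilin_r _ bO)) addr0.
  by rewrite -OA I_comm (linED (bilin_r _ bO)) OA smash_mul_A.
on_pure => a e.
rewrite smash_mulP_L smash_aug_la !iP IM I_la (linED (bilin_r _ bO)) !OA smash_parity.
by rewrite smash_mul_A (hmulr1 Aal).
Qed.

Let i1 : i 𝟙 = 0. Proof. by rewrite smash_one iP I1 (linE0 (bilin_r _ bO)). Qed.

Let i_der : super_derivation i.
Proof.
exact: (super_derivation_gen Ogr Oal smash_generated i_lin i1 (fun e s z => @i_gen e s z)).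
Qed.

Lemma smash_aug_iA x : i (iA x ⊠ 𝟙L) = 0.
Proof. by rewrite iP I1 (linE0 (bilin_r _ bO)). Qed.

(** Degree 0 has no predecessor, so there the claim is that [i] vanishes; this is also what the
    inductive step needs when the first odd letter is appended. *)
Let i_gword n s : gword smash_gen n s ->
  (n = 0%N -> i s = 0) /\ (forall m, n = m.+1 -> hcomp m (i s) = i s).
Proof.
elim=> [|{}n e {}s z gs [IH0 IHS] gz]; first by split=> // _; exact: i1.
have hs := gword_comp Oal smash_gen_hom gs; rewrite (i_gen _ gz) (parity_hom Ogr hs).
case: gz => -[-> [x ->]].
  rewrite smash_aug_iA (linE0 (bilin_r _ bO)) addr0 addn0; split.
    by move=> /IH0 ->; rewrite (linE0 (bilin_l _ bO)).
  move=> m /IHS h; rewrite -{1}(addn0 m); apply: (comp_mul Oal) => //.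
  by rewrite smash_compP (comp_one Lal).
rewrite addn1 smash_aug_la; split=> // m [<-].
have h2 : hcomp n (((-1) ^+ n *: s) ⋆ (j x ⊠ 𝟙L)) = ((-1) ^+ n *: s) ⋆ (j x ⊠ 𝟙L).
  rewrite -{1}(addn0 n); apply: (comp_mul Oal); last by rewrite smash_compP (comp_one Lal).
  by rewrite (linEZ (smash_comp_lin n)) hs.
rewrite (linED (smash_comp_lin n)) h2; congr (_ + _).
case: n IH0 IHS {hs h2 gs} => [/(_ erefl)-> _|n _ /(_ n erefl) h].
  by rewrite (linE0 (bilin_l _ bO)) (linE0 (smash_comp_lin 0)).
rewrite -{1}addn1; apply: (comp_mul Oal) => //.
by rewrite smash_compP la_comp.
Qed.

Let i_comp0 s : i (hcomp 0 s) = 0.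
Proof.
have il := i_lin; have c0 := smash_comp_lin 0.
move: s; refine (gword_ext smash_generated _ _ _); [lin|exact: lin_0|] => n s gs.
rewrite (comp_hom Ogr _ (gword_comp Oal smash_gen_hom gs)).
by case: n gs => [/i_gword[/(_ erefl)]|n _]; rewrite ?(linE0 il).
Qed.

Let i_compS n s : hcomp n (i (hcomp n.+1 s)) = i (hcomp n.+1 s).
Proof.
have il := i_lin; have c0 := smash_comp_lin n; have c1 := smash_comp_lin n.+1.
move: s; refine (gword_ext smash_generated _ _ _); [lin|lin|] => m s gs.
rewrite (comp_hom Ogr _ (gword_comp Oal smash_gen_hom gs)).
case: eqP => [e|_]; last by rewrite (linE0 il) (linE0 c0).
by case: (i_gword gs) => _ h; apply: h.
Qed.

Let i_odd n x : @hcomp k O n x = x -> exists2 m, @hcomp k O m (i x) = i x & odd m = ~~ odd n.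
Proof.
case: n => [|n] <-; last by exists n; [exact: i_compS|rewrite /= negbK].
(* The image is zero, hence homogeneous of any degree; 1 is chosen for its parity. *)
by exists 1%N => //; rewrite i_comp0 (linE0 (smash_comp_lin 1)).
Qed.

Lemma smash_augmentation : augmentation i.
Proof.
split; [exact: i_lin|by split; [exact: i_comp0|exact: i_compS]| |exact: i_der|].
  apply: (super_derivation_sq Ogr Oal smash_generated i_lin i1 i_der i_odd).
  move=> e z [[_ [x ->]]|[_ [v ->]]]; first by rewrite smash_aug_iA (linE0 i_lin).
  by rewrite smash_aug_la iP I1 (linE0 (bilin_r _ bO)).
apply: (super_coderivation_gen Ogr Oal smash_gen_hom smash_generated smash_cop_lin
  cop1_O smash_copM i_lin i1 i_der i_odd).
move=> e z [[_ [x ->]]|[_ [v ->]]].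
  rewrite smash_aug_iA (linE0 smash_cop_lin).
  by rewrite tpure0l tpure0r addr0.
by rewrite smash_aug_la; exact: smash_cop_A.
Qed.

End Augmentation.
End SmashProduct.

(** * The algebra U(g) # Lambda(V) *)

Section SkewDerivation.
Variables (k : fieldType) (V : Type) (L O : superHopfData k).
Local Notation "x ** y" := (@hmul k L x y) (at level 37, left associativity).
Local Notation "s ⋆ t" := (@hmul k O s t) (at level 37, left associativity).
Variables (la : V -> L) (e I : L -> O) (t : V -> O).
Hypotheses (Lgr : graded (@hcomp k L)) (Lal : graded_algebra L) (Oal : graded_algebra O).
Hypotheses (e_lin : linear e) (e1 : e (hone L) = hone O).
Hypothesis eM : forall x y, e (x ** y) = e x ⋆ e y.
Hypothesis L_ext : forall (M : lmodType k) (f h : L -> M), linear f -> linear h ->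
  f (hone L) = h (hone L) ->
  (forall v eta, f eta = h eta -> f (la v ** eta) = h (la v ** eta)) ->
  forall eta, f eta = h eta.
Hypothesis la_comp : forall v, hcomp 1 (la v) = la v.
Hypotheses (I_lin : linear I) (I1 : I (hone L) = 0).
Hypothesis I_cons : forall v x, I (la v ** x) = t v ⋆ e x - e (la v) ⋆ I x.

(** Passing from one letter on the left to an arbitrary left factor, the minus signs of the letters
    multiply up to the parity of [x]. *)
Lemma skew_derivationM (x z : L) :
  I (x ** z) = I x ⋆ e z + e (parityS (@hcomp k L) x) ⋆ I z.
Proof.
have bm : bilin (@hmul k L) by case: Lal.
have bO : bilin (@hmul k O) by case: Oal.
have pl := parity_lin Lgr.
move: x; refine (L_ext _ _ _ _); [lin|lin| |] => [|v x IH].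
  rewrite (hmul1 Lal) I1 (linE0 (bilin_l _ bO)) add0r (parity_one Lgr Lal) e1.
  by rewrite (hmul1 Oal).
rewrite -(hmulA Lal) !I_cons IH (parityM Lgr Lal) (parity_hom Lgr (la_comp v)).
rewrite expr1 scaleN1r (linEN (bilin_l _ bm)) (linEN e_lin) (linEN (bilin_l _ bO)) !eM.
rewrite (linED (bilin_r _ bO)) (linEB (bilin_l _ bO)) !(hmulA Oal).
by rewrite opprD addrA.
Qed.

End SkewDerivation.

Section ContractionOnExterior.
Variables (k : fieldType) (V : lmodType k) (O : superHopfData k).
Local Notation R := (@Bminus_rel k V).
Local Notation L := (Lam V).
Local Notation W w := (pword R w : L).
Local Notation "x ** y" := (@hmul k L x y) (at level 37, left associativity).
Local Notation "s ⋆ t" := (@hmul k O s t) (at level 37, left associativity).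
Variables (e : L -> O) (t : V -> O).
Hypotheses (Oal : graded_algebra O) (e_lin : linear e) (t_lin : linear t).
Hypotheses (e1 : e (hone L) = hone O) (eM : forall x y, e (x ** y) = e x ⋆ e y).
(** The condition v <| i(v) = 0 in disguise: contracting v v gives t(v) v - v t(v), which has to
    vanish. *)
Hypothesis e_t : forall v, e (lam1 v) ⋆ t v = t v ⋆ e (lam1 v).

Let bO : bilin (@hmul k O). Proof. by case: Oal. Qed.
Let c v w : O := t v ⋆ e (W w).
Let m v y : O := e (lam1 v) ⋆ y.

Let c_lin w : linear (c^~ w). Proof. by rewrite /c; lin. Qed.
Let m_bil : bilin m. Proof. by have ll := @lam1_lin k V; rewrite /m; lin. Qed.

Let c_rel z u v a : @grassmann_rel k V a -> wlin (fun w => c z (u ++ w ++ v)) a = 0.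
Proof.
move=> Ga; have l : linear (fun x : L => t z ⋆ e x) by lin.
by rewrite (wlin_comp _ _ l) (lam_word_rel u v Ga) (linE0 l).
Qed.

Let c_sq v w : c v (v :: w) = m v (c v w).
Proof. by rewrite /c /m lam_cons eM !(hmulA Oal) e_t. Qed.

Let m_sq v y : m v (m v y) = 0.
Proof. by rewrite /m (hmulA Oal) -eM lam1_sq (linE0 e_lin) (linE0 (bilin_l _ bO)). Qed.

Definition lam_contr : L -> O := plift (skeww c m).

Let IE := lam_plift (skeww_rel c_lin m_bil c_rel c_sq m_sq).

Lemma lam_contr_lin : linear lam_contr. Proof. exact: IE.1. Qed.
Lemma lam_contr1 : lam_contr (hone L) = 0. Proof. exact: (IE.2 [::]). Qed.

Lemma lam_contr_cons v x : lam_contr (lam1 v ** x) = t v ⋆ e x - e (lam1 v) ⋆ lam_contr x.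
Proof.
have il := lam_contr_lin; have bm := @lam_mul_bilin k V.
move: x; on_words => w.
by rewrite -lam_cons [LHS]IE.2 /lam_contr IE.2.
Qed.

Lemma lam_contr_lam1 v : lam_contr (lam1 v) = t v.
Proof.
rewrite -{1}(hmulr1 (@lam_graded_algebra k V) (lam1 v)) lam_contr_cons lam_contr1.
by rewrite (linE0 (bilin_r _ bO)) subr0 e1 (hmulr1 Oal).
Qed.

Lemma lam_contrM (x z : L) : lam_contr (x ** z)
  = lam_contr x ⋆ e z + e (parityS (@hcomp k L) x) ⋆ lam_contr z.
Proof.
exact: (skew_derivationM (@lam_graded k V) (@lam_graded_algebra k V) Oal e_lin e1 eM
  (@lam_ind_ext k V) (@lam1_comp k V) lam_contr_lin lam_contr1 lam_contr_cons).
Qed.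

End ContractionOnExterior.

Lemma uin_lie (k : fieldType) (g : lieAlgType k) (x y : g) :
  uin (lie x y) = hmul (uin x : Uenv g) (uin y) - hmul (uin y : Uenv g) (uin x) :> Uenv g.
Proof.
have h : pword (@env_rel k g) [:: x; y] = pword (@env_rel k g) [:: y; x] + uin (lie x y).
  exact: (env_word_lie [::] [::] x y).
rewrite [hmul (uin x : Uenv g) _](env_mulE [:: x] [:: y]).
by rewrite [hmul (uin y : Uenv g) _](env_mulE [:: y] [:: x]) h addrAC subrr add0r.
Qed.

Section OmegaAlgebra.
Variables (k : fieldType) (g : lieAlgType k) (V : lmodType k) (act : V -> g -> V).
Hypothesis hact : right_module act.
Local Notation A := (Uenv g).
Local Notation L := (Lam V).
Local Notation O := (Omega act).
Local Notation "a ** b" := (@hmul k A a b) (at level 37, left associativity).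
Local Notation "a *** b" := (@hmul k L a b) (at level 37, left associativity).
Local Notation "s ⋆ t" := (@hmul k O s t) (at level 37, left associativity).
Local Notation "𝟙A" := (hone A).
Local Notation "𝟙L" := (hone L).
Local Notation "𝟙" := (hone O).
(** From here the data and equations of the abstract cross product are instantiated, under the names
    they have there. *)
Let iA : g -> A := @uin k g.
Let la : V -> L := @lam1 k V.
Let D : L -> g -> L := gact act.
Let SA : A -> A := @pantipode k g (@env_rel k g) 0.
Let SL : L -> L := @lam_antipode k V.
Let ocomp := @hcomp k O.
Let omul := @hmul k O.
Let oone := @hone k O.
Let ocop := @hcop k O.
Let ocou := @hcou k O.
Let hgact := gact_right_module hact.

Let Agr := @env_graded k g.
Let Aal := @env_graded_algebra k g.
Let A0 := @env_comp0 k g.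
Let A_gen : forall a : A,
  span (fun y => exists n, gword (fun n z => n = 0%N /\ exists x, z = iA x) n y) a :=
  @prim_generated k g (@env_rel k g) 0.
Let Acop_lin := @env_cop_lin k g.
Let Acop1 := @env_cop1 k g.
Let AcopM := @env_copM k g.
Let Acop_iA := @env_cop_uin k g.
Let Acou_lin := @env_cou_lin k g.
Let Acou1 := @env_cou1 k g.
Let AcouM := @env_couM k g.
Let Acou_iA := @env_cou_uin k g.
Let Acounitr (a : A) : tliftS (fun b c : A => hcou c *: b) (hcop a) = a.
Proof.
have [_ _ [_ _ _ h _] _ _] := @env_super_hopf k g.
by have [_] := h a; rewrite tliftSE.
Qed.
Let SA_lin : linear SA. Proof. exact: (pliftE (@env_antipode k g)).1. Qed.
Let SA1 : SA 𝟙A = 𝟙A.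
Proof. by rewrite [LHS]((pliftE (@env_antipode k g)).2 [::]) /pSw scale1r. Qed.
Let SAM a x : SA (a ** iA x) = - (iA x ** SA a).
Proof.
have h : prim_gen (R := @env_rel k g) (e := 0) 0 (iA x) by split; [|exists x].
exact: (prim_SM (@env_comp k g) (@env_antipode k g) a h).
Qed.
Let Lgr := @lam_graded k V.
Let Lal := @lam_graded_algebra k V.
Let la_comp := @lam1_comp k V.
Let L_gen : forall a : L,
  span (fun y => exists n, gword (fun n z => n = 1%N /\ exists v, z = la v) n y) a :=
  @prim_generated k V (@Bminus_rel k V) 1.
Let Lcop_lin := @lam_cop_lin k V.
Let Lcop1 := @lam_cop1 k V.
Let LcopM := @lam_copM k V.
Let Lcop_la := @lam_cop_lam1 k V.
Let Lcou_lin := @lam_cou_lin k V.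
Let Lcou1 := @lam_cou1 k V.
Let LcouM := @lam_couM k V.
Let Lcou_la := @lam_cou_lam1 k V.
Let SL_lin : linear SL := @lam_antipode_lin k V.
Let SL1 : SL 𝟙L = 𝟙L := @lam_antipode1 k V.
Let SLM : forall s v, SL (s *** la v) = - (la v *** parityn (@hcomp k L) 1 (SL s)) :=
  @lam_antipodeM k V.
Let D_lin x : linear (fun e => D e x) := bilin_l x hgact.1.
Let D1 : forall x, D 𝟙L x = 0 := gact_one hact.
Let DM : forall a b x, D (a *** b) x = D a x *** b + a *** D b x := gactM hact.
Let D_comp : forall n e x, D (hcomp n e) x = hcomp n (D e x) := gact_comp hact.
Let D_cop := gact_cop hact.
Let D_cou := gact_cou hact.
Let D_SL : forall e x, SL (D e x) = D (SL e) x := gact_antipode hact.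
Let sact : L -> A -> L := lact act.
Let bact : bilin sact := uact_bilin hgact.
Let act1 : forall e, sact e 𝟙A = e := uact1 hgact.
Let actM e a x : sact e (a ** iA x) = D (sact e a) x.
Proof.
by rewrite [LHS](uactM hgact); exact: (uact_uin hgact).
Qed.
Let ocompE n t : ocomp n t = tmapS id (@hcomp k L n) t.
Proof. by rewrite -tmapSE. Qed.
Let omulE s t : omul s t = tliftS (fun a e => tliftS (fun b z =>
  tliftS (fun b1 b2 => (a ** b1) ⊠ (sact e b2 *** z)) (hcop b)) t) s.
Proof. by rewrite -tliftSE -tpureSE. Qed.
Let ooneE : oone = 𝟙A ⊠ 𝟙L. Proof. by rewrite -tpureSE. Qed.
Let ocopE s : ocop s = tliftS (fun a e => tliftS (fun a1 a2 =>
  tliftS (fun e1 e2 => (a1 ⊠ e1) ⊠ (a2 ⊠ e2)) (hcop e)) (hcop a)) s.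
Proof. by rewrite -tliftSE -tpureSE. Qed.
Let ocouE s : ocou s = tliftS (X := k^o) (fun (a : A) (e : L) => hcou a * hcou e) s.
Proof. by rewrite -tliftSE. Qed.

Lemma omega_super_hopf : super_hopf O. Proof. exact: (smash_super_hopf Agr Aal A0 A_gen Acop_lin
  Acop1 AcopM Acop_iA Acou_lin Acou1 AcouM Acou_iA SA_lin SA1 SAM Lgr Lal la_comp L_gen Lcop_lin
    Lcop1 LcopM Lcop_la Lcou_lin Lcou1 LcouM Lcou_la SL_lin SL1 SLM D_lin D1 DM D_comp D_cop
      D_cou D_SL bact act1 actM ocompE omulE ooneE ocopE ocouE). Qed.
Lemma omega_graded : graded (@hcomp k O). Proof. by case: omega_super_hopf. Qed.
Lemma omega_graded_algebra : graded_algebra O. Proof. by case: omega_super_hopf. Qed.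
Lemma omega_one : 𝟙 = 𝟙A ⊠ 𝟙L. Proof. exact: ooneE. Qed.
Lemma omega_compP n (a : A) (e : L) : @hcomp k O n (a ⊠ e) = a ⊠ hcomp n e.
Proof. exact: (smash_compP Lgr omul oone ocop ocou ocompE). Qed.
Lemma omega_mulP_uin (a : A) (e : L) x :
  (a ⊠ e) ⋆ (uin x ⊠ 𝟙L) = a ** uin x ⊠ e + a ⊠ gact act e x.
Proof. exact: (smash_mulP_iA Agr Aal A0 A_gen Acop_lin Acop1 AcopM Acop_iA Lgr Lal D_lin D1 DM
  D_comp bact act1 actM ocop ocou ocompE omulE ooneE). Qed.
Lemma omega_mulP_L (a : A) (e z : L) : (a ⊠ e) ⋆ (𝟙A ⊠ z) = a ⊠ e *** z.
Proof. exact: (smash_mulP_L Aal Acop_lin Acop1 Lal bact act1 ocomp oone ocop ocou omulE). Qed.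
Lemma omega_mul_A (a b : A) (z : L) : (a ⊠ 𝟙L) ⋆ (b ⊠ z) = a ** b ⊠ z.
Proof. exact: (smash_mul_A Agr Aal A0 A_gen Acop_lin Acop1 AcopM Acop_iA Lal D_lin D1 DM bact
  act1 actM ocomp oone ocop ocou omulE). Qed.
Lemma omega_couP (a : A) (e : L) : @hcou k O (a ⊠ e) = hcou a * hcou e.
Proof. exact: (smash_couP Acou_lin Lcou_lin ocomp omul oone ocop ocouE). Qed.
Lemma omega_cop_A (a : A) :
  @hcop k O (a ⊠ 𝟙L) = tmapS (fun a => a ⊠ 𝟙L : O) (fun a => a ⊠ 𝟙L : O) (hcop a).
Proof. exact: (smash_cop_inl Acop_lin Lcop_lin Lcop1 ocomp omul oone ocou ocopE). Qed.
Lemma omega_cop_lam1 v :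
  @hcop k O (𝟙A ⊠ lam1 v) = (𝟙A ⊠ lam1 v) ⊠ 𝟙 + 𝟙 ⊠ (𝟙A ⊠ lam1 v).
Proof. exact: (smash_cop_L Acop_lin Acop1 Lcop_lin ocomp omul ocou ooneE ocopE (@lam_cop_lam1 k
  V v)). Qed.
Lemma omega_derivation_ext (d d' : O -> O) : linear d -> linear d' -> d 𝟙 = d' 𝟙 ->
  super_derivation d -> super_derivation d' ->
  (forall x, d (uin x ⊠ 𝟙L) = d' (uin x ⊠ 𝟙L)) ->
  (forall v, d (𝟙A ⊠ lam1 v) = d' (𝟙A ⊠ lam1 v)) -> forall s, d s = d' s.
Proof.
move=> dl dl' d1 dD dD' dA dL.
apply: (super_derivation_ext (smash_generated Agr Aal A0 A_gen Acop_lin Acop1 AcopM Acop_iA Lgr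
  Lal L_gen D_lin D1 DM D_comp bact act1 actM ocompE omulE ooneE) dl dl' d1 dD dD').
by move=> _ _ [[_ [x ->]]|[_ [v ->]]].
Qed.

Section WoronowiczDifferential.
Variable om : g -> V.
Hypothesis hom : cocycle act om.
Let w (a : A) : L := lam1 (omext act om a).
Let w_lin : linear w.
Proof. have l := @lam1_lin k V; have l' := omext_lin hact hom; rewrite /w; lin. Qed.
Let w1 : w 𝟙A = 0. Proof. exact: etrans (f_equal (@lam1 k V) (omext1 hact hom)) (linE0
  (@lam1_lin k V)). Qed.
Let wM a x : w (a ** iA x) = D (w a) x + hcou a *: w (iA x).
Proof.
rewrite /w (omextM hact hom) (uact_uin hact) (linED (@lam1_lin k V)) (linEZ (@lam1_lin k V)).
by rewrite /D (gact_lam1 hact).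
Qed.
Let w_comp a : hcomp 1 (w a) = w a. Proof. exact: lam1_comp. Qed.
Let w_comm a e : w a *** e = parityS (@hcomp k L) e *** w a. Proof. exact: lam1_comm. Qed.
Let w_cop x : hcop (w (iA x)) = w (iA x) ⊠ 𝟙L + 𝟙L ⊠ w (iA x).
Proof. exact: lam_cop_lam1. Qed.
Let d : O -> O := woronowicz_d act om (fun=> 0).
Let dE s : d s = tliftS (fun a e => tliftS (fun a1 a2 => a1 ⊠ (w a2 *** e)) (hcop a)) s.
Proof.
rewrite /d /woronowicz_d tliftSE tpureSE; apply: eq_tlift => a e.
rewrite tpure0r addr0; apply: eq_tlift => a1 a2.
by rewrite (omext_proj hact hom).
Qed.

Lemma omega_d_lin : linear d. Proof. exact: (smash_d_lin Acop_lin Lal w_lin dE). Qed.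
Lemma omega_d_prim (a : A) (e : L) : hcop a = a ⊠ 𝟙A + 𝟙A ⊠ a ->
  d (a ⊠ e) = 𝟙A ⊠ lam1 (omext act om a) *** e.
Proof. by move=> h; exact: (smash_d_prim Acop_lin Lal w_lin w1 dE e h). Qed.
Lemma omega_d_L (e : L) : d (𝟙A ⊠ e) = 0. Proof. exact: (smash_d_L Acop_lin Acop1 Lal w_lin w1
  dE). Qed.
Lemma omega_d_comp n s : hcomp n.+1 (d (hcomp n s)) = d (hcomp n s).
Proof. exact: (smash_d_comp Acop_lin Lgr Lal ocompE w_lin w_comp dE). Qed.
Lemma omega_d_derivation : super_derivation d. Proof. exact: (smash_d_derivation Agr Aal A0
  A_gen Acop_lin Acop1 AcopM Acop_iA Acou_lin Acounitr Lgr Lal L_gen D_lin D1 DM D_comp bact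
    act1 actM ocompE omulE ooneE w_lin w1 wM w_comm dE). Qed.
Lemma omega_d_coderivation : super_coderivation d.
Proof. exact: (smash_d_coderivation Agr Aal A0 A_gen Acop_lin Acop1 AcopM Acop_iA Acou_lin
  Acounitr Lgr Lal la_comp L_gen Lcop_lin Lcop1 LcopM Lcop_la D_lin D1 DM D_comp D_cop bact act1
    actM ocompE omulE ooneE ocopE w_lin w1 wM w_comp w_comm w_cop dE). Qed.
Lemma omega_d_sq s : d (d s) = 0. Proof. exact: (smash_d_sq Agr Aal A0 A_gen Acop_lin Acop1
  AcopM Acop_iA Acou_lin Acounitr Lgr Lal L_gen D_lin D1 DM D_comp bact act1 actM ocompE omulE
    ooneE w_lin w1 wM w_comp w_comm dE). Qed.

End WoronowiczDifferential.

Section OmegaAugmentation.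
Variable j0 : V -> g.
Hypothesis hj : compatible_map act j0.
Let j v : A := uin (j0 v).
Let t (v : V) : O := j v ⊠ 𝟙L.
Let inL (e : L) : O := 𝟙A ⊠ e.
Let I : L -> O := lam_contr inL t.
Let inL_lin : linear inL. Proof. exact: tpure_linr. Qed.
Let t_lin : linear t.
Proof.
have [jl _ _] := hj; have ul := @uin_lin k g.
rewrite /t /j; lin.
Qed.
Let inL1 : inL 𝟙L = 𝟙. Proof. by rewrite omega_one. Qed.
Let inLM e z : inL (e *** z) = inL e ⋆ inL z. Proof. by rewrite /inL omega_mulP_L. Qed.
(** In the cross product the two sides differ by v <| j0 v, which is zero for a compatible map. *)
Let inL_t v : inL (lam1 v) ⋆ t v = t v ⋆ inL (lam1 v).
Proof.
have [_ _ j0P] := hj.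
have z : gact act (lam1 v) (j0 v) = 0.
  exact: etrans (gact_lam1 hact v (j0 v)) (etrans (f_equal _ (j0P v)) (linE0 (@lam1_lin k V))).
refine (etrans (omega_mulP_uin 𝟙A (lam1 v) (j0 v)) _).
refine (etrans _ (esym (omega_mul_A (uin (j0 v)) 𝟙A (lam1 v)))).
rewrite (hmul1 Aal (uin (j0 v))) (hmulr1 Aal (uin (j0 v))) z.
exact: etrans (f_equal (fun y => uin (j0 v) ⊠ lam1 v + y) (linE0 (@tpure_linr k A L 𝟙A)))
  (addr0 _).
Qed.
Let Oal := omega_graded_algebra.
Let I_lin : linear I := lam_contr_lin Oal inL_lin t_lin inLM inL_t.
Let I1 : I 𝟙L = 0 := lam_contr1 Oal inL_lin t_lin inLM inL_t.
Let IM e z : I (e *** z) = I e ⋆ (𝟙A ⊠ z) + (𝟙A ⊠ parityS (@hcomp k L) e) ⋆ I z.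
Proof. exact: (lam_contrM Oal inL_lin t_lin inL1 inLM inL_t). Qed.
Let I_la v : I (la v) = j v ⊠ 𝟙L := lam_contr_lam1 Oal inL_lin t_lin inL1 inLM inL_t v.
Let j_cop v : hcop (j v) = j v ⊠ 𝟙A + 𝟙A ⊠ j v. Proof. exact: env_cop_uin. Qed.
Let j_equiv v x : I (D (la v) x) = (j v ** iA x - iA x ** j v) ⊠ 𝟙L.
Proof.
have [_ j0M _] := hj.
refine (etrans (f_equal I (gact_lam1 hact v x)) (etrans (I_la (act v x)) _)).
by refine (f_equal (fun a => a ⊠ 𝟙L) _); rewrite /j j0M; exact: uin_lie.
Qed.

Definition omega_aug : O -> O := smash_aug I.

Lemma omega_augmentation : augmentation omega_aug. Proof. exact: (smash_augmentation Agr Aal A0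
  A_gen Acop_lin Acop1 AcopM Acop_iA Lgr Lal la_comp L_gen Lcop_lin Lcop1 LcopM Lcop_la D_lin D1
    DM D_comp D_cop bact act1 actM ocompE omulE ooneE ocopE I_lin I1 IM I_la j_cop j_equiv). Qed.
Lemma omega_aug_lam1 v : omega_aug (𝟙A ⊠ lam1 v) = uin (j0 v) ⊠ 𝟙L.
Proof. exact: (smash_aug_la Agr Aal A0 A_gen Acop_lin Acop1 AcopM Acop_iA Lal D_lin D1 DM bact
  act1 actM omulE I_lin I_la). Qed.

End OmegaAugmentation.
End OmegaAlgebra.

(** * The Poincare-Birkhoff-Witt theorem in degree one *)

Section InsertionSort.
Variables (B : eqType) (le : rel B).
Hypotheses (le_anti : antisymmetric le) (le_trans : transitive le) (le_total : total le).

Definition below (x : B) : pred B := fun t => ~~ le x t.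
(** Insertion by two filters rather than by recursion, because the correction [F] uses precisely
    these two segments of the sorted tail. *)
Definition insert (x : B) (s : seq B) := filter (below x) s ++ x :: filter (le x) s.
Definition isort : seq B -> seq B := foldr insert [::].

Let nle x y : ~~ le x y -> le y x. Proof. by case/orP: (le_total x y) => ->. Qed.

Let below_below x y t : le y x -> below y t -> below x t.
Proof. by move=> yx; apply: contra => /(le_trans yx). Qed.

Lemma insert_below_lt x y s : below x y ->
  filter (below x) (insert y s) = filter (below y) s ++ y :: filter (fun t => le y t && below x
    t) s.
Proof.
move=> xy; have yx := nle xy; rewrite filter_cat /= xy -!filter_predI; congr (_ ++ _ :: _).
  by apply: eq_filter => t /=; apply/andP/idP => [[]//|h]; split=> //; exact: below_below h.
by apply: eq_filter => t /=; rewrite andbC.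
Qed.

Lemma insert_le_lt x y s : below x y -> filter (le x) (insert y s) = filter (le x) s.
Proof.
move=> xy; have yx := nle xy; rewrite filter_cat /= (negbTE xy) -!filter_predI.
rewrite (eq_filter (a2 := pred0)) => [|t /=]; last first.
  by apply/andP => -[xt] /negP; apply; exact: le_trans xt.
rewrite filter_pred0; apply: eq_filter => t /=; apply/andP/idP => [[]//|xt].
by split=> //; exact: le_trans xt.
Qed.

Lemma insert_below_ge x y s : le y x -> filter (below y) (insert x s) = filter (below y) s.
Proof.
move=> yx; rewrite filter_cat /= ifN ?negbK // -!filter_predI.
rewrite [X in _ ++ X](eq_filter (a2 := pred0)) => [|t /=]; last first.
  by apply/andP => -[/negP nyt xt]; apply: nyt; exact: le_trans xt.
rewrite filter_pred0 cats0; apply: eq_filter => t /=.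
by apply/andP/idP => [[]//|h]; split=> //; exact: below_below h.
Qed.

Lemma insert_le_ge x y s : le y x ->
  filter (le y) (insert x s) = filter (fun t => le y t && below x t) s ++ x :: filter (le x) s.
Proof.
move=> yx; rewrite filter_cat /= yx -!filter_predI; congr (_ ++ _ :: _).
by apply: eq_filter => t /=; apply/andP/idP => [[]//|xt]; split=> //; exact: le_trans xt.
Qed.

(** Hence the sorted form of a word is unchanged when two neighbours are exchanged. *)
Lemma insertC x y s : insert x (insert y s) = insert y (insert x s).
Proof.
wlog xy : x y / below x y => [hw|].
  case: (eqVneq x y) => [->//|ne].
  case xy : (below x y); first exact: hw.
  apply/esym/hw/negP => yx; move/negbFE: xy => xy.
  by move/negP: ne; apply; apply/eqP/le_anti; rewrite xy yx.
have yx := nle xy.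
rewrite {1 3}/insert insert_below_lt // insert_le_lt // insert_below_ge // insert_le_ge //.
by rewrite -catA.
Qed.

(** Sortedness in the form in which it is used: the filters cut out an initial and a final
    segment. *)
Lemma isort_split x w : filter (below x) (isort w) ++ filter (le x) (isort w) = isort w.
Proof.
elim: w x => //= y w IH x; set s := isort w in IH *.
case: (boolP (le x y)) => xy.
  rewrite insert_below_ge // insert_le_ge // catA; congr (_ ++ _).
  have /= h := f_equal (filter (below y)) (IH x); rewrite filter_cat -!filter_predI in h.
  rewrite -[RHS]h; congr (_ ++ _); last by apply: eq_filter => t /=; rewrite andbC.
  by apply: eq_filter => t /=; apply/idP/andP => [h'|[]//]; split=> //; exact: below_below h'.
rewrite insert_below_lt // insert_le_lt // -catA /=; congr (_ ++ _ :: _).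
have yx := nle xy; have /= h := f_equal (filter (le y)) (IH x).
rewrite filter_cat -!filter_predI in h.
rewrite -[RHS]h; congr (_ ++ _).
by apply: eq_filter => t /=; apply/idP/andP => [xt|[]//]; split=> //; exact: le_trans xt.
Qed.

Lemma isort_between x y w : below x y -> filter (below x) (isort w)
  = filter (below y) (isort w) ++ filter (fun t => le y t && below x t) (isort w).
Proof.
move=> xy; have yx := nle xy; rewrite -[in LHS](isort_split y w) filter_cat -!filter_predI.
congr (_ ++ _); apply: eq_filter => t /=; last by rewrite andbC.
by apply/andP/idP => [[]//|h]; split=> //; exact: below_below h.
Qed.

Lemma isort_from x y w : le y x -> filter (le y) (isort w)
  = filter (fun t => le y t && below x t) (isort w) ++ filter (le x) (isort w).
Proof.
move=> yx; rewrite -[in LHS](isort_split x w) filter_cat -!filter_predI.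
congr (_ ++ _); apply: eq_filter => t //=.
by apply/andP/idP => [[]//|xt]; split=> //; exact: le_trans xt.
Qed.

Lemma isort_swap u x y v : isort (u ++ x :: y :: v) = isort (u ++ y :: x :: v).
Proof. by elim: u => [|z u /= ->//]; exact: insertC. Qed.

Lemma size_isort w : size (isort w) = size w.
Proof.
elim: w => //= x w <-; rewrite /insert -[in RHS](isort_split x w) !size_cat /=.
by rewrite addnS.
Qed.

End InsertionSort.

Lemma lie_anti (k : fieldType) (g : lieAlgType k) (x y : g) : lie x y = - lie y x.
Proof.
apply/eqP; rewrite -addr_eq0; apply/eqP; have := lie_alt (x + y).
rewrite (linED (lie_linearl _)) !(linED (lie_linearr _)) !lie_alt.
by rewrite add0r addr0.
Qed.

Ltac zcancel x := rewrite ?[_ + x + _]addrAC ?[_ - x + _]addrAC addrK.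

Section StraighteningIdentity.
Variable T : pzRingType.

(** In the application y is below x, a b c are the segments of the sorted tail v cut at y and at x,
    f is its correction, z is the bracket of x and y, and xa, ya, xb, xya, yxa are derivatives. The
    right-hand side is grouped so that each summand contains a factor lying in some [J]. *)
Lemma straightening_identity (x y z a b c f v xa ya xb xya yxa : T) :
  x * (y * f + ya * (b * c)) + ((xa * y + a * z) * b + a * y * xb) * c
    - (y * (x * f + (xa * b + a * xb) * c) + ya * (b * (x * c))) - z * v
  = (x * y - y * x - z) * f + z * (f - v + a * b * c)
    + (x * (ya * b) - ya * b * x - (xya * b + ya * xb)) * c
    - (y * xa - xa * y - yxa) * (b * c) - (y * a - a * y - ya) * (xb * c)
    - (z * a - a * z - (xya - yxa)) * (b * c).
Proof.
apply/eqP; rewrite -subr_eq0; apply/eqP.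
rewrite !(mulrDl, mulrDr, mulNr, mulrN) !(opprD, opprK) !mulrA -[LHS]add0r !addrA.
zcancel (x * y * f). zcancel (y * x * f). zcancel (z * f). zcancel (z * v).
zcancel (z * a * b * c). zcancel (x * ya * b * c). zcancel (ya * b * x * c).
zcancel (xya * b * c). zcancel (ya * xb * c). zcancel (y * xa * b * c).
zcancel (xa * y * b * c). zcancel (yxa * b * c). zcancel (y * a * xb * c).
zcancel (a * y * xb * c).
by rewrite addrK.
Qed.

End StraighteningIdentity.

Section PBW.
Variables (k : fieldType) (g : lieAlgType k) (B : choiceType) (b : B -> g).
Variable co : g -> {malg k[B]}.
Hypotheses (co_lin : linear co) (coK : forall v, flin b (co v) = v).
Hypothesis cob : forall e, co (b e) = << e >>.
Variable le : rel B.
Hypotheses (le_anti : antisymmetric le) (le_trans : transitive le) (le_total : total le).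

(** [T] stands for the free algebra on [B] and is known only through its words. The universal
    property [wl] is a sigma type, so that [D] and [Psi] can be extracted from it. *)
Variables (T : lalgType k) (wd : seq B -> T).
Hypothesis T_scalerAr : forall c (x y : T), c *: (x * y) = x * (c *: y).
Hypotheses (wd1 : wd [::] = 1) (wdM : forall u v, wd u * wd v = wd (u ++ v)).
Hypothesis T_span : forall x, span (fun y => exists w, y = wd w) x.
Hypothesis wl : forall (W : lmodType k) (f : seq B -> W),
  {h : T -> W | linear h & forall w, h (wd w) = f w}.

Local Notation L e := (wd [:: e]).

Let bm : bilin (@GRing.mul T).
Proof.
by split=> [y|x] c u v; [rewrite mulrDl scalerAl|rewrite mulrDr T_scalerAr].
Qed.

Let wd_cons x w : wd (x :: w) = L x * wd w. Proof. by rewrite wdM. Qed.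

Let T_ext (W : lmodType k) (f h : T -> W) : linear f -> linear h ->
  (forall w, f (wd w) = h (wd w)) -> forall t, f t = h t.
Proof. by move=> lf lh e t; apply: span_ext (T_span t) => // _ [w ->]. Qed.

Let flin_lin (W : lmodType k) (f : B -> W) : linear (flin f). Proof. exact: flin_linear. Qed.

Let g_ind (P : g -> Prop) : P 0 -> (forall c x y, P x -> P y -> P (c *: x + y)) ->
  (forall e, P (b e)) -> forall v, P v.
Proof.
move=> P0 PS Pb v; rewrite -(coK v); elim: (malg_span (co v)) => [|c _ y [m ->] _ IH].
  by rewrite (linE0 (flin_lin b)).
by rewrite (flin_lin b); apply: PS => //; rewrite flinU.
Qed.

Let j (v : g) : T := flin (fun e => L e) (co v).
Let j_lin : linear j.
Proof. have fl := flin_lin (fun e => L e); rewrite /j; lin. Qed.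
Let j_b e : j (b e) = L e. Proof. by rewrite /j cob flinU. Qed.

Let dg (n : nat) : T -> Prop := span (fun t => exists2 w, (size w <= n)%N & t = wd w).

(* The combinations of relators of length at most [n]; a single ideal would not do,
   as the induction is on this length. *)
Let J (n : nat) : T -> Prop := span (fun t => exists u x y v, (size u + size v + 2 <= n)%N /\
  t = wd u * (L x * L y - L y * L x - j (lie (b x) (b y))) * wd v).

Let JD n x y : J n x -> J n y -> J n (x + y). Proof. exact: spanD. Qed.
Let JB n x y : J n x -> J n y -> J n (x - y). Proof. exact: spanB. Qed.

Let dg_mono m n t : (m <= n)%N -> dg m t -> dg n t.
Proof.
by move=> mn; apply: span_mono => _ [w h ->]; exists w => //; exact: leq_trans mn.
Qed.

Let J_mono m n t : (m <= n)%N -> J m t -> J n t.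
Proof.
move=> mn; apply: span_mono => _ [u [x [y [v [h ->]]]]]; exists u, x, y, v.
by split=> //; exact: leq_trans mn.
Qed.

Let dg_wd w n : (size w <= n)%N -> dg n (wd w).
Proof. by move=> h; apply: span_incl; exists w. Qed.

Let dgM m n s t : dg m s -> dg n t -> dg (m + n) (s * t).
Proof.
move=> ds dt; have l1 := bilin_l t bm.
apply: (span_lin l1 _ ds) => _ [u hu ->].
apply: (span_lin (bilin_r (wd u) bm) _ dt) => _ [v hv ->].
by rewrite wdM; apply: dg_wd; rewrite size_cat leq_add.
Qed.

Let dg_j v : dg 1 (j v).
Proof.
move: v; apply: g_ind => [|c x y hx hy|e]; last by rewrite j_b; exact: dg_wd.
  by rewrite (linE0 j_lin); exact: span0.
by rewrite j_lin; exact: spanZD.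
Qed.

Let J_mull m n s t : dg m s -> J n t -> J (m + n) (s * t).
Proof.
move=> ds Jt; apply: (span_lin (bilin_l t bm) _ ds) => _ [u hu ->].
apply: (span_lin (bilin_r (wd u) bm) _ Jt) => _ [u' [x [y [v [h ->]]]]].
apply: span_incl; exists (u ++ u'), x, y, v; split; last by rewrite -wdM !mulrA.
by rewrite size_cat -!addnA leq_add // addnA.
Qed.

Let J_mulr m n s t : dg m s -> J n t -> J (n + m) (t * s).
Proof.
move=> ds Jt; apply: (span_lin (bilin_r t bm) _ ds) => _ [v hv ->].
apply: (span_lin (bilin_l (wd v) bm) _ Jt) => _ [u [x [y [v' [h ->]]]]].
apply: span_incl; exists u, x, y, (v' ++ v); split; last by rewrite -wdM !mulrA.
by rewrite size_cat addnA addnAC leq_add.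
Qed.

Let J_lie x y : J 2 (j x * j y - j y * j x - j (lie x y)).
Proof.
move: x; apply: g_ind => [|c x x' hx hx'|e].
- rewrite (linE0 j_lin) mul0r mulr0 (linE0 (lie_linearl _)) (linE0 j_lin) !subr0.
  exact: span0.
- have l : linear (fun x => j x * j y - j y * j x - j (lie x y)).
    by have ll := @lie_linearl k g y; lin.
  by rewrite l; exact: spanZD.
move: y; apply: g_ind => [|c x x' hx hx'|e'].
- rewrite (linE0 j_lin) mul0r mulr0 (linE0 (lie_linearr _)) (linE0 j_lin) !subr0.
  exact: span0.
- have l : linear (fun y => j (b e) * j y - j y * j (b e) - j (lie (b e) y)).
    by have ll := @lie_linearr k g (b e); lin.
  by rewrite l; exact: spanZD.
apply: span_incl; exists [::], e, e', [::]; split=> //.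
by rewrite wd1 mul1r mulr1 !j_b.
Qed.

(** The derivation of the free algebra extending the adjoint action of [z]. *)
Let Dw (z : g) : seq B -> T :=
  fix Dw w := if w is e :: w' then j (lie z (b e)) * wd w' + L e * Dw w' else 0.
Let D (z : g) : T -> T := s2val (wl (Dw z)).
Let D_lin z : linear (D z). Proof. exact: s2valP. Qed.
Let D_wd z w : D z (wd w) = Dw z w. Proof. exact: (s2valP' (wl (Dw z))). Qed.

Let D_cons z e w : D z (wd (e :: w)) = j (lie z (b e)) * wd w + L e * D z (wd w).
Proof. by rewrite !D_wd. Qed.

Let D_mul z s t : D z (s * t) = D z s * t + s * D z t.
Proof.
have Dl := D_lin z; move: s; refine (T_ext _ _ _); [lin|lin|] => u.
have z1 : D z 1 = 0 by rewrite -wd1 D_wd.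
have h e s : D z (L e * s) = j (lie z (b e)) * s + L e * D z s.
  by move: s; refine (T_ext _ _ _); [lin|lin|] => w; rewrite -wd_cons D_cons.
elim: u => [|e u IH]; first by rewrite wd1 !mul1r z1 mul0r add0r.
by rewrite wd_cons -mulrA !h IH mulrDl mulrDr !mulrA addrA.
Qed.

Let D_L z e : D z (L e) = j (lie z (b e)).
Proof. by rewrite D_cons D_wd wd1 /= mulr1 mulr0 addr0. Qed.

Let D_j z y : D z (j y) = j (lie z y).
Proof.
have Dl := D_lin z; have ll := @lie_linearr k g z.
move: y; apply: g_ind => [|c x x' hx hx'|e]; last by rewrite j_b D_L.
  by rewrite (linE0 j_lin) (linE0 Dl) (linE0 ll) (linE0 j_lin).
by rewrite j_lin Dl hx hx' ll j_lin.
Qed.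

Let D_dg n z t : dg n t -> dg n (D z t).
Proof.
move=> dt; apply: (span_lin (D_lin z) _ dt) => _ [w hw ->].
elim: w n {dt t} hw => [|e w IH] n hw; first by rewrite D_wd; exact: span0.
rewrite D_cons; case: n hw => // n hw; rewrite -add1n.
by apply: spanD; apply: dgM; [exact: dg_j|exact: dg_wd|exact: dg_wd|exact: IH].
Qed.

(** Moving [z] past one letter costs one relator, whose context consists of the other letters; hence
    the bound n + 1. *)
Let D_comm n z t : dg n t -> J n.+1 (j z * t - t * j z - D z t).
Proof.
have Dl := D_lin z.
have l : linear (fun t => j z * t - t * j z - D z t).
  exact: (lin_D (lin_D (bilin_r (j z) bm) (lin_N (bilin_l (j z) bm))) (lin_N Dl)).
move=> dt; refine (span_lin l _ dt) => _ [w hw ->] {dt t}; rewrite -/(J _ _).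
elim: w n hw => [|e w IH] n hw.
  by rewrite D_wd wd1 mulr1 mul1r subrr subr0; exact: span0.
have -> : j z * wd (e :: w) - wd (e :: w) * j z - D z (wd (e :: w))
   = (j z * L e - L e * j z - j (lie z (b e))) * wd w + L e * (j z * wd w - wd w * j z - D z (wd
     w)).
  rewrite D_cons wd_cons !(mulrBl, mulrBr) !mulrA opprD !addrA; congr (_ - _).
  by rewrite [LHS]addrAC; congr (_ - _); rewrite [RHS]addrAC addrNK.
case: n hw => // n hw; apply: JD.
  by rewrite -add2n; apply: J_mulr; [exact: dg_wd|rewrite -j_b; exact: J_lie].
by rewrite -add1n; apply: J_mull; [exact: dg_wd|exact: IH].
Qed.

(** The Jacobi identity on letters, extended by the Leibniz rule. This is the place where the Jacobi
    identity enters the theorem on U(g). *)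
Let D_lie x y t : D (lie x y) t = D x (D y t) - D y (D x t).
Proof.
have Dx := D_lin x; have Dy := D_lin y; have Dxy := D_lin (lie x y).
move: t; refine (T_ext _ _ _); [lin|lin|]; elim=> [|e w IH].
  have z u : D u (wd [::]) = 0 by rewrite D_wd.
  by rewrite !z (linE0 Dx) (linE0 Dy) subrr.
rewrite !D_cons (linED Dx) (linED Dy) !D_mul !D_L !D_j IH.
have jac : lie (lie x y) (b e) = lie x (lie y (b e)) - lie y (lie x (b e)).
  have := lie_jacobi x y (b e).
  rewrite (lie_anti (b e) (lie x y)) (lie_anti (b e) x) (linEN (lie_linearr _)).
  by move/eqP; rewrite subr_eq0 => /eqP ->.
rewrite jac (linEB j_lin) mulrBl mulrBr.
apply/eqP; rewrite -subr_eq0; apply/eqP; rewrite !(opprD, opprK) -[LHS]add0r !addrA.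
zcancel (j (lie x (lie y (b e))) * wd w). zcancel (j (lie y (lie x (b e))) * wd w).
zcancel (j (lie y (b e)) * D x (wd w)). zcancel (j (lie x (b e)) * D y (wd w)).
zcancel (L e * D x (D y (wd w))). by rewrite addrNK.
Qed.

Local Notation low x := (below le x).
Local Notation srt := (isort le).

(* Modulo [J (size w)], the word [w] is the sum of its sorted rearrangement and of
   [F w], which has smaller degree. *)
Let F : seq B -> T := fix F w := if w is x :: w' then
  L x * F w' + D (b x) (wd (filter (low x) (srt w'))) * wd (filter (le x) (srt w')) else 0.

Let F_cons x w : F (x :: w) =
  L x * F w + D (b x) (wd (filter (low x) (srt w))) * wd (filter (le x) (srt w)).
Proof. by []. Qed.
Let srt_cons x w : srt (x :: w) = filter (low x) (srt w) ++ x :: filter (le x) (srt w).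
Proof. by []. Qed.

Let F_dg w n : (size w <= n.+1)%N -> dg n (F w).
Proof.
elim: w n => [|x w IH] n hw; first exact: span0.
apply: spanD.
  case: w hw IH => [|y w] hw IH; first by rewrite mulr0; exact: span0.
  by case: n hw => // n hw; rewrite -add1n; apply: dgM; [exact: dg_wd|exact: IH].
have h := size_isort le_trans le_total w.
rewrite -(isort_split le_trans le_total x) size_cat in h.
apply: (@dg_mono (size (filter (low x) (srt w)) + size (filter (le x) (srt w)))).
  by rewrite h.
by apply: dgM; [apply: D_dg|]; exact: dg_wd.
Qed.

(** The tail is sorted first; moving the head past the smaller letters then costs its derivation of
    that segment. *)
Let F_sort w n : (size w <= n)%N -> J n (F w - wd w + wd (srt w)).
Proof.
elim: w n => [|x w IH] n hw; first by rewrite sub0r addNr; exact: span0.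
case: n hw => // n hw; have := size_isort le_trans le_total w.
have es := isort_split le_trans le_total x w.
rewrite -es size_cat => h.
rewrite F_cons srt_cons (wd_cons x w) -wdM (wd_cons x (filter _ _)).
have IHw := IH _ hw; rewrite -(f_equal wd es) -wdM in IHw.
set s1 := filter (low x) _ in h IHw *; set s2 := filter (le x) _ in h IHw *.
have -> : L x * F w + D (b x) (wd s1) * wd s2 - L x * wd w + wd s1 * (L x * wd s2)
    = L x * (F w - wd w + wd s1 * wd s2)
      - (j (b x) * wd s1 - wd s1 * j (b x) - D (b x) (wd s1)) * wd s2.
  rewrite j_b !(mulrDl, mulrDr, mulNr, mulrN) !mulrA.
  apply/eqP; rewrite -subr_eq0; apply/eqP; rewrite !(opprD, opprK) -[LHS]add0r !addrA.
  zcancel (L x * F w). zcancel (D (b x) (wd s1) * wd s2). zcancel (L x * wd s1 * wd s2).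
  zcancel (wd s1 * L x * wd s2). by rewrite addrNK.
apply: JB; first by rewrite -add1n; apply: J_mull; [exact: dg_wd|].
apply: (@J_mono ((size s1).+1 + size s2)); first by rewrite addSn h.
by apply: J_mulr; [exact: dg_wd|apply: D_comm; exact: dg_wd].
Qed.

(** The point is the bound: relators of length size v + 1 suffice although the words have length
    size v + 2. *)
Let F_swap_lt x y v n : low x y -> (size v < n)%N ->
  J n (F (x :: y :: v) - F (y :: x :: v) - j (lie (b x) (b y)) * wd v).
Proof.
move=> xy hv; have yx : le y x by have := le_total x y; rewrite (negbTE (xy : ~~ le x y)).
have := size_isort le_trans le_total v.
have es := isort_split le_trans le_total x v.
have eb := isort_between le_trans le_total v xy.
rewrite -es eb !size_cat => hs; rewrite eb in es.
rewrite !F_cons [srt (y :: v)]/= [srt (x :: v)]/= (insert_below_lt le_trans le_total) //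
  (insert_le_lt le_trans le_total) //.
rewrite (insert_below_ge le_trans) // (insert_le_ge le_trans) //.
rewrite (isort_from le_trans le_total v yx) eb.
move: es hs; set a := filter (low y) _; set m := filter _ (srt v).
set c := filter (le x) _ => es hs.
rewrite -(cat_rcons y a m) -cats1 -!wdM (wd_cons x c) !D_mul D_L -!j_b.
rewrite (straightening_identity _ _ _ _ _ _ _ _ _ _ _
  (D (b x) (D (b y) (wd a))) (D (b y) (D (b x) (wd a)))).
have da := dg_wd (leqnn (size a)); have dm := dg_wd (leqnn (size m)).
have dc := dg_wd (leqnn (size c)); have dmc := dgM dm dc.
have le1 : ((size a).+1 + (size m + size c) <= n)%N by rewrite addSn addnA hs.
have le2 : ((size a + size m).+1 + size c <= n)%N by rewrite addSn hs.
apply: JB; last first.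
  (* Because [D] is a Lie action, the last bracket is the commutator defect of the single element
     [lie (b x) (b y)]. *)
  by rewrite -D_lie; apply: (J_mono le1); apply: J_mulr => //; exact: D_comm.
apply: JB; last first.
  by apply: (J_mono le1); apply: J_mulr; [apply: dgM => //; exact: D_dg|exact: D_comm].
apply: JB; last first.
  by apply: (J_mono le1); apply: J_mulr => //; apply: D_comm; exact: D_dg.
apply: JD; last first.
  rewrite -D_mul; apply: (J_mono le2); apply: J_mulr => //; apply: D_comm.
  by apply: dgM => //; exact: D_dg.
apply: JD; last first.
  by apply: (J_mono hv); rewrite !wdM es -add1n; apply: J_mull; [exact: dg_j|exact: F_sort].
(* The relator of length 2 fits the bound only because the correction of a nonempty word is shorter
   than the word; for the empty word it is zero. *)
case: v hv {eb hs es a m c da dm dc dmc le1 le2} => [|t v] hv.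
  by rewrite mulr0; exact: span0.
by apply: (J_mono hv); rewrite -[(size _).+1]/(2 + size v)%N; apply: J_mulr; [exact: F_dg|exact:
  J_lie].
Qed.

Let F_swap u x y v n : (size u + size v < n)%N ->
  J n (F (u ++ x :: y :: v) - F (u ++ y :: x :: v) - wd u * j (lie (b x) (b y)) * wd v).
Proof.
elim: u n => [|z u IH] n hn; last first.
  case: n hn => // n hn; rewrite !cat_cons !F_cons.
  (* The second summand of [F] depends on the tail only through its sorted form, so it is the same
     for both words and cancels. *)
  rewrite (isort_swap le_anti le_trans le_total u x y v).
  have -> (p q r s t : T) : L z * p + q - (L z * r + q) - wd (z :: u) * s * t
      = L z * (p - r - wd u * s * t).
    by rewrite (wd_cons z u) !mulrBr !mulrA opprD addrACA subrr addr0.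
  by rewrite -add1n; apply: J_mull; [exact: dg_wd|exact: IH].
rewrite wd1 mul1r /=; case: (eqVneq x y) => [->|ne].
  by rewrite subrr lie_alt (linE0 j_lin) mul0r subr0; exact: span0.
case xy : (low x y); first exact: F_swap_lt.
have yx : low y x.
  apply/negP => yx; move/negbFE: xy => xy.
  by move/negP: ne; apply; apply/eqP/le_anti; rewrite xy yx.
have := F_swap_lt yx hn; move/(@spanN _ _ _ _); congr (J n _).
by rewrite (lie_anti (b x) (b y)) (linEN j_lin) mulNr opprK !opprB addrC.
Qed.

(* [Psi n] maps [J n] into [J n.-1] and fixes the words shorter than [n], so that
   elements of [J n] of degree one descend to [J 1 = 0]. *)
Let Psi n : T -> T := s2val (wl (fun w => if size w == n then F w else wd w)).
Let Psi_lin n : linear (Psi n). Proof. exact: s2valP. Qed.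
Let Psi_wd n w : Psi n (wd w) = if size w == n then F w else wd w.
Proof. exact: (s2valP' (wl _)). Qed.

Let Psi_dg n t : dg n t -> Psi n.+1 t = t.
Proof.
move=> dt; have pl := Psi_lin n.+1; apply: (span_ext pl (@lin_id _ _) _ dt) => _ [w hw ->].
by rewrite Psi_wd ltn_eqF.
Qed.

Let Psi_J n t : J n.+1 t -> J n (Psi n.+1 t).
Proof.
move=> Jt; apply: (span_lin (Psi_lin n.+1) _ Jt) => _ [u [x [y [v [h ->]]]]].
have dj : dg (size u + 1 + size v) (wd u * j (lie (b x) (b y)) * wd v).
  by apply: dgM; [apply: dgM; [exact: dg_wd|exact: dg_j]|exact: dg_wd].
case: (ltngtP (size u + size v + 2) n.+1) h => // [lt|e] _.
  rewrite Psi_dg; first by apply: span_incl; exists u, x, y, v.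
  rewrite mulrBr mulrBl; apply: spanB; last first.
    by apply: dg_mono dj; move: lt; rewrite ltnS; apply: leq_trans; rewrite addnAC leq_add2l.
  rewrite mulrBr mulrBl -!wd_cons !wdM; apply: spanB.
    by apply: dg_wd; rewrite -catA size_cat /= !addnS; move: lt; rewrite addn2 ltnS.
  by apply: dg_wd; rewrite -catA size_cat /= !addnS; move: lt; rewrite addn2 ltnS.
have pl := Psi_lin n.+1.
have -> : wd u * (L x * L y - L y * L x - j (lie (b x) (b y))) * wd v
    = wd (u ++ x :: y :: v) - wd (u ++ y :: x :: v) - wd u * j (lie (b x) (b y)) * wd v.
  by rewrite !mulrBr !mulrBl !wdM -!catA.
rewrite (linEB pl) (linEB pl) !Psi_wd !size_cat /= !addnS -(addn2 (size u + size v)) e eqxx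
  Psi_dg.
  by apply: F_swap; move: e; rewrite addn2 => -[<-].
by apply: dg_mono dj; rewrite addnAC addn1; move: e; rewrite addn2 => -[<-].
Qed.

Let J_dg1 n t : J n t -> dg 1 t -> t = 0.
Proof.
have J1 m s : (m <= 1)%N -> J m s -> s = 0.
  move=> hm; elim=> // c y z [u [x [x' [v [h _]]]]].
  by move: (leq_trans h hm); rewrite addn2.
elim: n t => [|[|n] IH] t Jt dt; [exact: J1 Jt|exact: J1 Jt|].
have e : Psi n.+2 t = t by apply: Psi_dg; exact: dg_mono dt.
by apply: IH => //; rewrite -e; exact: Psi_J.
Qed.

Let j_inj v : j v = 0 -> v = 0.
Proof.
have [h hl hE] := wl (fun w => if w is [:: e] then b e else 0).
move=> jv; rewrite -(coK v) -(linE0 hl) -jv.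
have fl := flin_lin (fun e => L e); have fb := flin_lin b.
rewrite /j; move: (co v); refine (malg_ext _ _ _); [lin|lin|] => e.
by rewrite !flinU hE.
Qed.

(** The algebra map from the free algebra on the set [g] to the one on a basis; it sends the linear
    relators to zero and the Lie relators into [J 2]. *)
Let thw : seq g -> T := foldr (fun v t => j v * t) 1.
Let th : falg k g -> T := wlin thw.
Let th_lin : linear th := wlin_lin thw.

Let thM a c : th (a * c) = th a * th c.
Proof.
have fm := @falg_mul_bilin k g.
move: a; refine (falg_ext (lin_comp th_lin (bilin_l c fm)) (lin_comp (bilin_l (th c) bm) th_lin)
  _).
move=> u; move: c; refine (falg_ext (lin_comp th_lin (bilin_r _ fm)) (lin_comp (bilin_r _ bm)
  th_lin) _).
move=> v; rewrite fword_mul /th !wlinE.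
by elim: u => [|x u /= ->]; [rewrite mul1r|rewrite mulrA].
Qed.

Let th_word v : th (fword k [:: v]) = j v. Proof. by rewrite /th wlinE /= mulr1. Qed.

Let J_eq3 n p q s p' q' s' : p = p' -> q = q' -> s = s' -> J n (p' - q' - s') ->
  J n (p - q - s).
Proof. by move=> -> -> ->. Qed.

Let th_ideal a : ideal (@env_rel k g) a -> exists n, J n (th a).
Proof.
move: a; refine (span_ind (P := fun a => exists n, J n (th a)) _ _ _)
  => [|c x y [m hm] [n hn]|_ [u r v Rr]].
- by exists 0%N; rewrite (linE0 th_lin); exact: span0.
- exists (maxn m n); rewrite th_lin; apply: spanZD.
    exact: J_mono (leq_maxl _ _) hm.
  exact: J_mono (leq_maxr _ _) hn.
have dgT t : exists n, dg n t.
  elim: (T_span t) => [|c _ y [w ->] _ [n hn]]; first by exists 0%N; exact: span0.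
  exists (maxn (size w) n); apply: spanZD; first by apply: dg_wd; exact: leq_maxl.
  exact: dg_mono (leq_maxr _ _) hn.
have [m hm] := dgT (th u); have [n hn] := dgT (th v).
exists (m + 2 + n)%N; rewrite !thM; apply: J_mulr => //; apply: J_mull => //.
have tm x y : th (fword k [:: x; y]) = j x * j y.
  rewrite -(th_word x) -(th_word y) -(thM (fword k [:: x]) (fword k [:: y])).
  exact: (f_equal th (esym (@fword_mul k g [:: x] [:: y]))).
have e p q s : th (p - q - s) = th p - th q - th s.
  exact: etrans (linEB th_lin _ _) (f_equal (fun t => t - th s) (linEB th_lin p q)).
case: Rr => [_ [c x y]|x y]; refine (@eq_ind_r T _ (J 2) _ _ (e _ _ _)).
  refine (J_eq3 (th_word _) (etrans (linEZ th_lin c _) (f_equal _ (th_word x))) (th_word y) _).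
  by rewrite j_lin [_ + j y]addrC addrK subrr; exact: span0.
exact: (J_eq3 (tm x y) (tm y x) (th_word (lie x y)) (J_lie x y)).
Qed.

(** If v and v' agree in U(g), then j (v - v') lies in some [J n] and has degree one, so it is zero
    by [J_dg1]. *)
Lemma uin_inj_of_basis : injective (@uin k g).
Proof.
move=> v v' /qpiE h; apply/eqP; rewrite -subr_eq0; apply/eqP/j_inj.
have [n hn] := th_ideal h; apply: (J_dg1 (n := n)); last exact: dg_j.
rewrite (linEB j_lin); refine (eq_ind _ (J n) hn _ _).
exact: etrans (linEB th_lin _ _) (f_equal2 (fun p q => p - q) (th_word v) (th_word v')).
Qed.

End PBW.

Lemma uin_inj (k : fieldType) (g : lieAlgType k) : injective (@uin k g).
Proof.
have [B [b [co [cl coK cob]]]] := basis_exists g.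
have [le wo] := well_ordering_principle B.
(* Unique least elements are all that is given; totality and antisymmetry are read off from pairs,
   transitivity from triples. *)
have le_total : total le.
  move=> x y; have [|z [[zP zm] _]] := wo (pred2 x y); first by exists x; rewrite !inE eqxx.
  have xP : x \in pred2 x y by rewrite !inE eqxx.
  have yP : y \in pred2 x y by rewrite !inE eqxx orbT.
  by move: zP (zm x xP) (zm y yP); rewrite !inE => /orP[/eqP -> _ ->//|/eqP -> -> _]; rewrite
    orbT.
have le_anti : antisymmetric le.
  move=> x y /andP[xy yx]; have [|z [_ zu]] := wo (pred2 x y); first by exists x; rewrite !inE
    eqxx.
  have refl t : le t t by have := le_total t t; rewrite orbb.
  have <- : z = x.
    by apply: zu; split=> [|t]; rewrite !inE ?eqxx // => /orP[/eqP->|/eqP->].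
  by apply: zu; split=> [|t]; rewrite !inE ?eqxx ?orbT // => /orP[/eqP->|/eqP->].
have le_trans : transitive le.
  move=> y x z xy yz; have [|t [[tP tm] _]] := wo (pred3 x y z); first by exists x; rewrite !inE
    eqxx.
  have xP : x \in pred3 x y z by rewrite !inE eqxx.
  have yP : y \in pred3 x y z by rewrite !inE eqxx orbT.
  have zP : z \in pred3 x y z by rewrite !inE eqxx !orbT.
  move: tP (tm x xP) (tm y yP) (tm z zP); rewrite !inE => /or3P[/eqP-> _ _ //|/eqP e|/eqP e].
    by rewrite e => yx _ _; rewrite (le_anti x y) ?xy.
  by rewrite e => _ zy _; rewrite -(le_anti y z) ?yz.
have fword1 : fword k ([::] : seq B) = 1.
  rewrite -[LHS]mulr1; move: (1 : falg k B); have bm := @falg_mul_bilin k B.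
  by refine (falg_ext (bilin_r _ bm) (@lin_id _ _) _) => w; rewrite fword_mul.
have wl (W : lmodType k) (f : seq B -> W) :
    {h : falg k B -> W | linear h & forall w, h (fword k w) = f w}.
  by exists (wlin f); [exact: wlin_lin|exact: wlinE].
exact: (uin_inj_of_basis cl coK cob le_anti le_trans le_total (T := (falg k B : lalgType k)) (wd
  := @fword k B)
  (@falg_scalerAr k B) fword1 (@fword_mul k B) (@falg_span k B) wl).
Qed.

(** * Primitive elements in characteristic zero *)

Section PrimitiveElements.
Variables (k : fieldType) (g : lieAlgType k) (A : superHopfData k) (iA : g -> A) (wd : seq g ->
  A).
Local Notation "a ** b" := (@hmul k A a b) (at level 37, left associativity).
Local Notation "𝟙" := (hone A).
Local Notation TA := (tmulS (@hcomp k A) (@hmul k A)).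
Hypotheses (Agr : graded (@hcomp k A)) (Aal : graded_algebra A).
Hypotheses (iA_lin : linear iA) (wd1 : wd [::] = 𝟙).
Hypothesis wd_cons : forall x w, wd (x :: w) = iA x ** wd w.
Hypothesis A_span : forall a, span (fun y => exists w, y = wd w) a.
Hypothesis iA_lie : forall x y, iA x ** iA y - iA y ** iA x = iA (lie x y).
Hypotheses (cop_lin : linear (@hcop k A)) (cop1 : hcop 𝟙 = 𝟙 ⊠ 𝟙).
Hypothesis cop_cons : forall x w, hcop (wd (x :: w)) = TA (iA x ⊠ 𝟙 + 𝟙 ⊠ iA x) (hcop (wd w)).
Hypothesis TA_pure : forall a b c d, TA (a ⊠ b) (c ⊠ d) = a ** c ⊠ b ** d.
Hypotheses (cou_lin : linear (fun a : A => hcou a : k^o)) (cou1 : hcou 𝟙 = 1).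
Hypothesis cou_iA : forall x, hcou (iA x) = 0.

Let bA : bilin (@hmul k A). Proof. by case: Aal. Qed.
Let bTA : bilin TA := tmul_bilin Agr bA.

Let fil n : A -> Prop := span (fun a => exists2 w, (size w <= n)%N & a = wd w).

Let fil_mono m n a : (m <= n)%N -> fil m a -> fil n a.
Proof.
by move=> mn; apply: span_mono => _ [w h ->]; exists w => //; exact: leq_trans mn.
Qed.

Let fil_wd w n : (size w <= n)%N -> fil n (wd w).
Proof. by move=> h; apply: span_incl; exists w. Qed.

Let fil_iA x n a : fil n a -> fil n.+1 (iA x ** a).
Proof.
move=> fa; apply: (span_lin (bilin_r (iA x) bA) _ fa) => _ [w hw ->].
by rewrite -wd_cons; exact: fil_wd.
Qed.

Let filM m n a c : fil m a -> fil n c -> fil (m + n) (a ** c).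
Proof.
move=> fa fc; apply: (span_lin (bilin_l c bA) _ fa) => _ [w hw ->].
apply: (@fil_mono (size w + n)); first by rewrite leq_add2r.
elim: w {fa hw} => [|x w IH]; first by rewrite wd1 (hmul1 Aal).
by rewrite wd_cons -(hmulA Aal); exact: fil_iA.
Qed.

(** The commutator with [x] replaces one letter by a bracket and so does not lengthen words: the
    associated graded algebra is commutative. *)
Let fil_comm x n a : fil n a -> fil n (iA x ** a - a ** iA x).
Proof.
have l : linear (fun a => iA x ** a - a ** iA x) by lin.
move=> fa; refine (span_lin l _ fa) => _ [w hw ->] {fa a}; rewrite -/(fil _ _).
elim: w n hw => [|y w IH] n hw.
  by rewrite wd1 (hmul1 Aal) (hmulr1 Aal) subrr; exact: span0.
have -> : iA x ** wd (y :: w) - wd (y :: w) ** iA x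
   = iA (lie x y) ** wd w + iA y ** (iA x ** wd w - wd w ** iA x).
  rewrite wd_cons -iA_lie (linEB (bilin_l _ bA)) (linEB (bilin_r _ bA)) !(hmulA Aal).
  by rewrite addrA addrNK.
by case: n hw => // n hw; apply: spanD; apply: fil_iA; [exact: fil_wd|exact: IH].
Qed.

Let tfil n : tensor A A -> Prop :=
  span (fun t => exists i p q, [/\ fil i p, fil (n - i) q, (i <= n)%N & t = p ⊠ q]).

Let cop_fil w : tfil (size w) (hcop (wd w)).
Proof.
elim: w => [|x w IH].
  rewrite wd1 cop1; apply: span_incl; exists 0%N, 𝟙, 𝟙.
  by split=> //; rewrite -wd1; exact: fil_wd.
rewrite cop_cons; apply: (span_lin (bilin_r _ bTA) _ IH) => _ [i [p [q [fp fq hi ->]]]].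
rewrite (linED (bilin_l _ bTA)) !TA_pure !(hmul1 Aal); apply: spanD; apply: span_incl.
  by exists i.+1, (iA x ** p), q; split=> //; exact: fil_iA.
exists i, p, (iA x ** q); split=> //; first by rewrite subSn //; exact: fil_iA.
exact: leqW.
Qed.

Let muD (a : A) : A := tliftS (@hmul k A) (hcop a).
Let muD_lin : linear muD. Proof. by rewrite /muD; lin. Qed.

Let mu_fil n t : tfil n t -> fil n (tliftS (@hmul k A) t).
Proof.
move=> ft; refine (span_lin (tlift_lin bA) _ ft) => _ [i [p [q [fp fq hi ->]]]].
by rewrite (tliftP _ _ bA) -(subnKC hi); exact: filM.
Qed.

(** The letter x enters either leg of the coproduct; moving it out of the right leg to the front
    costs a commutator, which stays in the same filtration step. *)
Let muD_cons x w : fil (size w) (muD (wd (x :: w)) - (iA x ** muD (wd w)) *+ 2).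
Proof.
rewrite /muD cop_cons; have ft := cop_fil w.
have l : linear (fun t => tliftS (@hmul k A) (TA (iA x ⊠ 𝟙 + 𝟙 ⊠ iA x) t)
    - (iA x ** tliftS (@hmul k A) t + iA x ** tliftS (@hmul k A) t)) by lin.
rewrite mulr2n; refine (span_lin l _ ft) => _ [i [p [q [fp fq hi ->]]]].
rewrite (linED (bilin_l _ bTA)) !TA_pure !(hmul1 Aal) (linED (tlift_lin bA)) !(tliftP _ _ bA).
have -> : iA x ** p ** q + p ** (iA x ** q) - (iA x ** (p ** q) + iA x ** (p ** q))
    = - ((iA x ** p - p ** iA x) ** q).
  rewrite (linEB (bilin_l _ bA)) !(hmulA Aal) opprB opprD addrA.
  by rewrite (addrC (_ ** _ ** q)) addrK.
apply: spanN; rewrite -/(fil _ _) -(subnKC hi).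
by apply: filM => //; exact: fil_comm.
Qed.

Let muD_fil n a : fil n a -> fil n (muD a).
Proof.
move=> fa; refine (span_lin muD_lin _ fa) => _ [w hw ->].
by apply: (fil_mono hw); apply: mu_fil; exact: cop_fil.
Qed.

(* Multiplication after comultiplication is 2^n in degree n of the associated graded
   algebra, but doubles every primitive element. *)
Let muD_top n a : fil n.+1 a -> fil n (muD a - a *+ 2 ^ n.+1).
Proof.
have l : linear (fun a => muD a - (2 ^ n.+1)%:R *: a).
  exact: (lin_D muD_lin (lin_N (lin_Z _ (@lin_id _ _)))).
rewrite -scaler_nat => fa; refine (span_lin l _ fa) => _ [w hw ->] {a fa l}.
rewrite -/(fil _ _) scaler_nat.
elim: w n hw => [|x w IH] n hw.
  have h0 : fil n (wd [::]) by exact: fil_wd.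
  by apply: spanB; [exact: muD_fil|rewrite -scaler_nat; exact: spanZ].
move: hw; rewrite leq_eqVlt => /predU1P[[e]|hw]; last first.
  have h0 : fil n (wd (x :: w)) by exact: fil_wd.
  by apply: spanB; [exact: muD_fil|rewrite -scaler_nat; exact: spanZ].
have -> : muD (wd (x :: w)) - wd (x :: w) *+ 2 ^ n.+1
    = (muD (wd (x :: w)) - (iA x ** muD (wd w)) *+ 2) + (iA x ** (muD (wd w) - wd w *+ 2 ^ n))
      *+ 2.
  rewrite (linEB (bilin_r _ bA)) mulrnBl addrA subrK wd_cons -!scaler_nat.
  rewrite (linEZ (bilin_r _ bA)) scalerA -natrM -expnS; reflexivity.
apply: spanD; first by rewrite -e; exact: muD_cons.
rewrite -scaler_nat; apply: spanZ; rewrite -/(fil _ _).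
(* For a single letter the tail is empty and the remaining bracket is zero; the induction hypothesis
   starts only at exponent 1. *)
case: n e => [/size0nil ->|n e]; last by apply: fil_iA; apply: IH; rewrite e.
rewrite /muD wd1 cop1 (tliftP _ _ bA) (hmul1 Aal) mulr1n subrr.
by rewrite (linE0 (bilin_r _ bA)); exact: span0.
Qed.

Lemma primitive_iA (a : A) : [pchar k] =i pred0 -> hcou a = 0 ->
  hcop a = a ⊠ 𝟙 + 𝟙 ⊠ a -> exists x, a = iA x.
Proof.
move=> ch a0 ap.
have mu_a : muD a = a *+ 2.
  by rewrite /muD ap (linED (tlift_lin bA)) !(tliftP _ _ bA) (hmul1 Aal) (hmulr1 Aal).
have step n : fil n.+2 a -> fil n.+1 a.
  (* The scalar 2 - 2^(n+2) is invertible in characteristic zero, so a primitive element descends in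
     the filtration until degree one. *)
  move=> /muD_top; rewrite mu_a -!scaler_nat -scalerBl; set c := _ - _ => h.
  have cn : c != 0.
    have le2 : (2 <= 2 ^ n.+2)%N by rewrite -{1}(expn1 2) leq_exp2l.
    rewrite /c -opprB oppr_eq0 -natrB // ((pcharf0P k).1 ch) subn_eq0 -ltnNge.
    by rewrite -{1}(expn1 2) ltn_exp2l.
  by rewrite -[a]scale1r -(mulVf cn) -scalerA; exact: spanZ.
have [n fn] : exists n, fil n a.
  elim: (A_span a) => [|c _ y [w ->] _ [n hn]]; first by exists 0%N; exact: span0.
  exists (maxn (size w) n); apply: spanZD; first by apply: fil_wd; exact: leq_maxl.
  exact: fil_mono (leq_maxr _ _) hn.
have f1 : fil 1 a.
  elim: n fn => [|[|n] IH] h //; first by apply: fil_mono h.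
  by apply/IH/step.
have [c [x ex]] : exists c x, a = c *: 𝟙 + iA x.
  elim: f1 => [|c _ y [w hw ->] _ [c' [x ->]]].
    by exists 0, 0; rewrite scale0r (linE0 iA_lin) addr0.
  case: w hw => [|z [|//]] _.
    by exists (c + c'), x; rewrite wd1 scalerDl addrA.
  exists c', (c *: z + x); rewrite wd_cons wd1 (hmulr1 Aal) iA_lin.
  by rewrite addrCA.
(* The counit kills [a] and [iA x], hence also the constant term [c]. *)
exists x; move: a0; rewrite ex (cou_lin c) cou1 cou_iA addr0 => h.
have -> : c = 0 by rewrite -h -[RHS]/(c * 1) mulr1.
by rewrite scale0r add0r.
Qed.

End PrimitiveElements.

Lemma env_primitive (k : fieldType) (g : lieAlgType k) (a : Uenv g) : [pchar k] =i pred0 ->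
  hcou a = 0 -> hcop a = a ⊠ hone (Uenv g) + hone (Uenv g) ⊠ a -> exists x, a = uin x.
Proof.
move=> ch a0 ap; exact: (primitive_iA (@env_graded k g) (@env_graded_algebra k g) (@uin_lin k g)
  (A := Uenv g)
  (wd := @pword k g (@env_rel k g))
  (erefl _) (fun x w => esym (@env_mulE k g [:: x] w)) (@palg_span _ _ _)
  (fun x y => esym (uin_lie x y)) (@env_cop_lin k g) (@env_cop1 k g) (@env_cop_cons k g)
  (@env_tmul k g) (@env_cou_lin k g) (@env_cou1 k g) (@env_cou_uin k g) ch a0 ap).
Qed.

(** * Restricting augmentations to degree one *)

Section AugmentationRestriction.
Variables (k : fieldType) (g : lieAlgType k) (V : lmodType k) (act : V -> g -> V).
Variables (A O : superHopfData k) (iA : g -> A) (in0 : A -> O) (in1 : V -> O) (rho : O -> A).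
Local Notation "a ** b" := (@hmul k A a b) (at level 37, left associativity).
Local Notation "s ⋆ t" := (@hmul k O s t) (at level 37, left associativity).
Local Notation PO := (parityS (@hcomp k O)).
Hypotheses (Aal : graded_algebra A) (Ogr : graded (@hcomp k O)) (Oal : graded_algebra O).
Hypotheses (iA_lin : linear iA) (iA_inj : injective iA).
Hypothesis iA_lie : forall x y, iA x ** iA y - iA y ** iA x = iA (lie x y).
Hypothesis Acounitl : forall a : A, tliftS (fun b c : A => hcou b *: c) (hcop a) = a.
Hypotheses (Acou_lin : linear (fun a : A => hcou a : k^o)) (Acou1 : hcou (hone A) = 1).
Hypotheses (in0_lin : linear in0) (in01 : in0 (hone A) = hone O).
Hypothesis in0M : forall a b, in0 (a ** b) = in0 a ⋆ in0 b.
Hypothesis in0_cop : forall a, hcop (in0 a) = tmapS in0 in0 (hcop a).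
Hypotheses (rho_lin : linear rho) (rho_in0 : forall a, rho (in0 a) = a).
Hypothesis comp0 : forall s, hcomp 0 s = in0 (rho s).
Hypotheses (in1_lin : linear in1) (in1_inj : injective in1).
Hypothesis in1_comp : forall v, hcomp 1 (in1 v) = in1 v.
Hypothesis in1_cop : forall v, hcop (in1 v) = in1 v ⊠ hone O + hone O ⊠ in1 v.
Hypothesis in1_sq : forall v, in1 v ⋆ in1 v = 0.
Hypothesis in1_comm : forall v x, in1 v ⋆ in0 (iA x) - in0 (iA x) ⋆ in1 v = in1 (act v x).

Variable i : O -> O.
Hypothesis aug : augmentation i.

Let bO : bilin (@hmul k O). Proof. by case: Oal. Qed.
Let i_lin : linear i. Proof. by case: aug. Qed.
Let i_der s t : i (s ⋆ t) = i s ⋆ t + PO s ⋆ i t.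
Proof. by have [_ _ _ d _] := aug; rewrite d paritySE. Qed.

Lemma in0_comp a : hcomp 0 (in0 a) = in0 a. Proof. by rewrite comp0 rho_in0. Qed.

Lemma aug_in0 a : i (in0 a) = 0.
Proof. by have [_ [h _] _ _ _] := aug; rewrite -in0_comp h. Qed.

Let i1 : i (hone O) = 0. Proof. by rewrite -in01 aug_in0. Qed.

Lemma aug_in1 v : i (in1 v) = in0 (rho (i (in1 v))).
Proof. by have [_ [_ h] _ _ _] := aug; rewrite -comp0 -[in1 v]in1_comp h. Qed.

(** Since i(1) = 0 and parity fixes 1, the coderivation rule on the primitive element v leaves only
    i(v) ⊗ 1 and 1 ⊗ i(v); the retraction [rho] carries this back to [A]. *)
Lemma aug_in1_cop v :
  hcop (rho (i (in1 v))) = rho (i (in1 v)) ⊠ hone A + hone A ⊠ rho (i (in1 v)).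
Proof.
set a := rho _; have [_ _ _ _ cd] := aug; have rl := rho_lin; have pl := parity_lin Ogr.
have h : hcop (in0 a) = in0 a ⊠ hone O + hone O ⊠ in0 a.
  rewrite /a -aug_in1 cd tmapSE paritySE in1_cop.
  have l1 : linear (tmapS i (@id O)) by lin.
  have l2 : linear (tmapS PO i) by lin.
  rewrite (linED l1) (linED l2) !tmapP; [|lin..].
  rewrite i1 tpure0l tpure0r addr0 add0r.
  by rewrite (parity_one Ogr Oal).
have e t : tmapS rho rho (tmapS in0 in0 t) = t.
  have nl := in0_lin; move: t; on_pure => b c.
  by tsimp; rewrite !rho_in0.
have l : linear (tmapS rho rho) by lin.
rewrite -[LHS]e -in0_cop h (linED l) !tmapP; [|lin..].
by rewrite -in01 !rho_in0.
Qed.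

(** For primitive a the counit axiom reads a = ε(a) 1 + a. *)
Lemma aug_in1_cou v : hcou (rho (i (in1 v))) = 0.
Proof.
have := Acounitl (rho (i (in1 v))); rewrite aug_in1_cop; set a := rho _.
have cl := Acou_lin.
have l : bilin (fun b c : A => hcou b *: c) by lin.
rewrite (linED (tlift_lin l)) !(tliftP _ _ l) Acou1 scale1r => /eqP.
rewrite -subr_eq0 addrK => /eqP e; have := cl (hcou a) (hone A) 0; rewrite e addr0.
have c0 : hcou (0 : A) = 0 := linE0 (V := k^o) cl.
by rewrite c0 Acou1 addr0 -[_ *: _]/(hcou a * 1) mulr1.
Qed.

Section Restriction.
Variable j : V -> g.
Hypothesis ij : forall v, i (in1 v) = in0 (iA (j v)).

Lemma aug_compatible : compatible_map act j.
Proof.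
have in0_inj : injective in0 by move=> a b e; rewrite -(rho_in0 a) e rho_in0.
split.
- move=> c u v; apply/iA_inj/in0_inj; rewrite -ij in1_lin i_lin !ij.
  by rewrite iA_lin in0_lin.
- move=> v x; apply/iA_inj/in0_inj; rewrite -ij -in1_comm (linEB i_lin) !i_der aug_in0 ij.
  rewrite (parity_hom Ogr (in0_comp _)) expr0 scale1r.
  rewrite (linE0 (bilin_r _ bO)) (linE0 (bilin_l _ bO)) addr0 add0r.
  by rewrite -!in0M -(linEB in0_lin) iA_lie.
- move=> v; apply: in1_inj; rewrite -in1_comm (linE0 in1_lin).
  have := f_equal i (in1_sq v); rewrite i_der (linE0 i_lin) ij.
  rewrite (parity_hom Ogr (in1_comp v)) expr1 scaleN1r (linEN (bilin_l _ bO)).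
  by move/eqP; rewrite subr_eq0 => /eqP ->; rewrite subrr.
Qed.

End Restriction.

Lemma aug_restriction : [pchar k] =i pred0 ->
  (forall a : A, [pchar k] =i pred0 -> hcou a = 0 ->
    hcop a = a ⊠ hone A + hone A ⊠ a -> exists x, a = iA x) ->
  forall v, exists x, i (in1 v) = in0 (iA x).
Proof.
move=> ch prim v; have [x e] := prim _ ch (aug_in1_cou v) (aug_in1_cop v).
by exists x; rewrite aug_in1 e.
Qed.

Lemma aug_unique_restriction : (forall v, exists x, i (in1 v) = in0 (iA x)) ->
  exists! j : V -> g, compatible_map act j /\ forall v, i (in1 v) = in0 (iA (j v)).
Proof.
move=> h; have [j ij] := choice h; exists j; split.
  by split=> //; exact: aug_compatible.
move=> j' [_ ij']; apply/funext => v; apply: iA_inj.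
by rewrite -(rho_in0 (iA (j v))) -ij ij' rho_in0.
Qed.

Section LieDerivative.
Variables (d : O -> O) (om : g -> V) (omA : A -> V).
Hypotheses (d_lin : linear d) (d_in1 : forall v, d (in1 v) = 0).
Hypothesis d_iA : forall x, d (in0 (iA x)) = in1 (om x).
Hypothesis d_prim : forall a, hcop a = a ⊠ hone A + hone A ⊠ a -> d (in0 a) = in1 (omA a).

Lemma lie_derivative_in0 x :
  lie_derivative d i (in0 (iA x)) = in0 (rho (i (in1 (om x)))).
Proof. by rewrite /lie_derivative aug_in0 (linE0 d_lin) add0r d_iA [LHS]aug_in1. Qed.

Lemma lie_derivative_in1 v :
  lie_derivative d i (in1 v) = in1 (omA (rho (i (in1 v)))).
Proof.
rewrite /lie_derivative d_in1 (linE0 i_lin) addr0 (f_equal d (aug_in1 v)).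
by apply: d_prim; exact: aug_in1_cop.
Qed.

End LieDerivative.
End AugmentationRestriction.

Lemma lie_right_module (k : fieldType) (g : lieAlgType k) : right_module (@lie k g).
Proof.
split; first by split; [exact: lie_linearl|exact: lie_linearr].
move=> v x y; have := lie_jacobi v x y.
rewrite (lie_anti y (lie v x)) (lie_anti x (lie y v)) (lie_anti y v).
rewrite (linEN (lie_linearl x)) opprK => /eqP; rewrite subr_eq0 => /eqP <-.
by rewrite addrK.
Qed.

(** * The calculus on U(g), its augmentations and Lie derivatives *)

Section OmegaCalculus.
Variables (k : fieldType) (g : lieAlgType k) (V : lmodType k) (act : V -> g -> V).
Hypothesis hact : right_module act.
Local Notation A := (Uenv g).
Local Notation L := (Lam V).
Local Notation O := (Omega act).
Local Notation "𝟙A" := (hone A).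
Local Notation "𝟙L" := (hone L).
Let Aal := @env_graded_algebra k g.
Let Ogr := omega_graded hact.
Let Oal := omega_graded_algebra hact.

Lemma Omega0E a : Omega0 act a = a ⊠ 𝟙L. Proof. by rewrite /Omega0 tpureSE. Qed.
Lemma Omega1E v : Omega1 act v = 𝟙A ⊠ lam1 v. Proof. by rewrite /Omega1 tpureSE. Qed.

Lemma Omega0_lin : linear (Omega0 act).
Proof. by rewrite /Omega0 tpureSE; exact: tpure_linl. Qed.

Lemma Omega1_lin : linear (Omega1 act).
Proof.
rewrite /Omega1 tpureSE.
exact: (lin_comp (@tpure_linr k A L 𝟙A) (@lam1_lin k V)).
Qed.

(** The map id ⊗ ε, a retraction onto the degree 0 part along the positive degrees. *)
Definition omega_rho : O -> A := tliftS (fun (a : A) (e : L) => hcou e *: a).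

Let rho_bil : bilin (fun (a : A) (e : L) => hcou e *: a).
Proof.
split=> [e|a]; first exact: (lin_Z _ (@lin_id _ _)).
exact: (lin_Zl a (@lam_cou_lin k V)).
Qed.

Lemma omega_rho_lin : linear omega_rho. Proof. exact: tlift_lin rho_bil. Qed.

Lemma omega_rho0 a : omega_rho (Omega0 act a) = a.
Proof.
rewrite Omega0E; refine (etrans (tliftP a 𝟙L rho_bil) _).
by rewrite (lam_cou1 V) scale1r.
Qed.

Lemma Omega0_inj : injective (Omega0 act).
Proof. by move=> a b e; rewrite -(omega_rho0 a) e omega_rho0. Qed.

Lemma Omega1_inj : injective (Omega1 act).
Proof.
have bl : bilin (fun (a : A) (e : L) => hcou a *: e).
  split=> [e|a]; first exact: (lin_Zl e (@env_cou_lin k g)).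
  exact: (lin_Z _ (@lin_id _ _)).
have K v : tliftS (fun (a : A) (e : L) => hcou a *: e) (Omega1 act v) = lam1 v.
  rewrite Omega1E; refine (etrans (tliftP 𝟙A (lam1 v : L) bl) _).
  by rewrite (env_cou1 g) scale1r.
by move=> u v e; apply: lam1_inj; rewrite -(K u) e K.
Qed.

Lemma lam_comp0 (e : L) : hcomp 0 e = hcou e *: 𝟙L.
Proof.
have l := graded_lin (@lam_graded k V) 0; have cl := lin_Zl 𝟙L (@lam_cou_lin k V).
move: e; refine (palg_ext l cl _) => w; rewrite lam_compE lam_couE.
by case: w => [|v w] /=; rewrite ?scale1r ?scale0r.
Qed.

Lemma omega_comp0 s : hcomp 0 s = Omega0 act (omega_rho s).
Proof.
have l := graded_lin Ogr 0; have l2 := lin_comp Omega0_lin omega_rho_lin.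
move: s; refine (tensor_ext l l2 _) => a e.
refine (etrans (omega_compP act 0 a e) _).
rewrite Omega0E (_ : omega_rho _ = hcou e *: a); last exact: (tliftP a e rho_bil).
rewrite (linEZ (@tpure_linl k A L 𝟙L)) -(linEZ (@tpure_linr k A L a)).
exact: f_equal (lam_comp0 e).
Qed.

Lemma Omega0_comp0 x : hcomp 0 x = x <-> exists a, x = Omega0 act a.
Proof.
split=> [<-|[a ->]]; first by exists (omega_rho x); exact: omega_comp0.
by rewrite omega_comp0 omega_rho0.
Qed.

Lemma Omega0M a b : Omega0 act (hmul a b) = hmul (Omega0 act a) (Omega0 act b).
Proof. by rewrite !Omega0E; exact: esym (omega_mul_A hact a b 𝟙L). Qed.

Lemma Omega0_one : Omega0 act 𝟙A = hone O.
Proof. by rewrite Omega0E; exact: esym (omega_one act). Qed.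

Lemma Omega0_cop a : hcop (Omega0 act a) = tmapS (Omega0 act) (Omega0 act) (hcop a).
Proof.
have e : Omega0 act = fun a => a ⊠ 𝟙L by apply/funext => b; exact: Omega0E.
by rewrite e; exact: (omega_cop_A act a).
Qed.

Lemma Omega0_cou a : hcou (Omega0 act a) = hcou a.
Proof. by rewrite Omega0E (omega_couP act a 𝟙L) (lam_cou1 V) mulr1. Qed.

Lemma Omega0_morphism : hopf_morphism (Omega0 act).
Proof.
split; [exact: Omega0_lin|exact: Omega0M|exact: Omega0_one| |exact: Omega0_cou].
by move=> x; rewrite tmapSE; exact: Omega0_cop.
Qed.

Lemma Omega1_comp v : hcomp 1 (Omega1 act v) = Omega1 act v.
Proof.
by rewrite Omega1E (omega_compP act 1 𝟙A (lam1 v)) (lam1_comp v).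
Qed.

Lemma Omega1_cop v :
  hcop (Omega1 act v) = Omega1 act v ⊠ hone O + hone O ⊠ Omega1 act v.
Proof. by rewrite Omega1E; exact: (omega_cop_lam1 act v). Qed.

Lemma Omega1_sq v : hmul (Omega1 act v) (Omega1 act v) = 0.
Proof.
rewrite Omega1E (omega_mulP_L hact 𝟙A (lam1 v) (lam1 v)) lam1_sq.
exact: (linE0 (@tpure_linr k A L 𝟙A)).
Qed.

Lemma Omega1_comm v x :
  hmul (Omega1 act v) (Omega0 act (uin x)) - hmul (Omega0 act (uin x)) (Omega1 act v)
  = Omega1 act (act v x).
Proof.
rewrite !Omega1E Omega0E (omega_mulP_uin hact 𝟙A (lam1 v) x).
rewrite (omega_mul_A hact (uin x) 𝟙A (lam1 v)) (hmul1 Aal (uin x)) (hmulr1 Aal (uin x)).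
by rewrite (gact_lam1 hact v x) addrC addKr.
Qed.

Let Acounitl (a : A) : tliftS (fun b c : A => hcou b *: c) (hcop a) = a.
Proof.
have [_ _ [_ _ _ h _] _ _] := @env_super_hopf k g.
by have [] := h a; rewrite tliftSE.
Qed.

(** For uniqueness: an augmentation vanishes on U(g) for degree reasons and is prescribed on V, and
    these generate. *)
Lemma omega_aug_exists (j : V -> g) : compatible_map act j ->
  exists! i : O -> O, augmentation i /\ restricts_to act i j.
Proof.
move=> hj; exists (@omega_aug k g V act j); split.
  split; first exact: omega_augmentation.
  by move=> v; rewrite Omega1E Omega0E; exact: omega_aug_lam1.
move=> i [ai ri]; apply/funext => s.
have [l0 [z0 _] _ d0 _] := omega_augmentation hact hj; have [l1 [z1 _] _ d1 _] := ai.
have in0 (f : O -> O) a : (forall x, f (hcomp 0 x) = 0) -> f (Omega0 act a) = 0.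
  by move=> h; rewrite -(omega_rho0 a) -omega_comp0.
refine (omega_derivation_ext hact l0 l1 _ d0 d1 _ _ s) => [|x|v].
- by rewrite -Omega0_one !in0.
- by rewrite -Omega0E !in0.
- rewrite -[X in i X]Omega1E ri Omega0E; exact: (omega_aug_lam1 hact hj).
Qed.

Section Augmentation.
Variable i : O -> O.
Hypothesis ai : augmentation i.

Lemma omega_aug_converse : [pchar k] =i pred0 \/
    (forall v, exists x, i (Omega1 act v) = Omega0 act (uin x)) ->
  exists! j : V -> g, compatible_map act j /\ restricts_to act i j.
Proof.
move=> h.
apply: (aug_unique_restriction Ogr Oal (@uin_lin k g) (@uin_inj k g)
  (fun x y => esym (uin_lie x y)) Omega0_lin Omega0M omega_rho0 omega_comp0
  Omega1_lin Omega1_inj Omega1_comp Omega1_sq Omega1_comm ai).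
case: h => // ch.
exact: (aug_restriction Ogr Oal Acounitl (@env_cou_lin k g) (@env_cou1 k g) Omega0_lin
  Omega0_one Omega0_cop
  omega_rho_lin omega_rho0 omega_comp0 Omega1_comp Omega1_cop ai ch
  (@env_primitive k g)).
Qed.

Section CalculusLieDerivative.
Variable om : g -> V.
Hypothesis hom : cocycle act om.
Local Notation d := (woronowicz_d act om (fun=> 0)).

Lemma omega_d_Omega1 v : d (Omega1 act v) = 0.
Proof. by rewrite Omega1E; exact: (omega_d_L hact hom (lam1 v)). Qed.

Lemma omega_d_Omega0 (a : A) : hcop a = a ⊠ 𝟙A + 𝟙A ⊠ a ->
  d (Omega0 act a) = Omega1 act (omext act om a).
Proof.
move=> ha; rewrite Omega0E Omega1E; refine (etrans (omega_d_prim hact hom 𝟙L ha) _).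
exact: f_equal (hmulr1 (@lam_graded_algebra k V) _).
Qed.

Lemma omega_d_uin x : d (Omega0 act (uin x)) = Omega1 act (om x).
Proof. by rewrite (omega_d_Omega0 (env_cop_uin x)) (omext_uin hact hom). Qed.

(** Kept in U(g), because in positive characteristic it may be a primitive element outside [g]. *)
Definition aug_value (v : V) : A := omega_rho (i (Omega1 act v)).

Lemma aug_valueP :
  [/\ linear aug_value, forall v, hcou (aug_value v) = 0,
      forall v, i (Omega1 act v) = Omega0 act (aug_value v),
      forall x, lie_derivative d i (Omega0 act (uin x)) = Omega0 act (aug_value (om x)) &
      forall v, lie_derivative d i (Omega1 act v) = Omega1 act (omext act om (aug_value v))].
Proof.
have [il _ _ _ _] := ai; split.
- exact: (lin_comp omega_rho_lin (lin_comp il Omega1_lin)).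
- exact: (aug_in1_cou Ogr Oal Acounitl (@env_cou_lin k g) (@env_cou1 k g) Omega0_lin Omega0_one
    Omega0_cop omega_rho_lin omega_rho0 omega_comp0 Omega1_comp Omega1_cop ai).
- exact: (aug_in1 omega_comp0 Omega1_comp ai).
- exact: (lie_derivative_in0 omega_rho0 omega_comp0 Omega1_comp ai (omega_d_lin hact hom)
  omega_d_uin).
- exact: (lie_derivative_in1 Ogr Oal Omega0_lin Omega0_one Omega0_cop omega_rho_lin omega_rho0
    omega_comp0 Omega1_comp Omega1_cop ai omega_d_Omega1 omega_d_Omega0).
Qed.

End CalculusLieDerivative.
End Augmentation.

Lemma omega_strongly_bicovariant (om : g -> V) : cocycle act om ->
  strongly_bicovariant (Omega0 act) (woronowicz_d act om (fun=> 0)).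
Proof.
move=> hom; split.
- exact: env_hopf.
- exact: omega_super_hopf.
- by split; [exact: Omega0_morphism|exact: Omega0_inj|exact: Omega0_comp0].
- by split; [exact: omega_d_lin|exact: omega_d_comp|exact: omega_d_sq].
- by split; [exact: omega_d_derivation|exact: omega_d_coderivation].
Qed.

End OmegaCalculus.

Theorem proposition4p7 (k : fieldType) (hk : 2%N \notin [pchar k])
    (g : lieAlgType k) (V : lmodType k) (act : V -> g -> V)
    (hact : right_module act) (om : g -> V) (hom : cocycle act om) :
  (* the crossed module V and the morphism om : U(g)^+ -> V *)
  [/\ crossed_module (uact act) (@trivial_coact k g V),
      forall v x, uact act v (uin x) = act v x,
      forall x, omext act om (uin x) = om x,
      forall (a : Uenv g) x, hcou a = 0 ->
        omext act om (hmul a (uin x)) = act (omext act om a) x &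
      aug_crossed_morphism (uact act) (@trivial_coact k g V) (omext act om)]
  /\
  (* Lambda(V) = B_-(V) is the Grassmann algebra of V *)
  [/\ super_hopf (Lam V),
      injective (@lam1 k V),
      forall eta : Lam V, hcomp 1 eta = eta <-> exists v, eta = lam1 v &
      forall x : falg k V,
        ideal (@Bminus_rel k V) x <-> ideal (@grassmann_rel k V) x]
  /\
  (* the calculus U(g) # Lambda(V), with delta = 0 *)
  let d := woronowicz_d act om (fun=> 0) in
  [/\ strongly_bicovariant (Omega0 act) d,
      forall eta : Lam V, d (hone (Uenv g) ⊗ eta) = 0,
      forall v x,
        hmul (Omega1 act v) (Omega0 act (uin x))
          - hmul (Omega0 act (uin x)) (Omega1 act v) = Omega1 act (act v x) &
      forall x, d (Omega0 act (uin x)) = Omega1 act (om x)]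
  /\
  (* augmentations *)
  [/\ forall j : V -> g, compatible_map act j ->
        exists! i : Omega act -> Omega act,
          augmentation i /\ restricts_to act i j,
      forall i : Omega act -> Omega act, augmentation i ->
        [pchar k] =i pred0 \/
          (forall v, exists x, i (Omega1 act v) = Omega0 act (uin x)) ->
        exists! j : V -> g, compatible_map act j /\ restricts_to act i j,
      forall i : Omega act -> Omega act, augmentation i ->
        exists r : V -> Uenv g,
          [/\ linear r, forall v, hcou (r v) = 0,
              forall v, i (Omega1 act v) = Omega0 act (r v),
              forall x, lie_derivative d i (Omega0 act (uin x))
                          = Omega0 act (r (om x)) &
              forall v, lie_derivative d i (Omega1 act v)
                          = Omega1 act (omext act om (r v))] &
      forall (i : Omega act -> Omega act) (j : V -> g),
        augmentation i -> restricts_to act i j ->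
        (forall x, lie_derivative d i (Omega0 act (uin x))
                     = Omega0 act (uin (j (om x)))) /\
        (forall v, lie_derivative d i (Omega1 act v)
                     = Omega1 act (om (j v)))]
  /\
  (* the canonical choice V = g *)
  [/\ right_module (@lie k g), injective (@uin k g),
      forall x : g, hcou (uin x) = 0 &
      compatible_map (@lie k g) id /\
      exists! i : Omega (@lie k g) -> Omega (@lie k g),
        augmentation i /\ restricts_to (@lie k g) i id].
Proof.
split; last split; last (move=> d; split; last split).
- split; [exact: uact_crossed|exact: uact_uin|exact: omext_uin| |exact: omext_crossed].
  by move=> a x a0; rewrite (omextM hact hom) a0 scale0r addr0 (uact_uin hact).
- by split; [exact: lam_super_hopf|exact: lam1_inj|exact: lam_deg1|exact: Bminus_ideal].
- split.
  + exact: omega_strongly_bicovariant.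
  + by move=> eta; rewrite tpureSE; exact: omega_d_L.
  + exact: Omega1_comm.
  + exact: omega_d_uin.
- split.
  + exact: omega_aug_exists.
  + exact: omega_aug_converse.
  + by move=> i ai; exists (aug_value i); exact: aug_valueP.
  + move=> i j ai ij; have [_ _ e e0 e1] := aug_valueP hact ai hom.
    (* Injectivity of U(g) in the calculus identifies the general U(g)-valued restriction with [j],
       and the general formulas specialise. *)
    have ej v : aug_value i v = uin (j v).
      by apply: (@Omega0_inj _ _ _ act); rewrite -e ij.
    split=> [x|v].
      by refine (etrans (e0 x) _); exact: (f_equal (Omega0 act) (ej (om x))).
    refine (etrans (e1 v) _); refine (f_equal (Omega1 act) _).
    by refine (etrans (f_equal (omext act om) (ej v)) _); exact: omext_uin.
(* For the adjoint action the condition v <| i(v) = 0 is the alternating law of the bracket. *)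
- have hc : compatible_map (@lie k g) id.
    by split=> // v; exact: lie_alt.
  split; [exact: lie_right_module|exact: uin_inj|exact: env_cou_uin|split=> //].
  exact: (omega_aug_exists (@lie_right_module k g) hc).
Qed.
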